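(* There is a deterministic algorithm that, given a history DAG $\mathbb G$ of size $O(n)$ constructed over a set $S$ of $n$ pairwise interior disjoint $x$-monotone curves, computes in worst-case $O(n\log n)$ time and $O(n)$ space the maximum ply of the collection $\mathcal T^*$ of all (open) trapezoids created during the construction of $\mathbb G$.
   Context: General position (standing assumption): no two distinct endpoints of curves have the same $x$-coordinate and no endpoint of one curve lies in the interior of another curve (curves may share endpoints). The trapezoidal map $\mathcal T(S)$ is obtained by extending a vertical wall from each endpoint upwards and downwards until it hits a curve of $S$ or goes to infinity; its faces are called trapezoids, considered open. History DAG $\mathbb G$ for an insertion order $cv_1,\dots,cv_n$ of $S$, with $S_i=\{cv_1,\dots,cv_i\}$: $\mathbb G_0$ is a single leaf (the whole plane). The leaves of $\mathbb G_i$ are the trapezoids of $\mathcal T(S_i)$. To pass from $\mathbb G_{i-1}$ to $\mathbb G_i$, let $p_i,q_i$ be the left and right endpoints of $cv_i$. Each leaf whose open trapezoid $\Delta$ is intersected by $cv_i$ is replaced by the following nodes, from top to bottom: if $p_i\in\Delta$, a point node $p_i$ whose left child is the leaf for the part of $\Delta$ left of $p_i$, and whose right child is the rest; then, if $q_i\in\Delta$, a point node $q_i$ whose right child is the leaf for the part of $\Delta$ right of $q_i$, and whose left child is the rest; then a curve node $cv_i$ with one child leaf for the part of the remaining piece above $cv_i$ and one for the part below $cv_i$. Finally, neighbouring new pieces that belong to the same trapezoid of $\mathcal T(S_i)$ are merged into one shared leaf. $\mathbb G=\mathbb G_n$. $\mathcal T^*=\bigcup_{i=1}^n \mathcal T(S_i)$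 is the set of all trapezoids occurring in the intermediate trapezoidal maps. The ply of a point $p$ is the number of trapezoids in $\mathcal T^*$ that contain $p$, and the maximum ply is the maximum over all points $p$ of the plane. The model is the real RAM with constant-time elementary predicates on curves and their endpoints; the trapezoids of $\mathcal T^*$ (with their top and bottom curves and walls) are assumed to be recorded along with the DAG. *)

(* Defs.v *)
From HB Require Import structures.
From mathcomp Require Import all_boot all_order all_fingroup all_algebra.
From mathcomp Require Import all_classical all_reals all_analysis.

Set Implicit Arguments.
Unset Strict Implicit.
Unset Printing Implicit Defensive.

Import Order.TTheory GRing.Theory Num.Theory.
Import numFieldNormedType.Exports.

Local Open Scope classical_set_scope.
Local Open Scope ring_scope.

(** * x-monotone curves and trapezoidal maps *)

(* The graph of a continuous function over [cl, cr]; [cf] is irrelevant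
   outside that interval. Vertical segments need not be covered, as general
   position excludes them (their two endpoints have the same abscissa). *)
Record curve (R : realType) := Curve {
  cl : R;
  cr : R;
  cf : R -> R;
  cl_lt_cr : cl < cr;
  cf_cont : {within `[cl, cr], continuous cf} }.

(* [(c, false)] names the left endpoint of curve [c], [(c, true)] the right
   one. Curves may share endpoints, so a point may have several names. *)
Definition endpoint (n : nat) := ('I_n * bool)%type.

Section Geometry.
Variables (R : realType) (n : nat) (cv : 'I_n -> curve R).

Definition on_curve (C : curve R) : set (R * R) :=
  [set z | cl C <= z.1 <= cr C /\ z.2 = cf C z.1].
Definition curve_interior (C : curve R) : set (R * R) :=
  [set z | cl C < z.1 < cr C /\ z.2 = cf C z.1].
Definition above_curve (C : curve R) : set (R * R) :=
  [set z | cl C <= z.1 <= cr C /\ cf C z.1 < z.2].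
Definition below_curve (C : curve R) : set (R * R) :=
  [set z | cl C <= z.1 <= cr C /\ z.2 < cf C z.1].

Definition ptx (e : endpoint n) : R :=
  if e.2 then cr (cv e.1) else cl (cv e.1).
Definition pt (e : endpoint n) : R * R := (ptx e, cf (cv e.1) (ptx e)).

Definition interior_disjoint :=
  forall c1 c2 : 'I_n, c1 != c2 ->
    curve_interior (cv c1) `&` curve_interior (cv c2) = set0.

Definition general_position :=
  (forall e1 e2 : endpoint n, ptx e1 = ptx e2 -> pt e1 = pt e2) /\
  (forall (e : endpoint n) (c : 'I_n), ~ curve_interior (cv c) (pt e)).

Section Map.
Variable X : {set 'I_n}.  (* the curves inserted so far *)

(* [z] lies on a wall when no curve crosses the open vertical segment between
   [z] and some endpoint with the same abscissa. *)
Definition on_wall : set (R * R) :=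
  [set z | exists e : endpoint n, [/\ e.1 \in X, z.1 = ptx e &
     forall c y, c \in X -> on_curve (cv c) (z.1, y) ->
       ~ ((pt e).2 < y < z.2 \/ z.2 < y < (pt e).2)]].

Definition skeleton : set (R * R) :=
  [set z | on_wall z \/ exists2 c, c \in X & on_curve (cv c) z].

(* The (open) trapezoids: the faces of the trapezoidal map of the curves [X]. *)
Definition trapezoid (D : set (R * R)) :=
  exists2 z, ~ skeleton z & D = connected_component (~` skeleton) z.

End Map.

(** ** Insertion order, the collection of all trapezoids, and ply *)

Variable ins : 'S_n.  (* the i-th inserted curve is [ins i] *)

(* the first [i] inserted curves *)
Definition prefix_set (i : nat) : {set 'I_n} :=
  [set ins j | j : 'I_n & (j < i)%N]%SET.

Definition Tstar : set (set (R * R)) :=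
  [set D | exists2 i : nat, (1 <= i <= n)%N & trapezoid (prefix_set i) D].

Definition has_ply (z : R * R) (k : nat) :=
  ([set D | Tstar D /\ D z] #= `I_k)%card.

Definition is_max_ply (m : nat) :=
  (forall z, exists2 k, has_ply z k & (k <= m)%N) /\ (exists z, has_ply z m).

End Geometry.

(** * Recorded trapezoids and history DAGs *)

(* [None] means that the trapezoid is unbounded in that direction. A left or
   right wall is named by an endpoint that induces it. *)
Record trap (n : nat) := Trap {
  tr_top : option 'I_n;
  tr_bot : option 'I_n;
  tr_left : option (endpoint n);
  tr_right : option (endpoint n) }.

(* Nodes of a DAG have names in ['I_N]; the children of a point node are listed
   left child first, those of a curve node upper child first. *)
Inductive kind (n N : nat) :=
| Leaf
| PointNode of endpoint n & 'I_N & 'I_N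
| CurveNode of 'I_n & 'I_N & 'I_N.
Arguments Leaf {n N}.

(* A node that is, or was before being replaced, a leaf keeps the record of its
   trapezoid. *)
Record node (n N : nat) := Node {
  nd_trap : option (trap n);
  nd_kind : kind n N }.

(* [None] marks a name that is not in use yet. *)
Definition dag (n N : nat) := 'I_N -> option (node n N).

Section History.
Variables (R : realType) (n : nat) (cv : 'I_n -> curve R).

Definition between_walls (d : trap n) (x : R) :=
  (if tr_left d is Some e then ptx cv e < x else True) /\
  (if tr_right d is Some e then x < ptx cv e else True).

Definition region (d : trap n) : set (R * R) :=
  [set z | [/\ between_walls d z.1,
    if tr_bot d is Some c then cf (cv c) z.1 < z.2 else True &
    if tr_top d is Some c then z.2 < cf (cv c) z.1 else True]].

(* The top and bottom curves extend all the way between the two walls. This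
   makes [region] independent of the values of [cf] outside [cl, cr]. *)
Definition wf_trap (d : trap n) :=
  forall x, between_walls d x ->
    (if tr_bot d is Some c then cl (cv c) <= x <= cr (cv c) else True) /\
    (if tr_top d is Some c then cl (cv c) <= x <= cr (cv c) else True).

Section Step.
Variables (N : nat) (X : {set 'I_n}) (c : 'I_n) (G G' : dag n N).
(* One insertion: [c] is inserted into [G], giving [G'], and [X] is the set of
   curves inserted so far, [c] included. *)

Definition leaf_at (H : dag n N) (j : 'I_N) (d : trap n) :=
  H j = Some (Node (Some d) Leaf).

Definition hit (k : 'I_N) (d : trap n) :=
  leaf_at G k d /\ exists2 z, region d z & on_curve (cv c) z.

(* [j] is the leaf of [G'] that holds the piece [P]. Pieces lying in the same
   trapezoid get the same leaf, see [step_leaves_inj]. *)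
Definition holds_piece (P : set (R * R)) (j : 'I_N) :=
  exists2 d, leaf_at G' j d & P `<=` region d.

(* The leaf [k] of [G], with trapezoid [d], is replaced: [kq] is the node
   reached after the point node for the left endpoint, if there is one, and
   [kc] is the one reached after the point node for the right endpoint, if
   there is one. The topmost of the new nodes takes over the name [k]. *)
Definition replaced (k : 'I_N) (d : trap n) (kq kc : 'I_N) :=
  let p := (c, false) in
  let q := (c, true) in
  let D := region d in
  let D1 := [set z | D z /\ (D (pt cv p) -> ptx cv p < z.1)] in
  let D2 := [set z | D1 z /\ (D (pt cv q) -> z.1 < ptx cv q)] in
  let record_of j := if j == k then Some d else None in
  [/\ D (pt cv p) -> exists2 l,
        G' k = Some (Node (Some d) (PointNode p l kq)) &
        holds_piece [set z | D z /\ z.1 < ptx cv p] l,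
      ~ D (pt cv p) -> kq = k,
      D (pt cv q) -> exists2 r,
        G' kq = Some (Node (record_of kq) (PointNode q kc r)) &
        holds_piece [set z | D1 z /\ ptx cv q < z.1] r,
      ~ D (pt cv q) -> kc = kq &
      exists a b,
        [/\ G' kc = Some (Node (record_of kc) (CurveNode c a b)),
            holds_piece (D2 `&` above_curve (cv c)) a &
            holds_piece (D2 `&` below_curve (cv c)) b]].

Record dag_step : Prop := {
  step_keep : forall k nd, G k = Some nd -> ~ (exists d, hit k d) ->
    G' k = Some nd;
  step_replace : exists kq kc : 'I_N -> 'I_N,
    [/\ forall k d, hit k d -> replaced k d (kq k) (kc k),
        forall k d j, hit k d -> j \in [:: kq k; kc k] -> j != k -> G j = None,
        forall k1 d1 k2 d2 j, hit k1 d1 -> hit k2 d2 ->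
          j \in [:: kq k1; kc k1] -> j \in [:: kq k2; kc k2] -> k1 = k2 &
        forall j nd, G j = None -> G' j = Some nd ->
          nd_kind nd = Leaf \/
          exists k d, hit k d /\ j \in [:: kq k; kc k]];
  step_leaves : forall j t, G' j = Some (Node t Leaf) ->
    exists d, [/\ t = Some d, wf_trap d & trapezoid cv X (region d)];
  step_leaves_onto : forall D, trapezoid cv X D ->
    exists j d, leaf_at G' j d /\ region d = D;
  step_leaves_inj : forall j1 j2 d1 d2, leaf_at G' j1 d1 -> leaf_at G' j2 d2 ->
    region d1 = region d2 -> j1 = j2 }.

End Step.

(* [G] is the history DAG for the insertion order [ins]. It has exactly [N]
   nodes, whose names are in no particular order. *)
Definition history_dag (ins : 'S_n) (N : nat) (root : 'I_N)
    (G : 'I_N -> node n N) :=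
  exists H : nat -> dag n N,
    [/\ forall k, H 0%N k =
          if k == root then Some (Node (Some (Trap None None None None)) Leaf)
          else None,
        forall i : 'I_n,
          dag_step (prefix_set ins i.+1) (ins i) (H i) (H i.+1) &
        forall k, H n k = Some (G k)].

End History.

(** * The real RAM *)

(* Programs are finite texts over a finite family of arrays of integers and a
   finite family of arrays of reals, with indirect addressing. Array names are
   literals, so a fixed program using B cells per array uses O(B) space; its
   expressions have constant size, so an assignment or a test has unit cost. *)

Inductive iexp :=
| ILit of nat
| IInput of iexp             (* cell of the read-only input *)
| ILoad of nat & iexp        (* array, index *)
| IAdd of iexp & iexp
| ISub of iexp & iexp        (* truncated *)
| IMul of iexp & iexp
| IDiv of iexp & iexp.

Inductive rexp :=
| RInt of iexp
| RX of iexp                 (* coordinates of an endpoint *)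
| RY of iexp
| RLoad of nat & iexp
| RAdd of rexp & rexp
| RSub of rexp & rexp
| RMul of rexp & rexp
| RDiv of rexp & rexp.

Inductive bexp :=
| BEq of iexp & iexp
| BLt of iexp & iexp
| BRLt of rexp & rexp
| BNot of bexp
| BAnd of bexp & bexp
  (* endpoint strictly above / strictly below a curve *)
| BAbove of iexp & iexp
| BBelow of iexp & iexp
  (* two curves with the same left (right) endpoint: the first one is below the
     second one immediately to the right (left) of it *)
| BRightBelow of iexp & iexp
| BLeftBelow of iexp & iexp.

Inductive cmd :=
| CSkip
| CStore of nat & iexp & iexp
| CRStore of nat & iexp & rexp
| CSeq of cmd & cmd
| CIf of bexp & cmd & cmd
| CWhile of bexp & cmd.

Record state (R : realType) := State {
  imem : nat -> nat -> nat;
  rmem : nat -> nat -> R }.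

Definition init_state (R : realType) : state R :=
  State (fun _ _ => 0%N) (fun _ _ => 0).

Definition upd (T : Type) (m : nat -> nat -> T) (a i : nat) (v : T) :=
  fun a' i' => if (a' == a) && (i' == i) then v else m a' i'.

Definition omap2 (A B T : Type) (f : A -> B -> T) (x : option A) (y : option B) :=
  obind (fun a => omap (f a) y) x.

Section Semantics.
Variables (R : realType) (n : nat) (cv : 'I_n -> curve R).
Variable inp : seq nat.
Variable B : nat.  (* cells per array *)
Variable W : nat.  (* largest storable integer *)

(* Handles: curve [c] is the integer [c], its left and right endpoints are
   [2 c] and [2 c + 1]. *)
Definition curve_at (h : nat) : option 'I_n := insub h.
Definition endpoint_at (h : nat) : option (endpoint n) :=
  omap (fun c => (c, odd h)) (curve_at h./2).

(* Evaluation fails, with value [None], on a bad handle or address. *)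
Fixpoint ieval (s : state R) (e : iexp) : option nat :=
  match e with
  | ILit k => Some k
  | IInput e1 => obind (onth inp) (ieval s e1)
  | ILoad a e1 =>
      obind (fun i => if (i < B)%N then Some (imem s a i) else None) (ieval s e1)
  | IAdd e1 e2 => omap2 addn (ieval s e1) (ieval s e2)
  | ISub e1 e2 => omap2 subn (ieval s e1) (ieval s e2)
  | IMul e1 e2 => omap2 muln (ieval s e1) (ieval s e2)
  | IDiv e1 e2 => omap2 divn (ieval s e1) (ieval s e2)
  end.

Definition ceval s e := obind curve_at (ieval s e).
Definition peval s e := obind endpoint_at (ieval s e).

Fixpoint reval (s : state R) (e : rexp) : option R :=
  match e with
  | RInt e1 => omap (fun k => k%:R) (ieval s e1)
  | RX e1 => omap (fun p => (pt cv p).1) (peval s e1)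
  | RY e1 => omap (fun p => (pt cv p).2) (peval s e1)
  | RLoad a e1 =>
      obind (fun i => if (i < B)%N then Some (rmem s a i) else None) (ieval s e1)
  | RAdd e1 e2 => omap2 (fun x y => x + y) (reval s e1) (reval s e2)
  | RSub e1 e2 => omap2 (fun x y => x - y) (reval s e1) (reval s e2)
  | RMul e1 e2 => omap2 (fun x y => x * y) (reval s e1) (reval s e2)
  | RDiv e1 e2 => omap2 (fun x y => x / y) (reval s e1) (reval s e2)
  end.

Definition right_below (c1 c2 : 'I_n) : Prop :=
  pt cv (c1, false) = pt cv (c2, false) /\
  \forall x \near (ptx cv (c1, false))^'+, cf (cv c1) x < cf (cv c2) x.
Definition left_below (c1 c2 : 'I_n) : Prop :=
  pt cv (c1, true) = pt cv (c2, true) /\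
  \forall x \near (ptx cv (c1, true))^'-, cf (cv c1) x < cf (cv c2) x.

Fixpoint beval (s : state R) (b : bexp) : option bool :=
  match b with
  | BEq e1 e2 => omap2 (fun i j : nat => i == j) (ieval s e1) (ieval s e2)
  | BLt e1 e2 => omap2 (fun i j : nat => (i < j)%N) (ieval s e1) (ieval s e2)
  | BRLt e1 e2 => omap2 (fun x y : R => x < y) (reval s e1) (reval s e2)
  | BNot b1 => omap negb (beval s b1)
  | BAnd b1 b2 => omap2 andb (beval s b1) (beval s b2)
  | BAbove e1 e2 =>
      omap2 (fun p c => `[< above_curve (cv c) (pt cv p) >])
        (peval s e1) (ceval s e2)
  | BBelow e1 e2 =>
      omap2 (fun p c => `[< below_curve (cv c) (pt cv p) >])
        (peval s e1) (ceval s e2)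
  | BRightBelow e1 e2 =>
      omap2 (fun c1 c2 => `[< right_below c1 c2 >]) (ceval s e1) (ceval s e2)
  | BLeftBelow e1 e2 =>
      omap2 (fun c1 c2 => `[< left_below c1 c2 >]) (ceval s e1) (ceval s e2)
  end.

(* [exec p s t s']: started in [s], program [p] halts in [s'] after [t] steps,
   without ever failing, leaving its [B]-cell arrays or storing an integer
   greater than [W]. *)
Inductive exec : cmd -> state R -> nat -> state R -> Prop :=
| ExSkip s : exec CSkip s 1 s
| ExStore a e1 e2 s i v :
    ieval s e1 = Some i -> ieval s e2 = Some v -> (i < B)%N -> (v <= W)%N ->
    exec (CStore a e1 e2) s 1 (State (upd (imem s) a i v) (rmem s))
| ExRStore a e1 e2 s i v :
    ieval s e1 = Some i -> reval s e2 = Some v -> (i < B)%N ->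
    exec (CRStore a e1 e2) s 1 (State (imem s) (upd (rmem s) a i v))
| ExSeq p1 p2 s s1 s2 t1 t2 :
    exec p1 s t1 s1 -> exec p2 s1 t2 s2 -> exec (CSeq p1 p2) s (t1 + t2) s2
| ExIfT b p1 p2 s s1 t :
    beval s b = Some true -> exec p1 s t s1 -> exec (CIf b p1 p2) s t.+1 s1
| ExIfF b p1 p2 s s1 t :
    beval s b = Some false -> exec p2 s t s1 -> exec (CIf b p1 p2) s t.+1 s1
| ExWhileT b p s s1 s2 t1 t2 :
    beval s b = Some true -> exec p s t1 s1 -> exec (CWhile b p) s1 t2 s2 ->
    exec (CWhile b p) s (t1 + t2).+1 s2
| ExWhileF b p s :
    beval s b = Some false -> exec (CWhile b p) s 1 s.

End Semantics.

(** ** Input format *)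

Section Encoding.
Variables (n N : nat).

Definition enc_option (T : Type) (f : T -> nat) (x : option T) : nat :=
  if x is Some y then (f y).+1 else 0%N.

Definition enc_curve (c : 'I_n) : nat := c.
Definition enc_endpoint (e : endpoint n) : nat := (e.1 : nat).*2 + e.2.

Definition enc_kind (k : kind n N) : seq nat :=
  match k with
  | Leaf => [:: 0; 0; 0; 0]%N
  | PointNode e l r => [:: 1%N; enc_endpoint e; l : nat; r : nat]
  | CurveNode c a b => [:: 2; enc_curve c; a : nat; b : nat]
  end.

Definition enc_trap (t : option (trap n)) : seq nat :=
  if t is Some d then
    [:: 1%N; enc_option enc_curve (tr_top d); enc_option enc_curve (tr_bot d);
        enc_option enc_endpoint (tr_left d); enc_option enc_endpoint (tr_right d)]
  else [:: 0; 0; 0; 0; 0]%N.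

(* The node named [k] occupies the nine cells from [3 + 9 k] on. *)
Definition encode (root : 'I_N) (G : 'I_N -> node n N) : seq nat :=
  [:: n; N; root : nat] ++
  flatten [seq enc_kind (nd_kind (G k)) ++ enc_trap (nd_trap (G k))
          | k <- enum 'I_N].

End Encoding.

(* Main.v *)
(** The record of a node of the history DAG is kept when the node is replaced,
so the trapezoids of [Tstar] are the regions of the records of [G], other than
that of the root, each occurring once, and the ply of a point is the number of
records whose region contains it.

Any linear order of the curves that extends "below somewhere" turns the
trapezoids into axis-parallel rectangles: horizontally the open interval between
the walls, vertically the interval between the ranks of the bottom and the top
curve. This preserves the maximum depth, because just right of any abscissa the
curves that are present are linearly ordered by height, in accordance with
their ranks. The relation is acyclic, and it is generated by the pairs (bottom,
top) of the recorded trapezoids, as vertically consecutive curves bound a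
trapezoid of the final map; so a topological sort of O(n) pairs yields the ranks.

The maximum depth of the rectangles is found by a left-to-right sweep. A
tournament tree delivers the walls in the order of their abscissas, and a second
tree over the ranks stores the gains and losses of depth at each rank together
with the maximal prefix sum; each wall costs a constant number of leaf-to-root
walks. The maximum is read off only between walls with distinct abscissas. *)

Require Import Defs.
From mathcomp Require Import all_boot all_order all_fingroup all_algebra.
From mathcomp Require Import all_classical all_reals all_analysis.
From mathcomp Require Import zify lra.

Set Implicit Arguments.
Unset Strict Implicit.
Unset Printing Implicit Defensive.

Local Open Scope nat_scope.

(** * Program logic *)

(** The program half and the geometric half meet in [depth v r], a count over the input cells: the
    records whose left wall is at most [v], whose right wall is beyond [v], and whose bottom rank is
    at most [r] and top rank above [r]. The half-open conventions make it the depth just to the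
    right of [v], so that walls with equal abscissas need no tie-breaking in the specification. The
    program half shows that [aBest] ends with the maximum of [depth]. The geometric half shows that
    every ply is at most some depth, by Helly's theorem for intervals of ranks, and that every depth
    is at most some ply, by choosing a point just right of [v] between the curves of rank at most
    [r] and the others. The integer cells hold bounded naturals, which shapes the tree: gains and
    losses of depth are separate counters that only grow, and a rectangle is removed by repeating
    its two increments with bottom and top exchanged. The word size has to be controlled at every
    entry of the tree. *)

Section ProgramLogic.
Variables (R : realType) (n : nat) (cv : 'I_n -> curve R).
Variables (inp : seq nat) (B W : nat).

Definition handle_x (h : nat) : R :=
  if endpoint_at n h is Some p then ptx cv p else GRing.zero.

(** Evaluation is split into a total value with defaults and a separate definedness condition
    [idef], so that values simplify by computation instead of passing through options. *)
Fixpoint ival (s : state R) (e : iexp) : nat :=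
  match e with
  | ILit k => k
  | IInput e1 => nth 0 inp (ival s e1)
  | ILoad a e1 => imem s a (ival s e1)
  | IAdd e1 e2 => ival s e1 + ival s e2
  | ISub e1 e2 => ival s e1 - ival s e2
  | IMul e1 e2 => ival s e1 * ival s e2
  | IDiv e1 e2 => ival s e1 %/ ival s e2
  end.

Fixpoint idef (s : state R) (e : iexp) : Prop :=
  match e with
  | ILit k => True
  | IInput e1 => idef s e1 /\ ival s e1 < size inp
  | ILoad a e1 => idef s e1 /\ ival s e1 < B
  | IAdd e1 e2 | ISub e1 e2 | IMul e1 e2 | IDiv e1 e2 => idef s e1 /\ idef s e2
  end.

Lemma ieval_ival s e : idef s e -> ieval inp B s e = Some (ival s e).
Proof.
elim: e => //= [e IH [/IH -> /= lt]|a e IH [/IH -> /= ->] //|||| ];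
  try by move=> e1 IH1 e2 IH2 [/IH1 -> /IH2 ->].
by rewrite onthE (nth_map 0).
Qed.

(** The only real numbers that the program looks at are abscissas of endpoints; the logic treats
    exactly this fragment. *)
Definition rdef (s : state R) (e : rexp) : Prop :=
  if e is RX e1 then idef s e1 /\ ival s e1 < n.*2 else False.
Definition rval (s : state R) (e : rexp) : R :=
  if e is RX e1 then handle_x (ival s e1) else GRing.zero.

Lemma reval_rval s e : rdef s e -> reval cv inp B s e = Some (rval s e).
Proof.
case: e => //= e [/ieval_ival E lt].
rewrite /peval E /= /handle_x /endpoint_at /curve_at.
have lt2 : (ival s e)./2 < n by lia.
by rewrite insubT.
Qed.

Fixpoint bval (s : state R) (b : bexp) : bool :=
  match b with
  | BEq e1 e2 => ival s e1 == ival s e2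
  | BLt e1 e2 => ival s e1 < ival s e2
  | BRLt e1 e2 => (rval s e1 < rval s e2)%R
  | BNot b1 => ~~ bval s b1
  | BAnd b1 b2 => bval s b1 && bval s b2
  | _ => false
  end.

Fixpoint bdef (s : state R) (b : bexp) : Prop :=
  match b with
  | BEq e1 e2 | BLt e1 e2 => idef s e1 /\ idef s e2
  | BRLt e1 e2 => rdef s e1 /\ rdef s e2
  | BNot b1 => bdef s b1
  | BAnd b1 b2 => bdef s b1 /\ bdef s b2
  | _ => False
  end.

Lemma beval_bval s b : bdef s b -> beval cv inp B s b = Some (bval s b).
Proof.
elim: b => //=.
- by move=> e1 e2 [/ieval_ival -> /ieval_ival ->].
- by move=> e1 e2 [/ieval_ival -> /ieval_ival ->].
- by move=> e1 e2 [/reval_rval -> /reval_rval ->].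
- by move=> b IH /IH ->.
- by move=> b1 IH1 b2 IH2 [/IH1 -> /IH2 ->].
Qed.

(* [m] is a time credit: the postcondition receives what the run leaves of it. *)
Definition wp (p : cmd) (s : state R) (m : nat) (Q : state R -> nat -> Prop) :=
  exists t s', [/\ exec cv inp B W p s t s', t <= m & Q s' (m - t)].

Lemma wp_conseq p s m (Q Q' : state R -> nat -> Prop) :
  wp p s m Q -> (forall s' m', Q s' m' -> Q' s' m') -> wp p s m Q'.
Proof. by move=> [t [s' [ex le q]]] QQ'; exists t, s'; split=> //; apply: QQ'. Qed.

Lemma wp_seq p1 p2 s m Q :
  wp p1 s m (fun s' m' => wp p2 s' m' Q) -> wp (CSeq p1 p2) s m Q.
Proof.
move=> [t1 [s1 [ex1 le1 [t2 [s2 [ex2 le2 q]]]]]].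
exists (t1 + t2), s2; split; [exact: ExSeq ex1 ex2|lia|].
by rewrite subnDA.
Qed.

(* Every iteration costs at least one credit, so that the credits also witness
   termination. *)
Lemma wp_while b p (I Q : state R -> nat -> Prop) s m :
  (forall s m, I s m -> [/\ bdef s b, 0 < m, bval s b -> wp p s m.-1 I &
     ~~ bval s b -> Q s m.-1]) ->
  I s m -> wp (CWhile b p) s m Q.
Proof.
move=> H; have [k] := ubnP m; elim: k s m => // k IH s m ltk Ism.
have [/beval_bval bd m0 Ht Hf] := H _ _ Ism.
case E: (bval s b) in bd Ht Hf.
- have [t1 [s1 [ex1 le1 /IH[|t2 [s2 [ex2 le2 q]]]]]] := Ht isT; first lia.
  exists (t1 + t2).+1, s2; split; [exact: ExWhileT ex1 ex2|lia|].
  by have -> : m - (t1 + t2).+1 = m.-1 - t1 - t2 by lia.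
- exists 1, s; split; [exact: ExWhileF|lia|].
  by rewrite subn1; apply: Hf.
Qed.

Lemma wp_skip s m (Q : state R -> nat -> Prop) :
  0 < m -> Q s m.-1 -> wp CSkip s m Q.
Proof. by move=> m0 q; exists 1, s; rewrite subn1; split=> //; exact: ExSkip. Qed.

Lemma wp_store a e1 e2 s m i v (Q : state R -> nat -> Prop) :
  idef s e1 -> ival s e1 = i -> idef s e2 -> ival s e2 = v ->
  i < B -> v <= W -> 0 < m ->
  Q (State (upd (imem s) a i v) (rmem s)) m.-1 -> wp (CStore a e1 e2) s m Q.
Proof.
move=> /ieval_ival d1 <- /ieval_ival d2 <- ltB leW m0 q.
by eexists; eexists; rewrite -subn1 in q; split; [apply: ExStore d1 d2 _ _|..].
Qed.

Lemma wp_if b p1 p2 s m (Q : state R -> nat -> Prop) :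
  bdef s b -> 0 < m -> (bval s b -> wp p1 s m.-1 Q) ->
  (~~ bval s b -> wp p2 s m.-1 Q) -> wp (CIf b p1 p2) s m Q.
Proof.
move=> /beval_bval bd m0 Ht Hf.
case E: (bval s b) in bd Ht Hf.
- have [t [s' [ex le q]]] := Ht isT.
  exists t.+1, s'; split; [exact: ExIfT|lia|].
  by have -> : m - t.+1 = m.-1 - t by lia.
- have [t [s' [ex le q]]] := Hf isT.
  exists t.+1, s'; split; [exact: ExIfF|lia|].
  by have -> : m - t.+1 = m.-1 - t by lia.
Qed.

(** The frame consists of whole integer arrays rather than cells. As each scalar has an array of its
    own, this already preserves every variable that a phase does not assign. *)
Fixpoint written (p : cmd) : seq nat :=
  match p with
  | CStore a _ _ => [:: a]
  | CSeq p1 p2 | CIf _ p1 p2 => written p1 ++ written p2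
  | CWhile _ p1 => written p1
  | _ => [::]
  end.

Lemma exec_frame p s t s' a : exec cv inp B W p s t s' ->
  a \notin written p -> imem s' a = imem s a.
Proof.
elim=> {p s t s'} //=.
- move=> b e1 e2 s i v _ _ _ _; rewrite inE => /negbTE ab.
  by rewrite /upd ab.
- by move=> p1 p2 s s1 s2 t1 t2 _ IH1 _ IH2; rewrite mem_cat negb_or
    => /andP[/IH1 <- /IH2 ->].
- by move=> b p1 p2 s s1 t _ _ IH; rewrite mem_cat negb_or => /andP[/IH].
- by move=> b p1 p2 s s1 t _ _ IH; rewrite mem_cat negb_or => /andP[_ /IH].
- by move=> b p s s1 s2 t1 t2 _ _ IH1 _ IH2 na; rewrite IH2 // IH1.
Qed.

Lemma wp_frame p s m Q : wp p s m Q ->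
  wp p s m (fun s' m' => Q s' m' /\
    forall a, a \notin written p -> imem s' a = imem s a).
Proof.
move=> [t [s' [ex le q]]]; exists t, s'; split=> //; split=> // a.
exact: exec_frame ex.
Qed.

End ProgramLogic.

(** Side conditions are closed from hypotheses only, never by arithmetic. This is why the runs below
    start with a block of facts on addresses and sizes, and why credits are first written as
    successors. *)
Ltac conj :=
  repeat match goal with
  | |- _ /\ _ => split
  | |- True => exact I
  | H : ?P |- ?P => exact H
  | |- is_true (0 < _.+1) => exact isT
  end.

Ltac run_pure := unfold upd; simpl; conj.
Ltac run_val := unfold upd; simpl; reflexivity.

Ltac step :=
  lazymatch goal with
  | |- wp _ _ _ _ (CSeq _ _) _ _ _ => apply: wp_seq; step
  | |- wp _ _ _ _ (CStore _ _ _) _ _ _ =>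
      eapply wp_store; [run_pure|run_val|run_pure|run_val|conj|conj|conj|cbn [imem rmem predn]]
  | |- wp _ _ _ _ (CIf _ _ _) _ _ _ =>
      apply: wp_if; [run_pure|conj|unfold upd; simpl bval; simpl predn|unfold upd; simpl bval; simpl predn]
  | |- wp _ _ _ _ CSkip _ _ _ => apply: wp_skip; [conj|cbn [imem rmem predn]]
  | |- _ => fail "step"
  end.

(** * Programs and the tree of partial results *)

Declare Scope prog_scope.
Delimit Scope prog_scope with prog.
Bind Scope prog_scope with iexp cmd bexp.
Notation "x + y" := (IAdd x y) : prog_scope.
Notation "x - y" := (ISub x y) : prog_scope.
Notation "x * y" := (IMul x y) : prog_scope.
Notation "x / y" := (IDiv x y) : prog_scope.
Notation "x == y" := (BEq x y) : prog_scope.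
Notation "x < y" := (BLt x y) : prog_scope.
Notation "p ;; q" := (CSeq p q) (at level 60, right associativity) : prog_scope.
Notation "'#' k" := (ILit k) (at level 2, format "# k") : prog_scope.
Notation "a .[ e ]" := (ILoad a e) : prog_scope.

(* The arrays of the program. Scalars live in cell 0 of an array of their own.
   In [aHead], [aDeg] and [aRank], curve [c] has index [c.+1], as in the records,
   so that index 0 stands for a missing bottom or top curve. *)
Notation aBest := 0 (only parsing).
Notation aL := 1 (only parsing).
Notation aI := 2 (only parsing).
Notation aK := 3 (only parsing).
Notation aHead := 4 (only parsing).
Notation aNext := 5 (only parsing).
Notation aDeg := 6 (only parsing).
Notation aQueue := 7 (only parsing).
Notation aRank := 8 (only parsing).
Notation aQh := 9 (only parsing).
Notation aQt := 10 (only parsing).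
Notation aEdge := 11 (only parsing).
Notation aPos := 12 (only parsing).
Notation aNeg := 13 (only parsing).
Notation aMax := 14 (only parsing).
Notation aMin := 15 (only parsing).
Notation aEv := 16 (only parsing).
Notation aC := 17 (only parsing).
Notation aU := 18 (only parsing).
Notation aV := 19 (only parsing).

Definition var a := ILoad a (ILit 0).
Definition assign a e := CStore a (ILit 0) e.

Local Open Scope prog_scope.

Definition in_n := IInput #0.
Definition in_N := IInput #1.
Definition in_root := IInput #2.
(* Fields 4 to 8 of node [k] are the record flag, top, bottom, left and right. *)
Definition field_e (j : nat) (k : iexp) := IInput (ILit (3 + j)%N + #9 * k).
Definition valid_e (k : iexp) :=
  BAnd (field_e 4 k == #1) (BNot (k == in_root)).

(* The left and the right wall of trapezoid [k] are the events [2 k] and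
   [2 k + 1]; array cells hold [id.+1] for event [id] and 0 for no event. *)
Definition event_e (a : iexp) :=
  IInput (#10 + ((a - #1 - #2 * ((a - #1) / #2)) + #9 * ((a - #1) / #2))) - #1.

(* Entry [i] of the tree has children [2 i] and [2 i + 1]. [aMax] is the maximal
   sum of [aPos - aNeg] over the prefixes, including the empty one, of the leaves
   below [i]; so it is nonnegative and truncated subtraction is harmless:
   [a + (b - a)] is the maximum of [a] and [b]. *)
Definition walk_body :=
  assign aI (var aI / #2);;
  CStore aMax (var aI) (aMax.[#2 * var aI] +
    (aPos.[#2 * var aI] + aMax.[#2 * var aI + #1] - aNeg.[#2 * var aI]
     - aMax.[#2 * var aI]));;
  CStore aNeg (var aI) (aNeg.[#2 * var aI] + aNeg.[#2 * var aI + #1]);;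
  CStore aPos (var aI) (aPos.[#2 * var aI] + aPos.[#2 * var aI + #1]);;
  CIf (aMin.[#2 * var aI] == #0)
    (CStore aMin (var aI) (aMin.[#2 * var aI + #1]))
    (CIf (aMin.[#2 * var aI + #1] == #0)
      (CStore aMin (var aI) (aMin.[#2 * var aI]))
      (CIf (BRLt (RX (event_e aMin.[#2 * var aI + #1]))
                 (RX (event_e aMin.[#2 * var aI])))
        (CStore aMin (var aI) (aMin.[#2 * var aI + #1]))
        (CStore aMin (var aI) (aMin.[#2 * var aI])))).

Definition walk := CWhile (#1 < var aI) walk_body.

Local Close Scope prog_scope.

Lemma field_in (inp : seq nat) N j k : size inp = 3 + 9 * N ->
  j < 9 -> k < N -> 3 + j + 9 * k < size inp.
Proof. by move=> ->; lia. Qed.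

Section Walk.
Variables (R : realType) (n : nat) (cv : 'I_n -> curve R).
Variables (inp : seq nat) (B W N root : nat).
Hypotheses (inp_N : nth 0 inp 1 = N) (inp_root : nth 0 inp 2 = root).

Definition node_field j k := nth 0 inp ((3 + j) + 9 * k).
Definition is_record k := (node_field 4 k == 1) && (k != root).
Definition is_event id :=
  [&& id < 2 * N, is_record (id %/ 2) & node_field (7 + id %% 2) (id %/ 2) != 0].
(** The shape is that of the value of [event_e], so that running the program produces this term by
    computation. The machine has no remainder operation, hence the subtraction; 10 is the header of
    3 cells plus field 7, the left wall, and an odd identifier moves on to field 8. *)
Definition event_handle id :=
  nth 0 inp (10 + ((id - 2 * (id %/ 2)) + 9 * (id %/ 2))) - 1.
Definition event_x id := handle_x cv (event_handle id).

Hypothesis size_inp : size inp = 3 + 9 * N.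
Hypothesis walls_ok : forall k, k < N -> is_record k ->
  node_field 7 k <= n.*2 /\ node_field 8 k <= n.*2.

Lemma event_handleE id :
  event_handle id = node_field (7 + id %% 2) (id %/ 2) - 1.
Proof. by rewrite /event_handle /node_field; congr (nth _ _ _ - _); lia. Qed.

Lemma event_handle_lt id : is_event id -> event_handle id < n.*2.
Proof.
rewrite event_handleE => /and3P[lt va nz].
have [|h7 h8] := walls_ok _ va; first by rewrite ltn_divLR 1?mulnC.
have : id %% 2 < 2 by rewrite ltn_mod.
case: (id %% 2) nz => [|[|//]]; rewrite ?addn0 ?addn1 => nz _; lia.
Qed.

Definition slot_ok x := x = 0 \/ 0 < x /\ is_event x.-1.

Definition earliest a b :=
  if a == 0 then b else if b == 0 then a
  else if (event_x (b - 1) < event_x (a - 1))%R then b else a.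

Variables (L Y : nat).
Hypotheses (leB : 2 * L <= B) (leY : 2 * Y <= W) (leN : 2 * N <= W)
  (leL : 2 * L <= W) (L0 : 0 < L).

Definition consistent_at (m : nat -> nat -> nat) j :=
  [/\ m aPos j = m aPos (2 * j) + m aPos (2 * j + 1),
      m aNeg j = m aNeg (2 * j) + m aNeg (2 * j + 1),
      m aMax j = maxn (m aMax (2 * j))
        (m aPos (2 * j) + m aMax (2 * j + 1) - m aNeg (2 * j)) &
      m aMin j = earliest (m aMin (2 * j)) (m aMin (2 * j + 1))].

(* Weighting by the index gives every level the same total, which is how the
   sums in the tree are kept below [Y]. *)
Definition bounded (m : nat -> nat -> nat) := forall j, j < 2 * L ->
  [/\ m aPos j * j <= Y, m aNeg j * j <= Y, m aMax j <= m aPos j & slot_ok (m aMin j)].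

Definition consistent m := forall j, 0 < j < L -> consistent_at m j.

Lemma slot_ok_le x : slot_ok x -> x <= W.
Proof. by case=> [->//|[x0 /and3P[lt _ _]]]; lia. Qed.

Lemma slot_ok_handle x : slot_ok x -> x != 0 -> event_handle (x - 1) < n.*2.
Proof. by case=> [->//|[x0 ok]] _; apply: event_handle_lt; rewrite subn1. Qed.

Lemma earliest_slot_ok a b : slot_ok a -> slot_ok b -> slot_ok (earliest a b).
Proof. by rewrite /earliest; do 3?[case: ifP]. Qed.

Lemma wp_walk_body s m (Q : state R -> nat -> Prop) :
  let i := imem s aI 0 %/ 2 in
  0 < i < L -> bounded (imem s) -> 9 <= m ->
  (forall s' m', m <= m' + 9 ->
    (forall a j : nat, a \notin [:: aPos; aNeg; aMax; aMin] \/ j <> i ->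
       imem s' a j = if (a == aI) && (j == 0) then i else imem s a j) ->
    [/\ imem s' aPos i = imem s aPos (2 * i) + imem s aPos (2 * i + 1),
      imem s' aNeg i = imem s aNeg (2 * i) + imem s aNeg (2 * i + 1),
      imem s' aMax i = maxn (imem s aMax (2 * i))
        (imem s aPos (2 * i) + imem s aMax (2 * i + 1) - imem s aNeg (2 * i)) &
      imem s' aMin i = earliest (imem s aMin (2 * i)) (imem s aMin (2 * i + 1))] ->
    Q s' m') ->
  wp cv inp B W walk_body s m Q.
Proof.
move=> i /andP[i0 iL] bd le9 H.
have iB : i < B by lia.
have iW : i <= W by lia.
have [|p1 q1 x1 k1] := bd (2 * i); first lia.
have [|p2 q2 x2 k2] := bd (2 * i + 1); first lia.
(* A prefix sum of gains minus losses never exceeds the total gain, so the bound on [aPos] also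
   serves for [aMax]. *)
have xle : maxn (imem s aMax (2 * i))
        (imem s aPos (2 * i) + imem s aMax (2 * i + 1) - imem s aNeg (2 * i)) <=
   imem s aPos (2 * i) + imem s aPos (2 * i + 1).
  by rewrite geq_max; apply/andP; split; lia.
(* Both children have index at least [2 * i], so [2 * i] times the sum is at most [2 * Y <= W], and
   [i] is positive. *)
have pY : imem s aPos (2 * i) + imem s aPos (2 * i + 1) <= W by nia.
have qY : imem s aNeg (2 * i) + imem s aNeg (2 * i + 1) <= W by nia.
have key (x : nat) : slot_ok x -> x != 0 ->
   10 + (x - 1 - 2 * ((x - 1) %/ 2) + 9 * ((x - 1) %/ 2)) < size inp.
  by case=> [->//|[x0 /and3P[lt _ _]]] _; rewrite size_inp; lia.
have mx a b : a + (b - a) = maxn a b by lia.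
have B0 : 0 < B by lia.
have B2 : 2 * i < B by lia.
have B21 : 2 * i + 1 < B by lia.
have aW : imem s aMax (2 * i) +
        (imem s aPos (2 * i) + imem s aMax (2 * i + 1) - imem s aNeg (2 * i)
         - imem s aMax (2 * i)) <= W.
  rewrite mx; exact: leq_trans xle pY.
have leW1 := slot_ok_le k1; have leW2 := slot_ok_le k2.
case: m le9 H => [|[|[|[|[|[|[|[|[|m]]]]]]]]] // _ H.
(* The four ways of choosing [aMin] differ only in the value stored last, so they share this
   continuation. *)
have fin (x m' : nat) : m <= m' ->
   x = earliest (imem s aMin (2 * i)) (imem s aMin (2 * i + 1)) ->
   Q (State (upd (upd (upd (upd (upd (imem s) aI 0 i)
       aMax i (imem s aMax (2 * i) +
        (imem s aPos (2 * i) + imem s aMax (2 * i + 1) - imem s aNeg (2 * i)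
         - imem s aMax (2 * i))))
       aNeg i (imem s aNeg (2 * i) + imem s aNeg (2 * i + 1)))
       aPos i (imem s aPos (2 * i) + imem s aPos (2 * i + 1)))
       aMin i x) (rmem s)) m'.
  rewrite mx => lem ->; apply: H => [||]; rewrite /upd /=; first by rewrite -addn1 addnC; lia.
    move=> a j; rewrite !inE /=.
    case=> [|/eqP/negbTE ->]; last by rewrite !andbF.
    by rewrite !negb_or => /and4P[/negbTE-> /negbTE-> /negbTE-> /negbTE->].
  by rewrite !eqxx.
rewrite /walk_body /assign /var.
step. rewrite -/i.
step.
step. step. step.
- by move=> /eqP E1; step; apply: fin; rewrite /earliest ?E1 //; lia.
- move=> E1; step.
  + move=> /eqP E2; step; apply: fin; rewrite /earliest ?E2 ?(negbTE E1) //; lia.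
  + move=> E2; step.
    * exact: key k2 E2.
    * exact: slot_ok_handle k2 E2.
    * exact: key k1 E1.
    * exact: slot_ok_handle k1 E1.
    * move=> lt; step.
      by apply: fin; rewrite /earliest ?(negbTE E2) ?(negbTE E1) /event_x ?lt //; lia.
    * move=> lt; step.
      by apply: fin; rewrite /earliest ?(negbTE E2) ?(negbTE E1) /event_x ?(negbTE lt) //; lia.
Qed.

(** A changed leaf can falsify the equations only at its ancestors. While the walk climbs, the
    parent of the current entry is the only place where they may fail; at the root no such place is
    left. An index below [2 ^ l.+1] leaves at most [l] levels to climb, each at 9 credits for the
    body and one for the test. *)
Lemma wp_walk l s m (Q : state R -> nat -> Prop) :
  0 < imem s aI 0 < 2 * L -> imem s aI 0 < 2 ^ l.+1 ->
  bounded (imem s) ->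
  (forall j, 0 < j < L -> j <> imem s aI 0 %/ 2 -> consistent_at (imem s) j) ->
  10 * l + 1 <= m ->
  (forall s' m', m <= m' + (10 * l + 1) -> bounded (imem s') ->
    consistent (imem s') ->
    (forall a j, a <> aI -> a \notin [:: aPos; aNeg; aMax; aMin] \/ L <= j ->
      imem s' a j = imem s a j) -> Q s' m') ->
  wp cv inp B W walk s m Q.
Proof.
move=> iL il bd co lem H.
pose I (s1 : state R) m1 := exists l1, [/\ 0 < imem s1 aI 0 < 2 * L,
  imem s1 aI 0 < 2 ^ l1.+1 /\ bounded (imem s1),
  (forall j, 0 < j < L -> j <> imem s1 aI 0 %/ 2 -> consistent_at (imem s1) j),
  10 * l1 + 1 <= m1 /\ m + (10 * l1) <= m1 + 10 * l &
  (forall a j, a <> aI -> a \notin [:: aPos; aNeg; aMax; aMin] \/ L <= j ->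
      imem s1 a j = imem s a j)].
apply: (@wp_while _ _ _ _ _ _ _ _ I); last by exists l; split.
move=> {iL il bd co lem}s1 m1 [l1 [iL [il bd] co [le1 le2] fr]]; split=> //=; [lia|lia| |].
- move=> i1; case: l1 il le1 le2 => [|l1] il le1 le2; first by move: il; rewrite expn1; lia.
  have i2l : imem s1 aI 0 %/ 2 < 2 ^ l1.+1 by rewrite ltn_divLR // -expnSr.
  set i := imem s1 aI 0 %/ 2 in i2l co.
  apply: wp_walk_body => //; rewrite -/i; [lia|lia|].
  move=> s2 m2 lem2 fr2 new.
  have i2 : imem s2 aI 0 = i by rewrite fr2 //; left.
  have fr3 a j : j <> i -> a <> aI -> imem s2 a j = imem s1 a j.
    by move=> ji /eqP/negbTE aI; rewrite fr2 ?aI //; right.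
  exists l1; rewrite i2; split; [lia|split=> //| |lia|].
  + move=> j jL; have [->|/eqP ji] := eqVneq j i.
      have [-> -> -> ->] := new.
      have [p1 q1 x1 k1] := bd (2 * i) ltac:(lia).
      have [p2 q2 x2 k2] := bd (2 * i + 1) ltac:(lia).
      split; [nia|nia| |exact: earliest_slot_ok].
      by rewrite geq_max; apply/andP; split; lia.
    by have := bd j jL; rewrite !fr3.
  (* The equation at [j] reads the entries [j], [2 * j] and [2 * j + 1]; for [j] other than [i], one
     of these is [i] only if [j] is [i %/ 2], the new exception. *)
  + move=> j jL ji2; have [->|/eqP ji] := eqVneq j i.
      have [e1 e2 e3 e4] := new.
      by rewrite /consistent_at e1 e2 e3 e4 !fr3 //; lia.
    by have := co j jL ji; rewrite /consistent_at !fr3 //; lia.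
  + move=> a j /eqP/negbTE naI ok; rewrite -fr //; last exact/eqP/negbT.
    rewrite fr2 ?naI //; case: ok => [|Lj]; [by left|right; lia].
- move=> i1; apply: H => //; [lia|].
  move=> j jL; apply: co => //; lia.
Qed.
End Walk.

(** * Maximal prefix sum and earliest event at the root of the tree *)

Section Tree.
Variables (R : realType) (n : nat) (cv : 'I_n -> curve R) (inp : seq nat).
Variables (h : nat) (m : nat -> nat -> nat).
Let L := 2 ^ h.
Hypothesis co : consistent cv inp L m.
Hypothesis leaf_max : forall q, L <= q < 2 * L -> m aMax q = m aPos q - m aNeg q.

(* Entry [j] has height [l]; the leaves are the entries from [L] on. *)
Definition is_node l j := [&& 0 < j, L <= j * 2 ^ l & j.+1 * 2 ^ l <= 2 * L].

Lemma is_nodeS l j : is_node l.+1 j ->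
  [/\ 0 < j < L, is_node l (2 * j) & is_node l (2 * j + 1)].
Proof.
move=> /and3P[j0 j1 j2]; rewrite /is_node; rewrite expnS in j1 j2.
have ? : 0 < 2 ^ l by rewrite expn_gt0.
split; [nia|apply/and3P; split; nia|apply/and3P; split; nia].
Qed.

(** The predicate receives the interval of leaves below the entry as two free bounds, so that the
    inductive arguments only join two intervals at [b] and never see powers of 2. *)
Lemma node_ind (P : nat -> nat -> nat -> Prop) :
  (forall q, L <= q < 2 * L -> P q q q.+1) ->
  (forall l j a b c, is_node l.+1 j -> a < b -> b < c -> L <= a -> c <= 2 * L ->
     consistent_at cv inp m j -> P (2 * j) a b ->
     P (2 * j + 1) b c -> P j a c) ->
  forall l j, is_node l j -> P j (j * 2 ^ l) (j.+1 * 2 ^ l).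
Proof.
move=> P0 PS; elim=> [|l IH] j nd.
  by rewrite expn0 !muln1; apply: P0; move: nd; rewrite /is_node expn0 !muln1; lia.
have [jL n1 n2] := is_nodeS nd.
have p0 : 0 < 2 ^ l by rewrite expn_gt0.
have := IH _ n1; have := IH _ n2.
have -> : (2 * j + 1).+1 = 2 * j.+1 by lia.
have -> : (2 * j).+1 = 2 * j + 1 by lia.
move=> IH2 IH1; case/and3P: (nd); rewrite expnS => j0 j1 j2.
apply: (PS l j _ ((2 * j + 1) * 2 ^ l)) => //; try (rewrite ?expnS; nia).
- exact: co.
- by move: IH1; congr P; lia.
- by move: IH2; congr P; lia.
Qed.

(** Sums stand on both sides, in place of differences, because subtraction on naturals is truncated.
    The empty prefix, with value 0, appears as the first alternative of the last clause. *)
Definition prefix_bound j a c :=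
  [/\ m aPos j = \sum_(a <= q < c) m aPos q,
      m aNeg j = \sum_(a <= q < c) m aNeg q,
      forall q, a <= q < c ->
        \sum_(a <= q' < q.+1) m aPos q' <= m aMax j + \sum_(a <= q' < q.+1) m aNeg q' &
      m aMax j = 0 \/ exists2 q, a <= q < c &
        \sum_(a <= q' < q.+1) m aPos q' = m aMax j + \sum_(a <= q' < q.+1) m aNeg q'].

(** A nonempty prefix of the joined interval is a prefix of the left half, or the whole left half
    followed by a prefix of the right half; these are the two arguments of the maximum in
    [consistent_at]. *)
Lemma tree_max l j : is_node l j -> prefix_bound j (j * 2 ^ l) (j.+1 * 2 ^ l).
Proof.
move: l j; apply: (node_ind (P := prefix_bound)).
  move=> q qL; split; rewrite ?big_nat1 //.
    move=> q' q'q; have -> : q' = q by lia.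
    rewrite !big_nat1 leaf_max //; lia.
  rewrite leaf_max //; case: (leqP (m aPos q) (m aNeg q)) => pn; first by left; lia.
  by right; exists q; rewrite ?big_nat1; lia.
move=> l j a b c _ ab bc _ _ [e1 e2 e3 _] [p1 n1 u1 v1] [p2 n2 u2 v2].
have cat F x : b <= x -> \sum_(a <= q < x) F q = \sum_(a <= q < b) F q + \sum_(b <= q < x) F q.
  by move=> bx; rewrite (big_cat_nat (n := b)) //= ltnW.
rewrite /prefix_bound e1 e2 e3; split.
- by rewrite cat ?p1 ?p2 // ltnW.
- by rewrite cat ?n1 ?n2 // ltnW.
- move=> q qac; case: (ltnP q b) => qb.
    apply: leq_trans (u1 q _) _; [lia|by rewrite leq_add2r leq_maxl].
  rewrite !(cat _ q.+1) -?p1 -?n1; try lia.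
  have := u2 q ltac:(lia); lia.
- case: (leqP (m aPos (2 * j) + m aMax (2 * j + 1) - m aNeg (2 * j)) (m aMax (2 * j))) => le.
    case: v1 => [->|[q qab E]]; [left; lia|right; exists q; first lia].
    by rewrite E; lia.
  (* If the right half contributes its empty prefix, the maximum is attained by the whole left half,
     that is, by the prefix ending at [b.-1]. *)
  case: v2 => [z|[q qab E]].
    right; exists b.-1; first lia.
    rewrite prednK; last lia.
    rewrite -p1 -n1; lia.
  right; exists q; first lia.
  rewrite !(cat _ q.+1) -?p1 -?n1 ?E; lia.
Qed.

Definition min_spec j a c :=
  (m aMin j = 0 -> forall q, a <= q < c -> m aMin q = 0) /\
  (m aMin j <> 0 -> (exists2 q, a <= q < c & m aMin q = m aMin j) /\
    forall q, a <= q < c -> m aMin q <> 0 ->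
      (event_x cv inp (m aMin j - 1) <= event_x cv inp (m aMin q - 1))%R).

Lemma tree_min l j : is_node l j -> min_spec j (j * 2 ^ l) (j.+1 * 2 ^ l).
Proof.
move: l j; apply: (node_ind (P := min_spec)).
  move=> q qL; split=> [q0 q' qq'|q0]; first by have -> : q' = q by lia.
  split; first by exists q; lia.
  by move=> q' qq' _; have -> : q' = q by lia.
move=> l j a b c _ ab bc _ _ [_ _ _ e] [z1 k1] [z2 k2].
rewrite /min_spec e /earliest.
case: eqVneq => [E1|/eqP N1].
  split.
    move=> E2 q qac; case: (ltnP q b) => qb; [apply: z1; lia|apply: z2; lia].
  move=> N2; have [[q qr Eq] lo] := k2 N2; split; first by exists q => //; lia.
  move=> q' qr' N'; case: (ltnP q' b) => qb; last by apply: lo => //; lia.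
  by case: N'; apply: z1; lia.
have [[q1 qr1 Eq1] lo1] := k1 N1.
case: eqVneq => [E2|/eqP N2].
  split=> // _; split; first by exists q1 => //; lia.
  move=> q' qr' N'; case: (ltnP q' b) => qb; first by apply: lo1 => //; lia.
  by case: N'; apply: z2; lia.
have [[q2 qr2 Eq2] lo2] := k2 N2.
case: ifP => cmp; split=> // _.
  split; first by exists q2 => //; lia.
  move=> q' qr' N'; case: (ltnP q' b) => qb; last by apply: lo2 => //; lia.
  by apply: Order.POrderTheory.le_trans (Order.POrderTheory.ltW cmp) (lo1 _ _ N'); lia.
split; first by exists q1 => //; lia.
move=> q' qr' N'; case: (ltnP q' b) => qb; first by apply: lo1 => //; lia.
apply: (Order.POrderTheory.le_trans _ (lo2 _ _ N')); last lia.
by rewrite Order.TotalTheory.leNgt cmp.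
Qed.

Lemma root_is_node : is_node h 1.
Proof. by rewrite /is_node mul1n !leqnn. Qed.

Lemma root_max :
  (forall r, r < L -> \sum_(q < r.+1) m aPos (L + q) <=
     m aMax 1 + \sum_(q < r.+1) m aNeg (L + q)) /\
  (m aMax 1 = 0 \/ exists2 r, r < L & \sum_(q < r.+1) m aPos (L + q) =
     m aMax 1 + \sum_(q < r.+1) m aNeg (L + q)).
Proof.
have [_ _ u v] := tree_max root_is_node; rewrite mul1n in u v.
have E F r : \sum_(q < r.+1) F (L + q) = \sum_(L <= q < (L + r).+1) F q.
  rewrite -[L in X in _ = X]add0n (big_addn 0) -addnS addKn big_mkord.
  by apply: eq_bigr => q _; rewrite addnC.
split.
  by move=> r rL; rewrite !E; apply: u; rewrite leq_addr /= -/L mul2n -addnn ltn_add2l.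
case: v => [->|[q qr Eq]]; [by left|right].
exists (q - L); first by move: qr; rewrite -/L; lia.
by rewrite !E subnKC //; case/andP: qr.
Qed.

Lemma root_min : min_spec 1 L (2 * L).
Proof. by have := tree_min root_is_node; rewrite mul1n. Qed.

End Tree.

(** * The sweep *)

Local Open Scope prog_scope.

Definition refresh_from (x : iexp) := assign aI (var aL + x);; walk.

(** To start a trapezoid, [aU] is its bottom slot and [aV] its top slot; to end it they are
    exchanged. The depth at the ranks in between thus goes up or down by one without any counter
    being decreased. *)
Definition bump :=
  CStore aPos (var aL + var aU) (aPos.[var aL + var aU] + #1);;
  CStore aMax (var aL + var aU) (aPos.[var aL + var aU] - aNeg.[var aL + var aU]);;
  refresh_from (var aU);;
  CStore aNeg (var aL + var aV) (aNeg.[var aL + var aV] + #1);;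
  CStore aMax (var aL + var aV) (aPos.[var aL + var aV] - aNeg.[var aL + var aV]);;
  refresh_from (var aV).

Definition set_event (x : iexp) :=
  CStore aMin (var aL + var aEv) x;; refresh_from (var aEv).

Definition bot_e (k : iexp) := aRank.[field_e 6 k].
(** The truncated difference is 1 exactly for a missing top curve, and [aRank] is 0 at index 0. So a
    missing top gets [n + 1], above all ranks, just as a missing bottom gets 0, below all of
    them. *)
Definition top_e (k : iexp) :=
  (#1 - field_e 5 k) * (in_n + #1) + aRank.[field_e 5 k].

(** A trapezoid without left wall is alive before the first event, so it enters the counters at
    once; all others wait for the event of their left wall. *)
Definition load_left (k : iexp) :=
  CIf (field_e 7 k == #0)
    (assign aU (bot_e k);; assign aV (top_e k);; bump)
    (assign aEv (#2 * k);; set_event (#2 * k + #1)).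

Definition load_right (k : iexp) :=
  CIf (field_e 8 k == #0) CSkip
    (assign aEv (#2 * k + #1);; set_event (#2 * k + #2)).

Definition load_traps :=
  assign aK #0;;
  CWhile (var aK < in_N)
    (CIf (valid_e (var aK)) (load_left (var aK);; load_right (var aK)) CSkip;;
     assign aK (var aK + #1)).

Definition record_best := assign aBest (var aBest + (aMax.[#1] - var aBest)).

(* Walls with the same abscissa are processed together: in between, a trapezoid
   that ends there may still be counted along with one that starts there. *)
Definition sweep_event :=
  assign aEv (aMin.[#1] - #1);;
  assign aK (var aEv / #2);;
  CIf (#2 * var aK == var aEv)
    (assign aU (bot_e (var aK));; assign aV (top_e (var aK)))
    (assign aU (top_e (var aK));; assign aV (bot_e (var aK)));;
  bump;;
  set_event #0;;
  CIf (aMin.[#1] == #0) record_best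
    (CIf (BRLt (RX (event_e (var aEv + #1))) (RX (event_e aMin.[#1])))
      record_best CSkip).

(** The initial value accounts for the abscissas to the left of all walls. *)
Definition sweep :=
  assign aBest aMax.[#1];; CWhile (#0 < aMin.[#1]) sweep_event.

Local Close Scope prog_scope.

Section Sweep.
Variables (R : realType) (n : nat) (cv : 'I_n -> curve R).
Variables (inp : seq nat) (B W N root h : nat).
Hypotheses (size_inp : size inp = 3 + 9 * N).
Hypotheses (inp_n : nth 0 inp 0 = n) (inp_N : nth 0 inp 1 = N)
  (inp_root : nth 0 inp 2 = root).
Let valid := is_record inp root.
Let field := node_field inp.
Let event_ok := is_event inp N root.
Let event_x := event_x cv inp.
Hypothesis walls_ok : forall k, k < N -> valid k ->
  field 7 k <= n.*2 /\ field 8 k <= n.*2.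
Hypothesis curves_ok : forall k, k < N -> valid k ->
  field 5 k <= n /\ field 6 k <= n.

Let L := 2 ^ h.
(** The same leaves serve two index sets: events below [2 * N] in [aMin], and slots 0 to [n + 1] in
    the other arrays. A counter of at most [2 * N + 1] at a leaf of index below [2 * L] gives the
    weighted bound [(2 * N + 1) * (2 * L)]; [W_big] is twice that, as the walk requires. *)
Hypothesis L_big : 2 * N + n + 2 <= L.
Hypothesis B_big : 2 * L <= B.
Hypothesis W_big : 4 * (2 * N + 1) * L <= W.

Let bounded := bounded inp N root L ((2 * N + 1) * (2 * L)).
Let consistent := consistent cv inp L.

(** Only the leaves are described, by the gains [p], the losses [q] and the pending events;
    consistency determines the inner entries. *)
Record model (s : state R) (p q : nat -> nat) (pend : nat -> bool) : Prop := {
  model_L : imem s aL 0 = L;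
  model_bounded : bounded (imem s);
  model_consistent : consistent (imem s);
  model_pos : forall r, r < L -> imem s aPos (L + r) = p r;
  model_neg : forall r, r < L -> imem s aNeg (L + r) = q r;
  model_max : forall r, r < L -> imem s aMax (L + r) = p r - q r;
  model_min : forall r, r < L -> imem s aMin (L + r) = if pend r then r.+1 else 0 }.

Lemma L_gt0 : 0 < L. Proof. by lia. Qed.

(** [s0] is the consistent state before a write and [s] the state after it. Their trees agree except
    at the leaf [L + i], hence the equations of [s] can fail only at the parent of that leaf, which
    is what [wp_walk] asks for. *)
Lemma wp_refresh x i (s0 s : state R) m (Q : state R -> nat -> Prop) :
  idef inp B s x -> ival inp s x = i -> i < L ->
  imem s aL 0 = L -> consistent (imem s0) ->
  (forall a j, a \in [:: aPos; aNeg; aMax; aMin] -> j <> L + i ->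
    imem s a j = imem s0 a j) ->
  bounded (imem s) -> 10 * h + 2 <= m ->
  (forall s' m', m <= m' + (10 * h + 2) -> bounded (imem s') ->
    consistent (imem s') ->
    (forall a j, a \in [:: aPos; aNeg; aMax; aMin] -> L <= j -> imem s' a j = imem s a j) ->
    (forall a, a \notin [:: aI; aPos; aNeg; aMax; aMin] -> imem s' a = imem s a) ->
    Q s' m') ->
  wp cv inp B W (refresh_from x) s m Q.
Proof.
move=> dx vx iL sL co fr bd lem H.
have L0 := L_gt0.
case: m lem H => [|m] lem H; first by lia.
have B0 : 0 < B by lia.
have iW : L + i <= W by nia.
rewrite /refresh_from /assign /var.
apply: wp_seq; eapply wp_store; [run_pure|run_val|run_pure|simpl; rewrite sL vx; reflexivity|conj..|].
simpl predn.
have : forall Q' s1, (forall a j, a <> aI -> imem s1 a j = imem s a j) ->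
   imem s1 aI 0 = L + i -> (forall s' m', Q' s' m' -> (forall a, a \notin written walk -> imem s' a = imem s1 a) -> Q s' m') ->
   (forall s' m', m <= m' + (10 * h + 1) -> bounded (imem s') -> consistent (imem s') ->
    (forall a j, a <> aI -> a \notin [:: aPos; aNeg; aMax; aMin] \/ L <= j -> imem s' a j = imem s1 a j) -> Q' s' m') ->
   wp cv inp B W walk s1 m Q.
  move=> Q' s1 fr1 i1 QQ HQ.
  have /wp_frame : wp cv inp B W walk s1 m Q'; last first.
    by move=> /wp_conseq; apply => s' m' []; apply: QQ.
  apply: (@wp_walk _ _ cv inp B W N root inp_N inp_root size_inp walls_ok L _ _ _ _ _ L0 h) HQ;
    rewrite ?i1; try lia; try nia.
  - by rewrite expnS -/L; lia.
  - by move=> j jL; have := bd j jL; rewrite !fr1.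
  - move=> j jL ji; have := co j jL; rewrite /consistent_at !fr1 // !fr //; lia.
move/(_ (fun s' m' => [/\ m <= m' + (10 * h + 1), bounded (imem s'), consistent (imem s') &
   (forall a j, a <> aI -> a \notin [:: aPos; aNeg; aMax; aMin] \/ L <= j -> imem s' a j = imem s a j)])).
apply.
- by move=> a j /eqP/negbTE aI; rewrite /= /upd aI.
- by [].
- move=> s' m' [le bd' co' fr'] fw; apply: H => //; first lia.
    move=> a j ain Lj; apply: fr'; last by right.
    by move=> aI; rewrite aI in ain.
  move=> a na; rewrite fw.
    rewrite /=; apply/funext => j; rewrite /upd; case: eqP na => // -> //.
  move: na; rewrite !inE !negb_or /= => /and5P[-> -> -> -> ->]; done.
- move=> s' m' le bd' co' fr'; split=> // a j na ok.
  by rewrite fr' //= /upd; move/eqP/negbTE: na => ->.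
Qed.

Lemma wp_bump s m p q pend u v (Q : state R -> nat -> Prop) :
  model s p q pend -> imem s aU 0 = u -> imem s aV 0 = v -> u < L -> v < L ->
  p u <= 2 * N -> q v <= 2 * N -> 20 * h + 8 <= m ->
  (forall s' m', m <= m' + (20 * h + 8) ->
    model s' (fun r => p r + (r == u)) (fun r => q r + (r == v)) pend ->
    (forall a, a \notin [:: aI; aPos; aNeg; aMax; aMin] -> imem s' a = imem s a) ->
    Q s' m') ->
  wp cv inp B W bump s m Q.
Proof.
move=> [sL bd co mp mq mx mn] su sv uL vL pu qv lem H.
have L0 := L_gt0.
case: m lem H => [|[|[|[|m]]]] lem H; try lia.
have B0 : 0 < B by lia.
have uB : L + u < B by lia.
have vB : L + v < B by lia.
rewrite /bump /var.
have NW : 2 * N + 1 <= W by nia.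
have puW : p u + 1 <= W by lia.
have pqW : p u + 1 - q u <= W by lia.
have pu' : imem s aPos (L + u) = p u by rewrite mp.
have qu' : imem s aNeg (L + u) = q u by rewrite mq.
apply: wp_seq; eapply wp_store; [run_pure; by rewrite sL su|simpl; rewrite sL su; reflexivity|run_pure; by rewrite sL su|simpl; rewrite sL su pu'; reflexivity|conj..|].
cbn [imem rmem predn].
apply: wp_seq; eapply wp_store; [run_pure; by rewrite sL su|unfold upd; simpl; rewrite sL su; reflexivity|run_pure; by rewrite sL su|unfold upd; simpl; rewrite sL su eqxx qu'; reflexivity|conj..|].
cbn [imem rmem predn].
apply: wp_seq.
apply: (@wp_refresh _ u s) => //; rewrite /upd /=; try lia.
- by move=> a j _ /eqP/negbTE ->; rewrite !andbF.
- move=> j jL /=; have := bd j jL; case: (eqVneq j (L + u)) => [->|] //.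
  by move=> -[h1 h2 h3 h4]; split=> //; [apply: leq_mul; lia|exact: leq_subr].
move=> s1 m1 lem1 bd1 co1 lf1 fr1.
have e1 a j : a \in [:: aPos; aNeg; aMax; aMin] -> L <= j ->
   imem s1 a j = if j == L + u then (if a == aMax then p u + 1 - q u else
     if a == aPos then p u + 1 else imem s a j) else imem s a j.
  move=> ai Lj; rewrite lf1 // /upd /=.
  by case: (j == L + u); rewrite ?andbF // !andbT.
have f1 a : a \notin [:: aI; aPos; aNeg; aMax; aMin] -> imem s1 a = imem s a.
  move=> na; rewrite fr1 //=; apply/funext => j; rewrite /upd.
  by move: na; rewrite !inE !negb_or => /and5P[_ /negbTE-> _ /negbTE-> _].
have s1L : imem s1 aL 0 = L by rewrite f1.
have s1v : imem s1 aV 0 = v by rewrite f1.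
have {}m1E : exists m2, m1 = m2.+2 by exists (m1 - 2); lia.
case: m1E => m2 E; subst m1.
have q1v : imem s1 aNeg (L + v) = q v.
  by rewrite e1 ?leq_addr // mq //=; case: ifP.
have p1v : imem s1 aPos (L + v) = p v + (v == u).
  rewrite e1 ?leq_addr // mp //= eqn_add2l; case: eqP => [->//|_]; by rewrite addn0.
have pvW : p v + (v == u) - (q v + 1) <= W.
  have := bd1 (L + v) ltac:(lia); rewrite p1v => -[h1 _ _ _]; nia.
apply: wp_seq; eapply wp_store; [run_pure; by rewrite s1L s1v|simpl; rewrite s1L s1v; reflexivity|run_pure; by rewrite s1L s1v|simpl; rewrite s1L s1v q1v; reflexivity|conj; try lia..|].
cbn [imem rmem predn].
apply: wp_seq; eapply wp_store; [run_pure; by rewrite s1L s1v|unfold upd; simpl; rewrite s1L s1v; reflexivity|run_pure; by rewrite s1L s1v|unfold upd; simpl; rewrite s1L s1v eqxx p1v; reflexivity|conj; try lia..|].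
cbn [imem rmem predn].
apply: (@wp_refresh _ v s1) => //; rewrite /upd /=; try lia.
- by move=> a j _ /eqP/negbTE ->; rewrite !andbF.
- move=> j jL /=; have := bd1 j jL; case: (eqVneq j (L + v)) => [->|] //.
  by rewrite p1v => -[h1 h2 h3 h4]; split=> //; [apply: leq_mul; lia|exact: leq_subr].
move=> s3 m3 lem3 bd3 co3 lf3 fr3.
have e3 a j : a \in [:: aPos; aNeg; aMax; aMin] -> L <= j ->
   imem s3 a j = if j == L + v then (if a == aMax then p v + (v == u) - (q v + 1) else
     if a == aNeg then q v + 1 else imem s1 a j) else imem s1 a j.
  move=> ai Lj; rewrite lf3 // /upd /=.
  by case: (j == L + v); rewrite ?andbF // !andbT.
have f3 a : a \notin [:: aI; aPos; aNeg; aMax; aMin] -> imem s3 a = imem s a.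
  move=> na; rewrite -(f1 _ na) fr3 //=; apply/funext => j; rewrite /upd.
  by move: na; rewrite !inE !negb_or => /and5P[_ _ /negbTE-> /negbTE-> _].
apply: H; [lia| |exact: f3].
split=> //; first by rewrite f3.
- move=> r rL; rewrite e3 ?leq_addr // e1 ?leq_addr //= !eqn_add2l mp //.
  by rewrite if_same; case: eqVneq => [->|_]; rewrite ?addn0.
- move=> r rL; rewrite e3 ?leq_addr // e1 ?leq_addr //= !eqn_add2l mq //.
  by rewrite if_same; case: eqVneq => [->|_]; rewrite ?addn0.
- move=> r rL; rewrite e3 ?leq_addr // e1 ?leq_addr //= !eqn_add2l mx //.
  case: (eqVneq r v) => [->|_]; rewrite ?addn0 //.
  by case: eqVneq => [->|_]; rewrite ?addn0.
- move=> r rL; rewrite e3 ?leq_addr // e1 ?leq_addr //= !eqn_add2l mn //.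
  by rewrite !if_same.
Qed.

Lemma wp_set_event x s m p q pend id y (Q : state R -> nat -> Prop) :
  model s p q pend -> imem s aEv 0 = id -> id < 2 * N ->
  idef inp B s x -> ival inp s x = y ->
  y = 0 \/ y = id.+1 /\ event_ok id -> 10 * h + 3 <= m ->
  (forall s' m', m <= m' + (10 * h + 3) ->
    model s' p q (fun r => if r == id then y != 0 else pend r) ->
    (forall a, a \notin [:: aI; aPos; aNeg; aMax; aMin] -> imem s' a = imem s a) ->
    Q s' m') ->
  wp cv inp B W (set_event x) s m Q.
Proof.
move=> [sL bd co mp mq mx mn] sid idN dx xy yid lem H.
have L0 := L_gt0.
case: m lem H => [|m] lem H; try lia.
have B0 : 0 < B by lia.
have idB : L + id < B by lia.
have idL : id < L by lia.
have yW : y <= W by nia.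
rewrite /set_event /var.
apply: wp_seq; eapply wp_store; [run_pure; by rewrite sL sid|simpl; rewrite sL sid; reflexivity|run_pure|rewrite xy; reflexivity|conj..|].
cbn [imem rmem predn].
apply: (@wp_refresh _ id s) => //; rewrite /upd /=; try lia.
- by move=> a j _ /eqP/negbTE ->; rewrite !andbF.
- move=> j jL /=; have := bd j jL; case: (eqVneq j (L + id)) => [->|] //.
  move=> -[h1 h2 h3 h4]; split=> //; rewrite /slot_ok.
  by case: yid => [->|[-> ok]]; [left|right].
move=> s1 m1 lem1 bd1 co1 lf1 fr1.
have e1 a j : a \in [:: aPos; aNeg; aMax; aMin] -> L <= j ->
   imem s1 a j = if (a == aMin) && (j == L + id) then y else imem s a j.
  by move=> ai Lj; rewrite lf1.
have f1 a : a \notin [:: aI; aPos; aNeg; aMax; aMin] -> imem s1 a = imem s a.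
  move=> na; rewrite fr1 //=; apply/funext => j; rewrite /upd.
  by move: na; rewrite !inE !negb_or => /and5P[_ _ _ _ /negbTE->].
apply: H; [lia| |exact: f1].
split=> //; first by rewrite f1.
- by move=> r rL; rewrite e1 ?leq_addr //= mp.
- by move=> r rL; rewrite e1 ?leq_addr //= mq.
- by move=> r rL; rewrite e1 ?leq_addr //= mx.
- move=> r rL; rewrite e1 ?leq_addr //= eqn_add2l mn //.
  by case: eqP => // ->; case: yid => [->|[-> _]].
Qed.


Variable rk : nat -> nat.
Hypotheses (rk0 : rk 0 = 0) (rk_le : forall c, c <= n -> rk c <= n)
  (rk_gt0 : forall c, 0 < c <= n -> 0 < rk c)
  (rk_edge : forall k, k < N -> valid k -> field 5 k != 0 -> field 6 k != 0 ->
     rk (field 6 k) < rk (field 5 k)).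

Definition bpos k := rk (field 6 k).
Definition tpos k := (1 - field 5 k) * (n + 1) + rk (field 5 k).

Lemma bpos_lt_tpos k : k < N -> valid k -> bpos k < tpos k <= n + 1.
Proof.
move=> kN va; have [c5 c6] := curves_ok kN va; have := rk_edge kN va.
have r5 := rk_le c5; have r6 := rk_le c6.
rewrite /bpos /tpos; case: (field 5 k) (field 6 k) c5 c6 r5 r6 => [|c] [|c'] c5 c6 r5 r6.
- by rewrite rk0; lia.
- by rewrite rk0; lia.
- by rewrite rk0 => _; have := rk_gt0 (c := c.+1); lia.
- by move/(_ isT isT); lia.
Qed.

Definition slot_count (A : nat -> bool) (f : nat -> nat) (r : nat) : nat :=
  \sum_(k < N) (A k && (f k == r)).
(** A trapezoid that has ended stays in [ins] and is in [rem] as well: its two gains and two losses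
    fall on the same two slots and cancel in every prefix sum. *)
Definition pos_of ins rem r := slot_count ins bpos r + slot_count rem tpos r.
Definition neg_of ins rem r := slot_count ins tpos r + slot_count rem bpos r.

Lemma slot_count_le A f r : slot_count A f r <= N.
Proof.
apply: (@leq_trans (\sum_(k < N) 1)); last by rewrite sum1_card card_ord.
by apply: leq_sum => k _; case: (_ && _).
Qed.

Lemma pos_of_le ins rem r : pos_of ins rem r <= 2 * N.
Proof. by rewrite mul2n -addnn leq_add // slot_count_le. Qed.

Lemma neg_of_le ins rem r : neg_of ins rem r <= 2 * N.
Proof. by rewrite mul2n -addnn leq_add // slot_count_le. Qed.

Lemma slot_count_add A A' f k r : k < N -> ~~ A k ->
  (forall k', k' < N -> A' k' = (k' == k) || A k') ->
  slot_count A' f r = slot_count A f r + (r == f k).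
Proof.
move=> kN Ak AA; rewrite /slot_count (bigD1 (Ordinal kN)) //= AA // eqxx /=.
rewrite [in RHS](bigD1 (Ordinal kN)) //= (negbTE Ak) add0n addnC eq_sym; congr (_ + _).
by apply: eq_bigr => k' kk'; rewrite AA // (negbTE (kk' : (k' : nat) != k)).
Qed.

Lemma eq_slot_count A A' f r : (forall k, k < N -> A k = A' k) -> slot_count A f r = slot_count A' f r.
Proof. by move=> AA; apply: eq_bigr => k _; rewrite AA. Qed.

Lemma sum_slot_count A f r : \sum_(q < r.+1) slot_count A f q = \sum_(k < N) (A k && (f k <= r)).
Proof.
rewrite exchange_big; apply: eq_bigr => k _.
case: (A k) => /=; last by rewrite big1.
case: (leqP (f k) r) => fr; last first.
  by rewrite big1 // => q _; case: eqP => // E; have := ltn_ord q; lia.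
rewrite (bigD1 (Ordinal (fr : f k < r.+1))) //= eqxx big1 ?addn0 // => q.
by rewrite -val_eqE /= eq_sym => /negbTE ->.
Qed.

Lemma eq_model s p q pend p' q' pend' : (forall r, p r = p' r) ->
  (forall r, q r = q' r) -> (forall r, r < L -> pend r = pend' r) ->
  model s p q pend -> model s p' q' pend'.
Proof.
move=> pp qq pe [? ? ? mp mq mx mn]; split=> //.
- by move=> r rL; rewrite mp.
- by move=> r rL; rewrite mq.
- by move=> r rL; rewrite mx // pp qq.
- by move=> r rL; rewrite mn // pe.
Qed.

Definition ins_of (pend : nat -> bool) k :=
  valid k && ((field 7 k == 0) || ~~ pend (2 * k)).
Definition rem_of (pend : nat -> bool) k :=
  valid k && (field 8 k != 0) && ~~ pend (2 * k + 1).

Definition started k (v : R) := (field 7 k == 0) || (event_x (2 * k) <= v)%R.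
Definition ended k (v : R) := (field 8 k != 0) && (event_x (2 * k + 1) <= v)%R.
Definition alive k v r :=
  [&& valid k, started k v, ~~ ended k v, bpos k <= r & r < tpos k].
Definition depth v r := \sum_(k < N) alive k v r.

Hypothesis walls_lt : forall k, k < N -> valid k -> field 7 k != 0 ->
  field 8 k != 0 -> (event_x (2 * k) < event_x (2 * k + 1))%R.

Lemma event_okL k : event_ok (2 * k) = [&& k < N, valid k & field 7 k != 0].
Proof.
rewrite /event_ok /is_event ltn_mul2l /= mulKn // (_ : (2 * k) %% 2 = 0) //.
by rewrite modnMr.
Qed.

Lemma event_okR k : event_ok (2 * k + 1) = [&& k < N, valid k & field 8 k != 0].
Proof.
rewrite /event_ok /is_event (_ : (2 * k + 1) %/ 2 = k); last by lia.
rewrite (_ : (2 * k + 1) %% 2 = 1); last by lia.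
by rewrite (_ : (2 * k + 1 < 2 * N) = (k < N)) //; lia.
Qed.

(** When the pending events are those beyond [v], summing gains minus losses over the slots up to
    [r] leaves [(bpos k <= r) - (tpos k <= r)], the indicator of [bpos k <= r < tpos k], for each
    trapezoid that has started and not ended, and 0 for the others. [walls_lt] excludes a trapezoid
    that ends without having started. *)
Lemma root_depth s pend v :
  model s (pos_of (ins_of pend) (rem_of pend)) (neg_of (ins_of pend) (rem_of pend)) pend ->
  (forall id, event_ok id -> pend id = (v < event_x id)%R) ->
  (forall r, r < L -> depth v r <= imem s aMax 1) /\
  (exists2 r, r < L & depth v r = imem s aMax 1).
Proof.
move=> mo pv.
have key r : \sum_(q < r.+1) pos_of (ins_of pend) (rem_of pend) q =
   depth v r + \sum_(q < r.+1) neg_of (ins_of pend) (rem_of pend) q.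
  rewrite !big_split /= !sum_slot_count /depth -!big_split /=.
  apply: eq_bigr => k _; have kN := ltn_ord k.
  rewrite /alive /ins_of /rem_of /started /ended.
  case va: (valid k) => //=; have := bpos_lt_tpos kN va; have := walls_lt kN va.
  case f7: (field 7 k == 0) => /=; case f8: (field 8 k == 0) => //=.
  - by move=> _ /andP[bt _]; case: leqP; case: leqP => //=; lia.
  - rewrite pv ?event_okR ?kN ?va ?f8 // -Order.TotalTheory.leNgt.
    by move=> _ /andP[bt _]; case: (_ <= v)%R => //=; case: leqP; case: leqP => //=; lia.
  - rewrite pv ?event_okL ?kN ?va ?f7 // -Order.TotalTheory.leNgt.
    by move=> _ /andP[bt _]; case: (_ <= v)%R => //=; case: leqP; case: leqP => //=; lia.
  - rewrite !pv ?event_okL ?event_okR ?kN ?va ?f7 ?f8 // -!Order.TotalTheory.leNgt.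
    move=> /(_ isT isT) lt /andP[bt _].
    have : (event_x (2 * k + 1) <= v)%R -> (event_x (2 * k) <= v)%R.
      by apply: Order.POrderTheory.le_trans; apply: Order.POrderTheory.ltW.
    case: (_ <= v)%R => /= [/(_ isT) ->|_] /=; first by case: leqP; case: leqP => //=; lia.
    by case: (_ <= v)%R => //=; case: leqP; case: leqP => //=; lia.
have mL : forall q, L <= q < 2 * L -> imem s aMax q = imem s aPos q - imem s aNeg q.
  move=> q qL; have -> : q = L + (q - L) by lia.
  by rewrite (model_max mo) ?(model_pos mo) ?(model_neg mo) //; lia.
have leafp r : r < L -> \sum_(q < r.+1) imem s aPos (L + q) =
    \sum_(q < r.+1) pos_of (ins_of pend) (rem_of pend) q.
  by move=> rL; apply: eq_bigr => q _; rewrite (model_pos mo) //; have := ltn_ord q; lia.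
have leafn r : r < L -> \sum_(q < r.+1) imem s aNeg (L + q) =
    \sum_(q < r.+1) neg_of (ins_of pend) (rem_of pend) q.
  by move=> rL; apply: eq_bigr => q _; rewrite (model_neg mo) //; have := ltn_ord q; lia.
have [u w] := root_max (model_consistent mo) mL.
have U r : r < L -> depth v r <= imem s aMax 1.
  by move=> rL; have := u r rL; rewrite leafp // leafn // key leq_add2r.
(* A root value of 0 may come from the empty prefix; as it bounds all depths, rank 0 attains it as
   well. *)
split=> //; case: w => [z|[r rL E]].
  exists 0; first exact: L_gt0.
  by apply/eqP; have := U 0 L_gt0; rewrite z leqn0.
exists r => //; move: E; rewrite leafp // leafn // key.
by move/eqP; rewrite eqn_add2r => /eqP.
Qed.

Lemma root_event s p q pend : model s p q pend ->
  (forall id, pend id -> event_ok id) ->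
  (imem s aMin 1 = 0 -> forall id, ~~ pend id) /\
  (imem s aMin 1 <> 0 -> pend (imem s aMin 1 - 1) /\
    forall id, pend id -> (event_x (imem s aMin 1 - 1) <= event_x id)%R).
Proof.
move=> mo pe; have [z w] := root_min (model_consistent mo).
have pL id : pend id -> id < L by move=> /pe /and3P[lt _ _]; lia.
split=> [/z Z id|nz].
  apply/negP => pid; have idL := pL _ pid.
  by have := Z (L + id) ltac:(lia); rewrite (model_min mo) // pid.
have [[x xL E] lo] := w nz.
have xE : x = L + (x - L) by lia.
have xl : x - L < L by lia.
move: E; rewrite xE (model_min mo) //; case: ifP => [px E|_ E]; last by rewrite -E in nz.
rewrite -E subn1 /=; split=> // id pid; have idL := pL _ pid.
have := lo (L + id) ltac:(lia); rewrite (model_min mo) // pid -E !subn1 /=.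
by apply.
Qed.

Definition prepared (s : state R) ins rem pend :=
  model s (pos_of ins rem) (neg_of ins rem) pend /\ imem s aRank = rk.

Lemma eq_pos_of ins rem ins' rem' r :
  (forall k, k < N -> ins k = ins' k) -> (forall k, k < N -> rem k = rem' k) ->
  pos_of ins rem r = pos_of ins' rem' r.
Proof. by move=> ii rr; rewrite /pos_of (eq_slot_count _ _ ii) (eq_slot_count _ _ rr). Qed.

Lemma eq_neg_of ins rem ins' rem' r :
  (forall k, k < N -> ins k = ins' k) -> (forall k, k < N -> rem k = rem' k) ->
  neg_of ins rem r = neg_of ins' rem' r.
Proof. by move=> ii rr; rewrite /neg_of (eq_slot_count _ _ ii) (eq_slot_count _ _ rr). Qed.

Lemma eq_prepared s ins rem pend ins' rem' pend' :
  (forall k, k < N -> ins k = ins' k) -> (forall k, k < N -> rem k = rem' k) ->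
  (forall r, r < L -> pend r = pend' r) ->
  prepared s ins rem pend -> prepared s ins' rem' pend'.
Proof.
move=> ii rr pp [mo rks]; split=> //; apply: eq_model mo => // r.
  exact: eq_pos_of.
exact: eq_neg_of.
Qed.

Lemma wp_load_left s m k ins pend (Q : state R -> nat -> Prop) :
  k < N -> valid k -> imem s aK 0 = k ->
  prepared s ins (fun=> false) pend -> ~~ ins k -> ~~ pend (2 * k) ->
  20 * h + 11 <= m ->
  (forall s' m', m <= m' + (20 * h + 11) -> imem s' aK 0 = k ->
     prepared s' (fun k' => (k' == k) && (field 7 k == 0) || ins k')
       (fun=> false) (fun id => (id == 2 * k) && event_ok id || pend id) ->
     Q s' m') ->
  wp cv inp B W (load_left (var aK)) s m Q.
Proof.
move=> kN va sk [mo rks] nik npk lem H.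
have [c5 c6] := curves_ok kN va; have := bpos_lt_tpos kN va => /andP[bt tn].
have L0 := L_gt0.
have [m1 E] : exists m1, m = m1.+3 by exists (m - 3); lia.
subst m.
have B0 : 0 < B by lia.
have s7 := field_in size_inp (isT : 7 < 9) kN.
have s6 := field_in size_inp (isT : 6 < 9) kN.
have s5 := field_in size_inp (isT : 5 < 9) kN.
have s0 : 0 < size inp by rewrite size_inp.
have b5 : nth 0 inp (3 + 5 + 9 * k) < B by have := c5; rewrite /field /node_field; lia.
have b6 : nth 0 inp (3 + 6 + 9 * k) < B by have := c6; rewrite /field /node_field; lia.
have NW : 2 * (2 * N + 1) <= W by nia.
have LW : L <= W by nia.
have bW : bpos k <= W by lia.
have tW : tpos k <= W by lia.
rewrite /load_left /assign /var /field_e.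
apply: wp_if; [by run_pure; rewrite sk|by []|rewrite /= sk -/(field 7 k) => f7|
  rewrite /= sk -/(field 7 k) => f7]; simpl predn.
- rewrite /bot_e /top_e /field_e /in_n.
  apply: wp_seq; eapply wp_store; [run_pure|run_val|by run_pure; rewrite sk|rewrite /= sk rks -/(bpos k); reflexivity|conj..|].
  cbn [imem rmem predn].
  apply: wp_seq; eapply wp_store; [run_pure|run_val|by run_pure; rewrite sk|rewrite /upd /= sk rks inp_n -/(tpos k); reflexivity|conj..|].
  cbn [imem rmem predn].
  have := wp_bump; move/(_ _ _ _ _ pend (bpos k) (tpos k)).
  set s1 := State _ _.
  move=> /(_ s1 m1 (pos_of ins (fun=> false)) (neg_of ins (fun=> false)) Q); apply.
  + by case: mo => ? ? ? ? ? ? ?; split.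
  + by [].
  + by [].
  + lia.
  + lia.
  + exact: pos_of_le.
  + exact: neg_of_le.
  + lia.
  move=> s' m' lem' mo' fr'; apply: H; [lia|by rewrite fr'|].
  split; last by rewrite fr'.
  have add_ins f r : slot_count (fun k' => (k' == k) && (field 7 k == 0) || ins k') f r =
      slot_count ins f r + (r == f k).
    by apply: slot_count_add => // k' _; rewrite f7 andbT.
  apply: eq_model mo' => [r|r|id idL].
  + by rewrite /pos_of (add_ins bpos r) addnAC.
  + by rewrite /neg_of (add_ins tpos r) addnAC.
  + by case: eqP => //= ->; rewrite event_okL f7 !andbF.
- apply: wp_seq; eapply wp_store; [run_pure|run_val|run_pure|rewrite /= sk; reflexivity|conj; try lia..|].
  cbn [imem rmem predn].
  set s1 := State _ _.
  have ok : event_ok (2 * k) by rewrite event_okL kN va f7.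
  apply: (@wp_set_event _ s1 m1.+1 (pos_of ins (fun=> false)) (neg_of ins (fun=> false)) pend (2 * k) (2 * k).+1).
  + by case: mo => ? ? ? ? ? ? ?; split.
  + by [].
  + lia.
  + by run_pure.
  + by rewrite /= /upd /= sk addn1.
  + by right.
  + lia.
  move=> s' m' lem' mo' fr'; apply: H; [lia|by rewrite fr'|].
  split; last by rewrite fr'.
  apply: eq_model mo' => [r|r|id idL].
  + by apply: eq_pos_of => // k' _; rewrite (negbTE f7) andbF.
  + by apply: eq_neg_of => // k' _; rewrite (negbTE f7) andbF.
  + by case: eqP => //= ->; rewrite ok.
Qed.

Lemma wp_load_right s m k ins pend (Q : state R -> nat -> Prop) :
  k < N -> valid k -> imem s aK 0 = k ->
  prepared s ins (fun=> false) pend -> ~~ pend (2 * k + 1) ->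
  10 * h + 5 <= m ->
  (forall s' m', m <= m' + (10 * h + 5) -> imem s' aK 0 = k ->
     prepared s' ins (fun=> false) (fun id => (id == 2 * k + 1) && event_ok id || pend id) ->
     Q s' m') ->
  wp cv inp B W (load_right (var aK)) s m Q.
Proof.
move=> kN va sk [mo rks] npk lem H.
have L0 := L_gt0.
have [m1 E] : exists m1, m = m1.+3 by exists (m - 3); lia.
subst m.
have B0 : 0 < B by lia.
have s8 := field_in size_inp (isT : 8 < 9) kN.
have NW : 2 * (2 * N + 1) <= W by nia.
rewrite /load_right /assign /var /field_e.
apply: wp_if; [by run_pure; rewrite sk|by []|rewrite /= sk -/(field 8 k) => f8|
  rewrite /= sk -/(field 8 k) => f8]; simpl predn.
- apply: wp_skip => //=; apply: H => //; first lia.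
  split=> //; apply: eq_model mo => // id idL.
  by case: eqP => //= ->; rewrite event_okR f8 !andbF (negbTE npk).
- apply: wp_seq; eapply wp_store; [run_pure|run_val|run_pure|rewrite /= sk; reflexivity|conj; try lia..|].
  cbn [imem rmem predn].
  set s1 := State _ _.
  have ok : event_ok (2 * k + 1) by rewrite event_okR kN va f8.
  apply: (@wp_set_event _ s1 m1.+1 (pos_of ins (fun=> false)) (neg_of ins (fun=> false)) pend (2 * k + 1) (2 * k + 2)).
  + by case: mo => ? ? ? ? ? ? ?; split.
  + by [].
  + lia.
  + by run_pure.
  + by rewrite /= /upd /= sk.
  + by right; split=> //; lia.
  + lia.
  move=> s' m' lem' mo' fr'; apply: H; [lia|by rewrite fr'|].
  split; last by rewrite fr'.
  apply: eq_model mo' => // id idL.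
  by case: eqP => //= ->; rewrite ok addn2.
Qed.

Lemma wp_load_traps s m (Q : state R -> nat -> Prop) :
  prepared s (fun=> false) (fun=> false) (fun=> false) ->
  N * (30 * h + 20) + 2 <= m ->
  (forall s' m', m <= m' + (N * (30 * h + 20) + 2) ->
     prepared s' (ins_of event_ok) (rem_of event_ok) event_ok -> Q s' m') ->
  wp cv inp B W load_traps s m Q.
Proof.
move=> pr lem H.
have L0 := L_gt0; have B0 : 0 < B by lia.
have NW : 2 * (2 * N + 1) <= W by nia.
pose insj j k := [&& valid k, field 7 k == 0 & k < j].
pose pendj j id := event_ok id && (id %/ 2 < j).
have [m1 E] : exists m1, m = m1.+1 by exists (m - 1); lia.
subst m.
rewrite /load_traps /assign /var.
apply: wp_seq; eapply wp_store; [run_pure|run_val|run_pure|run_val|conj..|] => //.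
cbn [imem rmem predn].
pose I (s1 : state R) m1' := exists j, [/\ j <= N, imem s1 aK 0 = j,
   prepared s1 (insj j) (fun=> false) (pendj j) &
   (N - j) * (30 * h + 20) < m1' /\ m1 + (N - j) * (30 * h + 20) <= m1' + N * (30 * h + 20)].
have s1' : 1 < size inp by rewrite size_inp.
have s2' : 2 < size inp by rewrite size_inp.
apply: (@wp_while _ _ _ _ _ _ _ _ I); last first.
  exists 0; split=> //; last by rewrite subn0; lia.
  apply: (@eq_prepared _ (fun=> false) (fun=> false) (fun=> false)) => //.
  - by move=> k _; rewrite /insj ltn0 !andbF.
  - by move=> k _; rewrite /pendj ltn0 !andbF.
  - by case: pr => -[? ? ? ? ? ? ?] ?; split.
move=> {pr lem}s1 m2 [j [jN sj pr [lem1 lem2]]]; split; [by run_pure|exact: leq_ltn_trans (leq0n _) lem1| |].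
- rewrite /= sj inp_N => lt.
  have [d Ed] : exists d, N - j = d.+1 by exists (N - j).-1; lia.
  rewrite Ed mulSn in lem1 lem2.
  have [m3 E] : exists m3, m2.-1 = m3.+1 by exists (m2 - 2); lia.
  rewrite E.
  have jd : N - j.+1 = d by lia.
  have pend_half id : (id == 2 * j) || (id == 2 * j + 1) = (id %/ 2 == j).
    apply/idP/eqP => [/orP[]/eqP ->|<-]; [exact: mulKn|lia|].
    by apply/orP; case: (eqVneq id (2 * (id %/ 2))) => [|ne]; [left|right; lia].
  apply: wp_seq; rewrite /valid_e /field_e /in_root /var.
  have in4 := field_in size_inp (isT : 4 < 9) lt.
  have fin s4 m4 : m3 <= m4 + (30 * h + 16) -> imem s4 aK 0 = j ->
     prepared s4 (insj j.+1) (fun=> false) (pendj j.+1) ->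
     wp cv inp B W (CStore aK (ILit 0) (IAdd (ILoad aK (ILit 0)) (ILit 1))) s4 m4 I.
    move=> lem4 k4 pr4; eapply wp_store; [run_pure|run_val|run_pure|rewrite /= k4 addn1; reflexivity|lia|lia|lia|].
    exists j.+1; split=> //; last by rewrite jd; lia.
    by case: pr4 => -[? ? ? ? ? ? ?] ?; split.
  apply: wp_if; [by run_pure; rewrite sj|by []|rewrite /= sj inp_root => va; have {}va : valid j := va|
    rewrite /= sj inp_root => va; have {}va : ~~ valid j := va]; simpl predn.
  + apply: wp_seq; apply: (wp_load_left (k := j) lt va sj pr).
    * by rewrite /insj ltnn !andbF.
    * by rewrite /pendj mulKn // ltnn andbF.
    * lia.
    move=> s5 m5 lem5 k5 pr5; apply: (wp_load_right (k := j) lt va k5 pr5).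
    * rewrite /pendj (_ : (2 * j + 1) %/ 2 = j) ?ltnn ?andbF ?orbF; last by lia.
      by case: eqP => //; lia.
    * lia.
    move=> s6 m6 lem6 k6 pr6; apply: fin => //; first lia.
    apply: eq_prepared pr6 => // [k _|id _].
    * rewrite /insj ltnS [k <= j]leq_eqVlt; case: (eqVneq k j) => [->|_] //=.
      by rewrite va ltnn !andbF orbF andbT.
    * rewrite /pendj ltnS [id %/ 2 <= j]leq_eqVlt -pend_half.
      by case: (id == 2 * j); case: (id == 2 * j + 1); case: (event_ok id).
  + apply: wp_skip; [lia|apply: (fin s1) => //; first lia].
    apply: eq_prepared pr => // [k _|id _].
    * rewrite /insj ltnS [k <= j]leq_eqVlt; case: (eqVneq k j) => [->|_] //=.
      by rewrite (negbTE va).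
    * rewrite /pendj ltnS [id %/ 2 <= j]leq_eqVlt; case: (eqVneq _ j) => [E2|_] //=; rewrite E2 ltnn andbF.
      by rewrite /event_ok /is_event E2 -/valid (negbTE va) /= andbF.
- rewrite /= sj inp_N => ge; apply: H; first by lia.
  have jE : j = N by lia.
  rewrite jE in pr; apply: eq_prepared pr => [k kN|k kN|id idL].
  + by rewrite /insj /ins_of event_okL kN; case: (valid k) => //=; case: (field 7 k == 0).
  + by rewrite /rem_of event_okR kN; case: (valid k) => //=; case: (field 8 k == 0).
  + rewrite /pendj; case E: (event_ok id) => //=; case/and3P: E => lt _ _.
    by rewrite ltn_divLR // mulnC.
Qed.

Lemma depth_le v r : depth v r <= N.
Proof.
apply: (@leq_trans (\sum_(k < N) 1)); last by rewrite sum1_card card_ord.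
by apply: leq_sum => k _; case: (alive _ _ _).
Qed.

(** Such a [v] turns the maximum at the root before the first event into a value of [depth]. *)
Lemma below_all_events : exists v, forall id, event_ok id -> (v < event_x id)%R.
Proof.
suff H K : exists v, forall id, id < K -> (v < event_x id)%R.
  have [v lt] := H (2 * N); exists v => id /and3P[idN _ _]; exact: lt.
elim: K => [|K [v lt]]; first by exists GRing.zero.
exists (Order.min v (event_x K - 1)%R) => id.
rewrite ltnS leq_eqVlt => /orP[/eqP ->|/lt {}lt].
  by rewrite Order.TotalTheory.gt_min orbC Num.Theory.ltrBlDr
    Num.Theory.ltrDl Num.Theory.ltr01.
by rewrite Order.TotalTheory.gt_min lt.
Qed.

Definition without (pend : nat -> bool) id r := if r == id then false else pend r.

Lemma ins_of_without (pend : nat -> bool) id k : pend id -> event_ok id -> k < N ->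
  ins_of (without pend id) k = (k == id %/ 2) && (2 * k == id) || ins_of pend k.
Proof.
move=> pid ok kN; rewrite /ins_of /without; case: (eqVneq (2 * k) id) => [E|_].
  by move: ok; rewrite -E event_okL mulKn // eqxx => /and3P[_ -> _]; rewrite orbT.
by rewrite andbF.
Qed.

Lemma rem_of_without (pend : nat -> bool) id k : pend id -> event_ok id -> k < N ->
  rem_of (without pend id) k = (k == id %/ 2) && (2 * k != id) || rem_of pend k.
Proof.
move=> pid ok kN; rewrite /rem_of /without; case: (eqVneq (2 * k + 1) id) => [E|ne].
  move: ok; rewrite -E event_okR => /and3P[_ -> ->].
  by rewrite (_ : (2 * k + 1) %/ 2 = k) ?eqxx; [rewrite (_ : 2 * k != 2 * k + 1) //; lia|lia].
suff -> : (k == id %/ 2) && (2 * k != id) = false by [].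
by apply/negbTE/negP => /andP[/eqP kE /eqP nE]; lia.
Qed.

Definition pending (pend : nat -> bool) := \sum_(id < 2 * N) pend id.

Lemma pending_without (pend : nat -> bool) id : pend id -> id < 2 * N ->
  pending pend = (pending (without pend id)).+1.
Proof.
move=> pid idN; rewrite /pending (bigD1 (Ordinal idN)) //= pid add1n; congr _.+1.
rewrite [RHS](bigD1 (Ordinal idN)) //= /without eqxx add0n.
by apply: eq_bigr => i ne; rewrite (negbTE (ne : (i : nat) != id)).
Qed.

(** The counters are tied to the set of pending events, not to an abscissa: within a group of walls
    with equal abscissas this set need not consist of all events beyond some [v]. Accordingly
    [swept_max] speaks only of abscissas before all pending events, while [swept_depth] keeps the
    recorded value from exceeding the true maximum. *)
Record swept (s : state R) (pend : nat -> bool) : Prop := {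
  swept_prepared : prepared s (ins_of pend) (rem_of pend) pend;
  swept_ok : forall id, pend id -> event_ok id;
  swept_order : forall id id', event_ok id -> ~~ pend id -> pend id' ->
    (event_x id <= event_x id')%R;
  swept_max : forall v, (forall id, pend id -> (v < event_x id)%R) ->
    forall r, r < L -> depth v r <= imem s aBest 0;
  swept_depth : exists v, exists2 r, r < L & depth v r = imem s aBest 0 }.

Lemma model_frame s s' p q pend :
  (forall a, a \in [:: aL; aPos; aNeg; aMax; aMin] -> imem s' a = imem s a) ->
  model s p q pend -> model s' p q pend.
Proof.
move=> E [sL bd co mp mq mx mn].
have [eL eP eN eM eI] : [/\ imem s' aL = imem s aL, imem s' aPos = imem s aPos,
    imem s' aNeg = imem s aNeg, imem s' aMax = imem s aMax & imem s' aMin = imem s aMin].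
  by split; apply: E.
split; rewrite ?eL ?eP ?eN ?eM ?eI //.
  by move=> j jL; rewrite eP eN eM eI; apply: bd.
by move=> j jL; rewrite /consistent_at eP eN eM eI; apply: co.
Qed.

Lemma wp_choose s m k id (Q : state R -> nat -> Prop) :
  k < N -> valid k -> imem s aK 0 = k -> imem s aEv 0 = id -> 
  imem s aRank = rk -> 4 <= m ->
  (forall s' m', m <= m' + 4 ->
    imem s' aU 0 = (if 2 * k == id then bpos k else tpos k) ->
    imem s' aV 0 = (if 2 * k == id then tpos k else bpos k) ->
    (forall a, a \notin [:: aU; aV] -> imem s' a = imem s a) -> Q s' m') ->
  wp cv inp B W
   (CIf (BEq (IMul (ILit 2) (var aK)) (var aEv))
    (CSeq (assign aU (bot_e (var aK))) (assign aV (top_e (var aK))))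
    (CSeq (assign aU (top_e (var aK))) (assign aV (bot_e (var aK))))) s m Q.
Proof.
move=> kN va sk sid rks lem H.
have [c5 c6] := curves_ok kN va; have := bpos_lt_tpos kN va => /andP[bt tn].
have L0 := L_gt0.
have [m1 E] : exists m1, m = m1.+4 by exists (m - 4); lia.
subst m.
have B0 : 0 < B by lia.
have s6 := field_in size_inp (isT : 6 < 9) kN.
have s5 := field_in size_inp (isT : 5 < 9) kN.
have s0 : 0 < size inp by rewrite size_inp.
have b5 : nth 0 inp (3 + 5 + 9 * k) < B by have := c5; rewrite /field /node_field; lia.
have b6 : nth 0 inp (3 + 6 + 9 * k) < B by have := c6; rewrite /field /node_field; lia.
have LW : L <= W by nia.
have bW : bpos k <= W by lia.
have tW : tpos k <= W by lia.
rewrite /assign /bot_e /top_e /var /field_e /in_n.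
have fr (x y : nat) : forall a, a \notin [:: aU; aV] ->
    upd (upd (imem s) aU 0 x) aV 0 y a = imem s a.
  move=> a; rewrite !inE negb_or => /andP[/negbTE nu /negbTE nv].
  by apply/funext => j; rewrite /upd nu nv.
apply: wp_if; [by run_pure|by []|rewrite /= sk sid => e|rewrite /= sk sid => e]; simpl predn;
  rewrite ?e ?(negbTE e) in H.
- apply: wp_seq; eapply wp_store; [run_pure|run_val|by run_pure; rewrite sk|rewrite /= sk rks -/(bpos k); reflexivity|conj..|].
  cbn [imem rmem predn].
  eapply wp_store; [run_pure|run_val|by run_pure; rewrite sk|rewrite /upd /= sk rks inp_n -/(tpos k); reflexivity|conj..|].
  cbn [imem rmem predn]; apply: H => //; [lia|exact: fr].
- apply: wp_seq; eapply wp_store; [run_pure|run_val|by run_pure; rewrite sk|rewrite /= sk rks inp_n -/(tpos k); reflexivity|conj..|].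
  cbn [imem rmem predn].
  eapply wp_store; [run_pure|run_val|by run_pure; rewrite sk|rewrite /upd /= sk rks -/(bpos k); reflexivity|conj..|].
  cbn [imem rmem predn]; apply: H => //; [lia|exact: fr].
Qed.

Lemma wp_record_best s m (Q : state R -> nat -> Prop) :
  0 < m -> imem s aMax 1 <= N -> imem s aBest 0 <= N ->
  (forall s', imem s' aBest 0 = maxn (imem s aBest 0) (imem s aMax 1) ->
     (forall a, a != aBest -> imem s' a = imem s a) -> Q s' m.-1) ->
  wp cv inp B W record_best s m Q.
Proof.
move=> m0 xN bN H; have L0 := L_gt0; have B0 : 0 < B by lia.
have B1 : 1 < B by lia.
have NW : N <= W by nia.
have bW : imem s aBest 0 + (imem s aMax 1 - imem s aBest 0) <= W by clear -xN bN NW; lia.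
rewrite /record_best /assign /var.
eapply wp_store; [run_pure|run_val|run_pure|run_val|conj..|].
apply: H => [|a /negbTE na] /=; first by rewrite /upd /=; lia.
by apply/funext => j; rewrite /upd na.
Qed.

Lemma event_in x : 0 < x -> event_ok (x - 1) ->
  10 + (x - 1 - 2 * ((x - 1) %/ 2) + 9 * ((x - 1) %/ 2)) < size inp.
Proof. by move=> x0 /and3P[lt _ _]; rewrite size_inp; lia. Qed.

Lemma wp_sweep_event s m pend (Q : state R -> nat -> Prop) :
  swept s pend -> imem s aMin 1 <> 0 -> 30 * h + 30 <= m ->
  (forall s' m' pend', m <= m' + (30 * h + 30) -> swept s' pend' ->
     pending pend = (pending pend').+1 -> Q s' m') ->
  wp cv inp B W sweep_event s m Q.
Proof.
move=> sw nz lem H.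
have [[mo rks] ok ord up dep] := sw.
have [_ /(_ nz)[]] := root_event mo ok.
set id := imem s aMin 1 - 1 => pid idmin.
have okid := ok _ pid; have := okid => /and3P[idN va _].
set k := id %/ 2 in va.
have L0 := L_gt0; have B0 : 0 < B by lia.
have B1 : 1 < B by lia.
have NW : 2 * (2 * N + 1) <= W by nia.
have kN : k < N by rewrite ltn_divLR // mulnC.
have := bpos_lt_tpos kN va => /andP[bt tn].
have bN : imem s aBest 0 <= N by case: dep => v [r _ <-]; apply: depth_le.
have [m1 E] : exists m1, m = m1.+2 by exists (m - 2); lia.
subst m.
have idW : id <= W by lia.
have kW : k <= W by lia.
rewrite /sweep_event.
apply: wp_seq; eapply wp_store; [run_pure|run_val|run_pure|rewrite /= -/id; reflexivity|conj..|].
cbn [imem rmem predn].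
apply: wp_seq; eapply wp_store; [run_pure|run_val|run_pure|rewrite /upd /= -/k; reflexivity|conj..|].
cbn [imem rmem predn].
set s2 := State _ _.
have mo2 : model s2 (pos_of (ins_of pend) (rem_of pend)) (neg_of (ins_of pend) (rem_of pend)) pend.
  by case: mo => ? ? ? ? ? ? ?; split.
apply: wp_seq; apply: (@wp_choose s2 m1 k id) => //; first lia.
move=> s3 m3 lem3 u3 v3 fr3.
have mo3 : model s3 (pos_of (ins_of pend) (rem_of pend)) (neg_of (ins_of pend) (rem_of pend)) pend.
  by apply: model_frame mo2 => a ain; apply: fr3; move: a ain; apply/allP.
apply: wp_seq; apply: (wp_bump mo3 u3 v3).
- by case: ifP => _; lia.
- by case: ifP => _; lia.
- exact: pos_of_le.
- exact: neg_of_le.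
- lia.
move=> s4 m4 lem4 mo4 fr4.
have id4 : imem s4 aEv 0 = id by rewrite fr4 // fr3.
apply: wp_seq; apply: (@wp_set_event (ILit 0) _ _ _ _ _ id 0 _ mo4 id4) => //.
- by left.
- lia.
move=> s5 m5 lem5 mo5 fr5.
set pend' := without pend id.
have mo' : model s5 (pos_of (ins_of pend') (rem_of pend')) (neg_of (ins_of pend') (rem_of pend')) pend'.
  have iw k' : k' < N -> ins_of pend' k' = (k' == k) && (2 * k' == id) || ins_of pend k'.
    exact: ins_of_without.
  have rw k' : k' < N -> rem_of pend' k' = (k' == k) && (2 * k' != id) || rem_of pend k'.
    exact: rem_of_without.
  (* An even identifier is a left wall, by which [k] joins [ins]; an odd one is a right wall, by
     which [k] joins [rem]. *)
  case e: (2 * k == id) in mo5.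
  - have I f r : slot_count (ins_of pend') f r = slot_count (ins_of pend) f r + (r == f k).
      apply: slot_count_add => // [|k' k'N].
        by rewrite /ins_of (eqP e) pid; case/and3P: okid => _ _; rewrite -(eqP e) mulKn //
          (_ : (2 * k) %% 2 = 0) ?modnMr // => /negbTE f7; rewrite /field f7 andbF.
      by rewrite iw //; case: (eqVneq k' k) => [->|_]; rewrite ?e.
    have J f r : slot_count (rem_of pend') f r = slot_count (rem_of pend) f r.
      by apply: eq_slot_count => k' k'N; rewrite rw //; case: (eqVneq k' k) => [->|_]; rewrite ?e.
    by apply: eq_model mo5 => // r; rewrite /pos_of /neg_of I J addnAC.
  - have idE : id = 2 * k + 1 by move/eqP: e; rewrite /k; lia.
    have I f r : slot_count (ins_of pend') f r = slot_count (ins_of pend) f r.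
      by apply: eq_slot_count => k' k'N; rewrite iw //; case: (eqVneq k' k) => [->|_]; rewrite ?e.
    have J f r : slot_count (rem_of pend') f r = slot_count (rem_of pend) f r + (r == f k).
      apply: slot_count_add => // [|k' k'N]; first by rewrite /rem_of -idE pid andbF.
      by rewrite rw //; case: (eqVneq k' k) => [->|_]; rewrite ?e.
    by apply: eq_model mo5 => // r; rewrite /pos_of /neg_of I J addnA.
have ok' id' : pend' id' -> event_ok id'.
  by rewrite /pend' /without; case: eqP => // _; apply: ok.
have pe' id' : pend' id' -> pend id'.
  by rewrite /pend' /without; case: eqP.
have [rz rnz] := root_event mo' ok'.
have fr5s a : a \notin [:: aI; aPos; aNeg; aMax; aMin; aU; aV; aEv; aK] ->
   imem s5 a = imem s a.
  rewrite !inE !negb_or => /and5P[n1 n2 n3 n4] /and5P[n5 n6 n7 n8 n9].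
  rewrite fr5 ?fr4 ?fr3 ?inE ?negb_or ?n1 ?n2 ?n3 ?n4 ?n5 ?n6 ?n7 //.
  by apply/funext => j; rewrite /= /upd (negbTE n8) (negbTE n9).
have id5 : imem s5 aEv 0 = id by rewrite fr5 // fr4 // fr3.
have best5 : imem s5 aBest 0 = imem s aBest 0 by rewrite fr5s.
have ordk id' : event_ok id' -> ~~ pend' id' -> (event_x id' <= event_x id)%R.
  rewrite /pend' /without; case: eqP => [-> //|_ oki npi]; exact: ord.
have ord' i1 i2 : event_ok i1 -> ~~ pend' i1 -> pend' i2 -> (event_x i1 <= event_x i2)%R.
  by move=> o1 n1 p2; apply: Order.POrderTheory.le_trans (ordk _ o1 n1) (idmin _ (pe' _ p2)).
have fin s6 m6 : (forall a, a != aBest -> imem s6 a = imem s5 a) ->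
   m1.+2 <= m6 + (30 * h + 30) ->
   (forall v, (forall id, pend' id -> (v < event_x id)%R) -> forall r, r < L -> depth v r <= imem s6 aBest 0) ->
   (exists v, exists2 r, r < L & depth v r = imem s6 aBest 0) -> Q s6 m6.
  move=> fr6 lem6 up6 dep6; apply: H (pending_without pid idN) => //.
  split=> //; split; first by apply: model_frame mo' => a ain; apply: fr6; move: a ain; apply/allP.
  by rewrite fr6 // fr5s.
(* From the event just processed up to the next pending one, the pending events are exactly those
   beyond [v], so [root_depth] applies. *)
have quiet v : (event_x id <= v)%R -> (forall i, pend' i -> (v < event_x i)%R) ->
   forall i, event_ok i -> pend' i = (v < event_x i)%R.
  move=> le lt i oki; case p: (pend' i); first by rewrite lt.
  symmetry; apply/negbTE; rewrite -Order.TotalTheory.leNgt.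
  by apply: Order.POrderTheory.le_trans le; apply: ordk => //; rewrite p.
have old v : (v < event_x id)%R -> forall r, r < L -> depth v r <= imem s aBest 0.
  move=> lt; apply: up => i pi; apply: Order.POrderTheory.lt_le_trans lt _; exact: idmin.
have rec m6 : 30 * h + 30 + m6 > m1.+2 -> 
   (forall i, pend' i -> (event_x id < event_x i)%R) -> wp cv inp B W record_best s5 m6 Q.
  move=> lem6 lt.
  have [u1 [r1 rL1 E1]] := root_depth mo' (quiet _ (Order.POrderTheory.lexx _) lt).
  apply: wp_record_best; rewrite ?best5 //; first lia.
    by rewrite -E1 depth_le.
  move=> s6 b6 fr6; apply: fin => //; first lia.
    move=> v vlt r rL; rewrite b6 leq_max; case: (Order.TotalTheory.ltP v (event_x id)) => cmp.
      by rewrite old.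
    by have [-> //] := root_depth mo' (quiet _ cmp vlt); rewrite orbT.
  rewrite b6; case: leqP => _; last by [].
  by exists (event_x id), r1.
have [m6 E6] : exists m6, m5 = m6.+4 by exists (m5 - 4); lia.
subst m5.
apply: wp_if; [by run_pure|by []|rewrite /= => /eqP z|rewrite /= => /eqP nz5]; simpl predn.
  by apply: rec; [lia|move=> i; rewrite (negbTE (rz z i))].
have [p5 min5] := rnz nz5.
apply: wp_if; [|by []|rewrite /= id5 => cmp|rewrite /= id5 => cmp]; simpl predn.
- have e5 := ok' _ p5.
  have h1 := event_handle_lt inp_N inp_root size_inp walls_ok e5.
  have okid1 : event_ok (id + 1 - 1) by rewrite addnK.
  have h2 := event_handle_lt inp_N inp_root size_inp walls_ok okid1.
  have x5 : 0 < imem s5 aMin 1 by rewrite lt0n; apply/eqP.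
  have a1 := event_in x5 e5.
  have x1 : 0 < id + 1 by rewrite addn1.
  have a2 := event_in x1 okid1.
  by rewrite /= id5; conj.
- apply: rec; first lia.
  move=> i pi; apply: Order.POrderTheory.lt_le_trans (min5 _ pi).
  by move: cmp; rewrite -!/(event_handle _ _) addnK.
(* The next event is not further right: every [v] before all pending events is then also before the
   event just processed, so there is no new abscissa to account for. *)
- apply: wp_skip => //; apply: fin => //; [lia| |by rewrite best5].
  move=> v vlt r rL; rewrite best5; apply: old => //.
  apply: Order.POrderTheory.lt_le_trans (vlt _ p5) _.
  by move: cmp; rewrite -!/(event_handle _ _) addnK -Order.TotalTheory.leNgt.
Qed.

Lemma wp_sweep s m (Q : state R -> nat -> Prop) :
  prepared s (ins_of event_ok) (rem_of event_ok) event_ok ->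
  2 * N * (30 * h + 31) + 3 <= m ->
  (forall s' m', m <= m' + (2 * N * (30 * h + 31) + 3) ->
    (forall v r, r < L -> depth v r <= imem s' aBest 0) ->
    (exists v, exists2 r, r < L & depth v r = imem s' aBest 0) -> Q s' m') ->
  wp cv inp B W sweep s m Q.
Proof.
move=> [mo rks] lem H.
have [v0 v0lt] := below_all_events.
have L0 := L_gt0; have B0 : 0 < B by lia.
have B1 : 1 < B by lia.
have NW : 2 * (2 * N + 1) <= W by nia.
have q0 v : (forall id, event_ok id -> (v < event_x id)%R) -> forall id, event_ok id ->
    event_ok id = (v < event_x id)%R.
  by move=> lt id okid; rewrite okid lt.
have [u0 [r0 rL0 E0]] := root_depth mo (q0 _ v0lt).
have xW : imem s aMax 1 <= W by rewrite -E0; have := depth_le v0 r0; lia.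
have [m1 E] : exists m1, m = m1.+1 by exists (m - 1); lia.
subst m.
rewrite /sweep.
apply: wp_seq; eapply wp_store; [run_pure|run_val|run_pure|run_val|conj..|].
cbn [imem rmem predn].
pose I (s1 : state R) m2 := exists pend, [/\ swept s1 pend,
  pending pend * (30 * h + 31) < m2 &
  m1 + pending pend * (30 * h + 31) <= m2 + 2 * N * (30 * h + 31)].
have pendN pend : pending pend <= 2 * N.
  apply: (@leq_trans (\sum_(k < 2 * N) 1)); last by rewrite sum1_card card_ord.
  by apply: leq_sum => k _; case: (pend _).
apply: (@wp_while _ _ _ _ _ _ _ _ I); last first.
  exists event_ok; have := leq_mul (pendN event_ok) (leqnn (30 * h + 31)).
  move=> le; split; [|lia|lia].
  split=> //.
  - by split=> //; case: mo => ? ? ? ? ? ? ?; split.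
  - by move=> id id' -> .
  - move=> v lt r rL; rewrite /= /upd /=.
    by have [-> //] := root_depth mo (q0 _ lt).
  - by exists v0, r0.
move=> s1 m2 [pend [sw lem1 lem2]]; split; [by run_pure|exact: leq_ltn_trans (leq0n _) lem1| |].
- rewrite /= lt0n => /eqP nz.
  case E: (pending pend) lem1 lem2 => [|d] lem1 lem2.
    have [_ /(_ nz)[p _]] := root_event (swept_prepared sw).1 (@swept_ok _ _ sw).
    have := @swept_ok _ _ sw _ p => /and3P[lt _ _].
    by have := pending_without p lt; rewrite E.
  rewrite mulSn in lem1 lem2.
  apply: (wp_sweep_event sw nz); first lia.
  move=> s' m' pend' lem' sw' E'; exists pend'; split=> //.
    by move: E'; rewrite E => -[<-]; lia.
  by move: E'; rewrite E => -[<-]; lia.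
- rewrite /= lt0n negbK => /eqP z.
  have [nop _] := root_event (swept_prepared sw).1 (@swept_ok _ _ sw).
  apply: H; [lia| |exact: swept_depth sw].
  by move=> v r rL; apply: (swept_max sw) => // id; rewrite (negbTE (nop z id)).
Qed.
End Sweep.

(** * Topological sorting of the curves *)

Local Open Scope prog_scope.

(** These are adjacency lists in which a record serves as its own edge: pointers are shifted by one
    and 0 ends a list. Several records with the same pair of curves give parallel edges, each
    counted in [aDeg]. *)
Definition add_edge (k : iexp) :=
  CIf (BAnd (valid_e k) (BAnd (BNot (field_e 5 k == #0)) (BNot (field_e 6 k == #0))))
    (CStore aNext k aHead.[field_e 6 k];;
     CStore aHead (field_e 6 k) (k + #1);;
     CStore aDeg (field_e 5 k) (aDeg.[field_e 5 k] + #1))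
    CSkip.

Definition build_graph :=
  assign aK #0;;
  CWhile (var aK < in_N) (add_edge (var aK);; assign aK (var aK + #1)).

Definition enqueue (c : iexp) :=
  CStore aQueue (var aQt) c;; assign aQt (var aQt + #1).

(* [aDeg] counts the edges from curves that are not processed yet (Kahn). *)
Definition find_sources :=
  assign aC #1;;
  CWhile (var aC < in_n + #1)
    (CIf (aDeg.[var aC] == #0) (enqueue (var aC)) CSkip;;
     assign aC (var aC + #1)).

Definition relax :=
  assign aC (field_e 5 (var aEdge - #1));;
  CStore aDeg (var aC) (aDeg.[var aC] - #1);;
  assign aEdge aNext.[var aEdge - #1];;
  CIf (aDeg.[var aC] == #0) (enqueue (var aC)) CSkip.

(** The rank is read after [aQh] is incremented, so ranks start at 1 and 0 remains for a missing
    bottom curve. *)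
Definition process_curve :=
  assign aC aQueue.[var aQh];;
  assign aQh (var aQh + #1);;
  CStore aRank (var aC) (var aQh);;
  assign aEdge aHead.[var aC];;
  CWhile (#0 < var aEdge) relax.

Definition toposort := CWhile (var aQh < var aQt) process_curve.

Local Close Scope prog_scope.

Section Topo.
Variables (R : realType) (n : nat) (cv : 'I_n -> curve R).
Variables (inp : seq nat) (B W N root : nat).
Hypotheses (size_inp : size inp = 3 + 9 * N).
Hypotheses (inp_n : nth 0 inp 0 = n) (inp_N : nth 0 inp 1 = N)
  (inp_root : nth 0 inp 2 = root).
Let valid := is_record inp root.
Let field := node_field inp.
Hypothesis curves_ok : forall k, k < N -> valid k ->
  field 5 k <= n /\ field 6 k <= n.
Hypotheses (B_big : N + n + 2 <= B) (W_big : N + n + 2 <= W).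

Definition edge k := [&& valid k, field 5 k != 0 & field 6 k != 0].
Definition src k := field 6 k.
Definition dst k := field 5 k.

Lemma srcE k : nth 0 inp (3 + 6 + 9 * k) = src k. Proof. by []. Qed.
Lemma dstE k : nth 0 inp (3 + 5 + 9 * k) = dst k. Proof. by []. Qed.

(** Any potential that grows along the edges witnesses acyclicity; it enters only the argument that
    no curve is left out of the queue. *)
Variable height : nat -> nat.
Hypothesis acyclic : forall k, k < N -> edge k -> height (src k) < height (dst k).

Lemma src_in k : k < N -> edge k -> 0 < src k <= n.
Proof. by move=> kN /and3P[va _ nz]; rewrite lt0n nz; have [] := curves_ok kN va. Qed.

Lemma dst_in k : k < N -> edge k -> 0 < dst k <= n.
Proof. by move=> kN /and3P[va nz _]; rewrite lt0n nz; have [] := curves_ok kN va. Qed.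

Fixpoint chain (next : nat -> nat) (e : nat) (l : seq nat) : Prop :=
  if l is k :: l' then e = k.+1 /\ chain next (next k) l' else e = 0.

Lemma eq_chain next next' e l : {in l, next =1 next'} ->
  chain next e l -> chain next' e l.
Proof.
elim: l e => //= k l IH e E [-> c]; split=> //; rewrite -E ?mem_head //.
by apply: IH c => x xl; apply: E; rewrite inE xl orbT.
Qed.

(** The order is reversed because each edge is put in front of those found before it. *)
Definition out_edges j c := [seq k <- rev (iota 0 j) | edge k && (src k == c)].
Definition in_degree j c := count (fun k => edge k && (dst k == c)) (iota 0 j).

Lemma in_degree_le j c : in_degree j c <= j.
Proof. by rewrite -{2}(size_iota 0 j) count_size. Qed.

Lemma wp_build_graph s m (Q : state R -> nat -> Prop) :
  (forall c, imem s aHead c = 0) -> (forall c, imem s aDeg c = 0) ->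
  N * 8 + 2 <= m ->
  (forall s' m', m <= m' + (N * 8 + 2) ->
    (forall c, chain (imem s' aNext) (imem s' aHead c) (out_edges N c)) ->
    (forall c, imem s' aDeg c = in_degree N c) -> Q s' m') ->
  wp cv inp B W build_graph s m Q.
Proof.
move=> h0 d0 lem H.
have B0 : 0 < B by lia.
have [m1 E] : exists m1, m = m1.+1 by exists (m - 1); lia.
subst m.
have s1' : 1 < size inp by rewrite size_inp.
have s2' : 2 < size inp by rewrite size_inp.
rewrite /build_graph /assign /var.
apply: wp_seq; eapply wp_store; [run_pure|run_val|run_pure|run_val|conj..|] => //.
cbn [imem rmem predn].
pose I (s1 : state R) m2 := exists j, [/\ j <= N, imem s1 aK 0 = j,
  (forall c, chain (imem s1 aNext) (imem s1 aHead c) (out_edges j c)),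
  (forall c, imem s1 aDeg c = in_degree j c) &
  (N - j) * 8 < m2 /\ m1 + (N - j) * 8 <= m2 + N * 8].
apply: (@wp_while _ _ _ _ _ _ _ _ I); last first.
  by exists 0; split=> //; rewrite subn0; lia.
move=> s1 m2 [j [jN sj ch dg [lem1 lem2]]]; split; [by run_pure|exact: leq_ltn_trans (leq0n _) lem1| |].
- rewrite /= sj inp_N => lt.
  have [d Ed] : exists d, N - j = d.+1 by exists (N - j).-1; lia.
  have jd : N - j.+1 = d by lia.
  rewrite Ed mulSn in lem1 lem2.
  have [m3 E] : exists m3, m2 = m3.+4.+4 by exists (m2 - 8); lia.
  subst m2; simpl predn.
  have i4 := field_in size_inp (isT : 4 < 9) lt.
  have i5 := field_in size_inp (isT : 5 < 9) lt.
  have i6 := field_in size_inp (isT : 6 < 9) lt.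
  have jB : j < B by lia.
  have jW : j.+1 <= W by lia.
  have iotaS : iota 0 j.+1 = rcons (iota 0 j) j by rewrite -addn1 iotaD add0n cats1.
  have outS c : out_edges j.+1 c = if edge j && (src j == c) then j :: out_edges j c else out_edges j c.
    by rewrite /out_edges iotaS rev_rcons.
  have inS c : in_degree j.+1 c = in_degree j c + (edge j && (dst j == c)).
    by rewrite /in_degree iotaS -cats1 count_cat /= addn0.
  have fin s4 m4 : m3 < m4 -> imem s4 aK 0 = j ->
     (forall c, chain (imem s4 aNext) (imem s4 aHead c) (out_edges j.+1 c)) ->
     (forall c, imem s4 aDeg c = in_degree j.+1 c) ->
     wp cv inp B W (CStore aK (ILit 0) (IAdd (ILoad aK (ILit 0)) (ILit 1))) s4 m4 I.
    move=> lem4 k4 c4 d4; eapply wp_store; [run_pure|run_val|run_pure|rewrite /= k4 addn1; reflexivity|lia|lia|lia|].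
    by exists j.+1; split=> //; rewrite jd; lia.
  apply: wp_seq; rewrite /add_edge /valid_e /field_e /in_root /var.
  apply: wp_if; [by run_pure; rewrite sj|by []|rewrite /= sj inp_root => e; have {}e : edge j := e|
    rewrite /= sj inp_root => e; have {}e : ~~ edge j := e]; simpl predn.
  + have /andP[src0 srcn] := src_in lt e.
    have /andP[dst0 dstn] := dst_in lt e.
    have srcB : src j < B by lia.
    have dstB : dst j < B by lia.
    have hW : imem s1 aHead (src j) <= W.
      have := ch (src j); case E : (out_edges j (src j)) => [|k l] /=; first by move=> ->.
      have : k \in out_edges j (src j) by rewrite E mem_head.
      by rewrite mem_filter mem_rev mem_iota => /andP[_ kj] [-> _]; lia.
    have dW : imem s1 aDeg (dst j) + 1 <= W by rewrite dg; have := in_degree_le j (dst j); lia.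
    apply: wp_seq; eapply wp_store; [run_pure|rewrite /= sj; reflexivity|run_pure; rewrite sj //|rewrite /= sj srcE; reflexivity|conj..|].
    cbn [imem rmem predn].
    apply: wp_seq; eapply wp_store; [run_pure; rewrite sj //|rewrite /upd /= sj srcE; reflexivity|run_pure|rewrite /upd /= sj addn1; reflexivity|conj..|].
    cbn [imem rmem predn].
    eapply wp_store; [run_pure; rewrite sj //|rewrite /upd /= sj dstE; reflexivity|run_pure; rewrite sj //|rewrite /upd /= sj dstE; reflexivity|conj..|].
    cbn [imem rmem predn].
    apply: fin; [lia|exact: sj| |].
    * move=> c; rewrite outS e /upd /= eq_sym.
      have ext l x : j \notin l -> chain (imem s1 aNext) x l ->
         chain (fun i' => if i' == j then imem s1 aHead (src j) else imem s1 aNext i') x l.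
        by move=> jl; apply: eq_chain => y yl; case: eqP => // E; rewrite -E yl in jl.
      have jout c' : j \notin out_edges j c'.
        by rewrite mem_filter mem_rev mem_iota add0n ltnn !andbF.
      case: eqP => [<-|_] /=; last by apply: ext.
      by split=> //; rewrite eqxx; apply: ext.
    * by move=> c; rewrite inS e /upd /= eq_sym; case: eqP => [->|_]; rewrite dg ?addn0.
  + apply: wp_skip => //; apply: fin; [lia|exact: sj| |].
      by move=> c; rewrite outS (negbTE e).
    by move=> c; rewrite inS (negbTE e) addn0.
- rewrite /= sj inp_N => ge; have jE : j = N by lia.
  by rewrite jE in ch dg lem2; apply: H => //; lia.
Qed.

(** [q] is the whole history of the queue, of which the first [j] curves have been taken out, and
    [undone] are the edges still counted in [aDeg]. The latter is a parameter because in the middle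
    of a curve only part of its outgoing edges has been relaxed. *)
Record topo (s : state R) (q : seq nat) (j : nat) (undone : nat -> bool) : Prop := {
  topo_size : imem s aQt 0 = size q;
  topo_queue : forall i, i < size q -> imem s aQueue i = nth 0 q i;
  topo_uniq : uniq q;
  topo_in : forall c, c \in q -> 0 < c <= n;
  topo_le : j <= size q;
  topo_deg : forall c, imem s aDeg c =
    count (fun k => [&& edge k, dst k == c & undone k]) (iota 0 N);
  topo_zero : forall c, 0 < c <= n -> (c \in q) = (imem s aDeg c == 0);
  topo_order : forall k, k < N -> edge k -> dst k \in q ->
    src k \in q /\ index (src k) q < index (dst k) q }.

Lemma topo_size_le s q j undone : topo s q j undone -> size q <= n.
Proof.
move=> t; rewrite -(size_iota 1 n) uniq_leq_size ?(topo_uniq t) // => c /(topo_in t).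
by rewrite mem_iota add1n ltnS.
Qed.

Lemma wp_find_sources s m (Q : state R -> nat -> Prop) :
  imem s aQt 0 = 0 -> (forall c, imem s aDeg c = in_degree N c) ->
  n * 5 + 2 <= m ->
  (forall s' m' q, m <= m' + (n * 5 + 2) -> topo s' q 0 xpredT -> Q s' m') ->
  wp cv inp B W find_sources s m Q.
Proof.
move=> qt0 dg lem H.
have B0 : 0 < B by lia.
have W1 : 1 <= W by lia.
have [m1 E] : exists m1, m = m1.+1 by exists (m - 1); lia.
subst m.
have s0' : 0 < size inp by rewrite size_inp.
rewrite /find_sources /assign /var.
apply: wp_seq; eapply wp_store; [run_pure|run_val|run_pure|run_val|conj..|] => //.
cbn [imem rmem predn].
pose qs j := [seq c <- iota 1 j | in_degree N c == 0].
pose I (s1 : state R) m2 := exists j, [/\ j <= n, imem s1 aC 0 = j.+1,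
  imem s1 aQt 0 = size (qs j) /\ (forall i, i < size (qs j) -> imem s1 aQueue i = nth 0 (qs j) i),
  (forall c, imem s1 aDeg c = in_degree N c) &
  (n - j) * 5 < m2 /\ m1 + (n - j) * 5 <= m2 + n * 5].
apply: (@wp_while _ _ _ _ _ _ _ _ I); last first.
  by exists 0; split=> //; rewrite subn0; lia.
move=> s1 m2 [j [jN sj [qt qi] dg' [lem1 lem2]]]; split; [by run_pure|exact: leq_ltn_trans (leq0n _) lem1| |].
- rewrite /= sj inp_n addn1 ltnS => lt.
  have [d Ed] : exists d, n - j = d.+1 by exists (n - j).-1; lia.
  have jd : n - j.+1 = d by lia.
  rewrite Ed mulSn in lem1 lem2.
  have [m3 E] : exists m3, m2 = m3.+4.+1 by exists (m2 - 5); lia.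
  subst m2; simpl predn.
  have jB : j.+1 < B by lia.
  have jW : j.+1 <= W by lia.
  have iotaS : iota 1 j.+1 = rcons (iota 1 j) j.+1 by rewrite -cats1 -[[:: j.+1]]/(iota (1 + j) 1) -iotaD addn1.
  have qS : qs j.+1 = if in_degree N j.+1 == 0 then rcons (qs j) j.+1 else qs j.
    by rewrite /qs iotaS filter_rcons.
  have szj : size (qs j) <= j by rewrite size_filter -{2}(size_iota 1 j) count_size.
  have fin s4 m4 : m3 < m4 -> imem s4 aC 0 = j.+1 ->
     imem s4 aQt 0 = size (qs j.+1) ->
     (forall i, i < size (qs j.+1) -> imem s4 aQueue i = nth 0 (qs j.+1) i) ->
     (forall c, imem s4 aDeg c = in_degree N c) ->
     wp cv inp B W (CStore aC (ILit 0) (IAdd (ILoad aC (ILit 0)) (ILit 1))) s4 m4 I.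
    move=> lem4 k4 c4 d4 e4; eapply wp_store; [run_pure|run_val|run_pure|rewrite /= k4 addn1; reflexivity|lia|lia|lia|].
    by exists j.+1; split=> //; rewrite jd; lia.
  apply: wp_seq; rewrite /enqueue /assign /var.
  have qB : size (qs j) < B by lia.
  have qW : size (qs j) + 1 <= W by lia.
  apply: wp_if; [by run_pure; rewrite sj|by []|rewrite /= sj dg' => e|rewrite /= sj dg' => e]; simpl predn.
  + apply: wp_seq; eapply wp_store; [run_pure|rewrite /= qt; reflexivity|run_pure|rewrite /= sj; reflexivity|conj..|].
    cbn [imem rmem predn].
    eapply wp_store; [run_pure|run_val|run_pure|rewrite /upd /= qt; reflexivity|conj..|].
    cbn [imem rmem predn].
    apply: fin; [lia|exact: sj|by rewrite qS e size_rcons /upd /= addn1| |exact: dg'].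
    rewrite qS e size_rcons /upd /=.
    by move=> i; rewrite nth_rcons ltnS leq_eqVlt; case: (eqVneq i) => [->|_] /=; rewrite ?ltnn // => il; rewrite il qi.
  + by apply: wp_skip => //; apply: fin; rewrite ?qS ?(negbTE e) //; lia.
- rewrite /= sj inp_n addn1 ltnS => ge; have jE : j = n by lia.
  rewrite jE in qt qi lem2; apply: (H _ _ (qs n)); first by lia.
  have inq c : (c \in qs n) = (in_degree N c == 0) && (0 < c <= n).
    by rewrite mem_filter mem_iota add1n ltnS.
  split=> //.
  + by rewrite filter_uniq ?iota_uniq.
  + by move=> c; rewrite inq => /andP[].
  + by move=> c; rewrite dg'; apply: eq_count => k; rewrite andbT.
  + by move=> c cn; rewrite inq cn andbT dg'.
  + move=> k kN e; rewrite inq => /andP[/eqP z _]; move: z.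
    move/eqP; rewrite -leqn0 leqNgt -has_count => /hasP[]; exists k.
      by rewrite mem_iota.
    by rewrite e eqxx.
Qed.

(** [k :: l] stands for the unread rest of the list of the current curve: its edges are the only
    ones with a dequeued source that still count. *)
Lemma wp_relax s m q j k l (Q : state R -> nat -> Prop) :
  topo s q j (fun k' => (src k' \notin take j q) || (k' \in k :: l)) ->
  imem s aEdge 0 = k.+1 -> k < N -> edge k -> k \notin l ->
  src k \in take j q -> imem s aNext k <= N -> 8 <= m ->
  (forall s' m' q', m <= m' + 8 ->
     take j q' = take j q -> imem s' aEdge 0 = imem s aNext k ->
     topo s' q' j (fun k' => (src k' \notin take j q') || (k' \in l)) ->
     (forall a, a \notin written relax -> imem s' a = imem s a) -> Q s' m') ->
  wp cv inp B W relax s m Q.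
Proof.
move=> t ek kN e kl sk nN lem H.
have B0 : 0 < B by lia.
have [m1 E] : exists m1, m = m1.+4.+4 by exists (m - 8); lia.
subst m.
have /andP[d0 dn] := dst_in kN e.
have dB : dst k < B by lia.
have dW : dst k <= W by lia.
have kB : k < B by lia.
have nW : imem s aNext k <= W by lia.
have i5 := field_in size_inp (isT : 5 < 9) kN.
have szq := topo_size_le t.
have degW : imem s aDeg (dst k) - 1 <= W.
  rewrite (topo_deg t); apply: leq_trans (leq_subr _ _) _.
  by apply: leq_trans (count_size _ _) _; rewrite size_iota; lia.
rewrite /relax /assign /var /field_e.
apply: wp_seq; eapply wp_store; [run_pure|run_val|run_pure; by rewrite ek subn1|rewrite /= ek subn1 dstE; reflexivity|conj..|].
cbn [imem rmem predn].
apply: wp_seq; eapply wp_store; [run_pure|run_val|run_pure|run_val|conj..|].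
cbn [imem rmem predn].
apply: wp_seq; eapply wp_store; [run_pure|run_val|run_pure; by rewrite ek subn1|rewrite /upd /= ek subn1; reflexivity|conj..|].
cbn [imem rmem predn].
set u := (fun k' => (src k' \notin take j q) || (k' \in l)).
have uk : u k = false by rewrite /u sk (negbTE kl).
have deg' c : (if c == dst k then imem s aDeg (dst k) - 1 else imem s aDeg c) =
    count (fun k' => [&& edge k', dst k' == c & u k']) (iota 0 N).
  have cnt c' : count (fun k' => [&& edge k', dst k' == c' & (src k' \notin take j q) || (k' \in k :: l)]) (iota 0 N) =
    count (fun k' => [&& edge k', dst k' == c' & u k']) (iota 0 N) + (dst k == c').
    have -> : (dst k == c') = (dst k == c') * count_mem k (iota 0 N) :> nat.
      by rewrite count_uniq_mem ?iota_uniq // mem_iota kN muln1.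
    elim: (iota 0 N) => [|x r IH] /=; first by rewrite muln0.
    rewrite IH inE mulnDr addnACA; congr (_ + _).
    case: (eqVneq x k) => [->|_]; last by rewrite muln0 addn0 /u.
    by rewrite uk e muln1 /= orbT andbT andbF.
  by rewrite !(topo_deg t) !cnt; case: eqP => [->|/eqP]; rewrite ?eqxx ?addnK // eq_sym => /negbTE ->; rewrite addn0.
have degk : imem s aDeg (dst k) != 0.
  rewrite (topo_deg t) -lt0n -has_count; apply/hasP; exists k; first by rewrite mem_iota.
  by rewrite e eqxx mem_head orbT.
(* The edge [k] was still counted, so the degree was positive and the curve has not been enqueued
   before. *)
have dq : dst k \notin q by rewrite (topo_zero t) ?d0.
have zE : (if dst k == dst k then imem s aDeg (dst k) - 1 else imem s aDeg (dst k)) =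
   imem s aDeg (dst k) - 1 by rewrite eqxx.
apply: wp_if; [by run_pure|by []|rewrite /upd /= zE => z|rewrite /upd /= zE => z]; simpl predn.
- have szq' : size q < n.
    have : uniq (dst k :: q) by rewrite /= dq (topo_uniq t).
    move/uniq_leq_size => /(_ (iota 1 n)); rewrite size_iota; apply => c.
    by rewrite mem_iota add1n ltnS inE => /orP[/eqP ->|/(topo_in t)]; rewrite ?d0.
  have qB : size q < B by lia.
  have qW : size q + 1 <= W by lia.
  rewrite /enqueue /assign /var.
  apply: wp_seq; eapply wp_store; [run_pure|rewrite /upd /= (topo_size t); reflexivity|run_pure|run_val|conj..|].
  cbn [imem rmem predn].
  eapply wp_store; [run_pure|run_val|run_pure|rewrite /upd /= (topo_size t); reflexivity|conj..|].
  cbn [imem rmem predn].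
  have tk : take j (rcons q (dst k)) = take j q by rewrite -cats1 takel_cat ?(topo_le t).
  apply: (H _ _ (rcons q (dst k))) => //; [lia| |]; last first.
    move=> a; rewrite /= !inE !negb_or => /and5P[/negbTE n1 /negbTE n2 /negbTE n3 /negbTE n4 /negbTE n5].
    by apply/funext => i; rewrite /upd n1 n2 n3 n4 n5.
  rewrite tk; split=> /=; rewrite /upd /=.
  + by rewrite size_rcons addn1.
  + move=> i; rewrite size_rcons ltnS leq_eqVlt nth_rcons; case: (eqVneq i) => [->|_] /=; rewrite ?ltnn // => il.
    by rewrite il (topo_queue t).
  + by rewrite rcons_uniq dq (topo_uniq t).
  + by move=> c; rewrite mem_rcons inE => /orP[/eqP ->|/(topo_in t)] //; rewrite d0.
  + by rewrite size_rcons; apply: leq_trans (topo_le t) _.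
  + by move=> c; rewrite -deg' ?andbT.
  + move=> c cn; rewrite mem_rcons inE ?andbT (topo_zero t) //.
    by case: eqP => [_|_] //=; rewrite z.
  + have idx c : c \in q -> index c (rcons q (dst k)) = index c q by move=> cq; rewrite -cats1 index_cat cq.
    move=> k' k'N e'; rewrite !mem_rcons !inE => /orP[/eqP dE|dE].
      (* The degree of [dst k] is now 0, so every edge into it is done; its source has been dequeued
         and precedes the new last element of the queue. *)
      have : u k' = false.
        move: z; have := deg' (dst k); rewrite eqxx => ->.
        rewrite -leqn0 leqNgt -has_count => /hasPn /(_ k'); rewrite mem_iota k'N e' dE eqxx /=.
        by move=> /(_ isT) /negbTE.
      rewrite /u => /negbT; rewrite negb_or negbK => /andP[/mem_take sq _].
      have idt : index (dst k) (rcons q (dst k)) = size q.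
        by rewrite -cats1 index_cat (negbTE dq) /= eqxx addn0.
      by rewrite sq orbT dE idx // idt index_mem.
    have [sq lt] := topo_order t k'N e' dE.
    by rewrite sq orbT !idx.
- apply: wp_skip => //; apply: (H _ _ q) => //; [lia| |]; last first.
    move=> a; rewrite /= !inE !negb_or => /and5P[/negbTE n1 /negbTE n2 /negbTE n3 /negbTE n4 /negbTE n5].
    by apply/funext => i; rewrite /upd n1 n2 n3.
  split=> /=; rewrite /upd /=; try by case: t.
  move=> c cn; rewrite (topo_zero t) // ?andbT.
    by case: (eqVneq c (dst k)) => [->|_] //; rewrite (negbTE z) (negbTE degk).
Qed.

(** This is the potential of the amortised analysis: each edge leaves it once, when its source is
    processed, and pays for 9 steps, whence the linear total in [wp_toposort]. *)
Definition edges_left (j : nat) (q : seq nat) :=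
  count (fun k => edge k && (src k \notin take j q)) (iota 0 N).

Lemma wp_process_curve s m q j (Q : state R -> nat -> Prop) :
  topo s q j (fun k' => src k' \notin take j q) -> j < size q ->
  imem s aQh 0 = j ->
  (forall c, chain (imem s aNext) (imem s aHead c) (out_edges N c)) ->
  imem s aRank 0 = 0 -> (forall i, i < j -> imem s aRank (nth 0 q i) = i.+1) ->
  9 * size (out_edges N (nth 0 q j)) + 8 <= m ->
  (forall s' m' q', m <= m' + (9 * size (out_edges N (nth 0 q j)) + 8) ->
    topo s' q' j.+1 (fun k' => src k' \notin take j.+1 q') ->
    take j.+1 q' = take j.+1 q -> imem s' aQh 0 = j.+1 ->
    (forall c, chain (imem s' aNext) (imem s' aHead c) (out_edges N c)) ->
    imem s' aRank 0 = 0 -> (forall i, i < j.+1 -> imem s' aRank (nth 0 q' i) = i.+1) ->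
    Q s' m') ->
  wp cv inp B W process_curve s m Q.
Proof.
move=> t jq qh ch r0 rk lem H.
set c := nth 0 q j in lem H.
have B0 : 0 < B by lia.
have [m1 E] : exists m1, m = m1.+4 by exists (m - 4); lia.
subst m.
have cq : c \in q by rewrite mem_nth.
have /andP[c0 cn] := topo_in t cq.
have szq := topo_size_le t.
have cB : c < B by lia.
have cW : c <= W by lia.
have jB : j < B by lia.
have jW : j.+1 <= W by lia.
have outN k c' : k \in out_edges N c' -> [/\ k < N, edge k & src k = c'].
  by rewrite mem_filter mem_rev mem_iota => /andP[/andP[e /eqP s'] kN].
have chW next e l : chain next e l -> {subset l <= gtn N} -> e <= N.
  by case: l => [|k l] /= => [-> //|[-> _] /(_ k)]; rewrite mem_head; apply.
have hW : imem s aHead c <= W.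
  have : imem s aHead c <= N by apply: chW (ch c) _ => k /outN[].
  by lia.
rewrite /process_curve /assign /var.
apply: wp_seq; eapply wp_store; [run_pure; by rewrite qh|run_val|run_pure; by rewrite qh|rewrite /= qh (topo_queue t) //; reflexivity|conj..|].
cbn [imem rmem predn].
apply: wp_seq; eapply wp_store; [run_pure|run_val|run_pure|rewrite /upd /= qh addn1; reflexivity|conj..|].
cbn [imem rmem predn].
apply: wp_seq; eapply wp_store; [run_pure|run_val|run_pure|run_val|conj..|].
cbn [imem rmem predn].
apply: wp_seq; eapply wp_store; [run_pure|run_val|run_pure|run_val|conj..|].
cbn [imem rmem predn].
have tS : take j.+1 q = rcons (take j q) c by rewrite (take_nth 0).
have cnt : c \notin take j q.
  by have := take_uniq j.+1 (topo_uniq t); rewrite tS rcons_uniq => /andP[].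
set s1 := State _ _.
pose fr (s2 : state R) := [/\ imem s2 aNext = imem s aNext, imem s2 aHead = imem s aHead,
  imem s2 aQh 0 = j.+1 & imem s2 aRank = fun i => if i == c then j.+1 else imem s aRank i].
pose I (s2 : state R) m2 := exists q' l,
  [/\ topo s2 q' j.+1 (fun k' => (src k' \notin take j.+1 q') || (k' \in l)),
   take j.+1 q' = take j.+1 q, chain (imem s aNext) (imem s2 aEdge 0) l /\ fr s2,
   uniq l /\ {subset l <= out_edges N c} &
   9 * size l < m2 /\ m1 + 9 * size l <= m2 + 9 * size (out_edges N c)].
have rank_nth i : i < j -> nth 0 q i != c.
  move=> ij; apply: contraNneq cnt => <-; rewrite -(nth_take 0 ij) mem_nth // size_take.
  by rewrite jq.
apply: (@wp_while _ _ _ _ _ _ _ _ I); last first.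
  exists q, (out_edges N c); split=> //.
  - split=> //; try by case: t.
    move=> c'; apply: etrans (topo_deg t c') _; apply: eq_in_count => k; rewrite mem_iota => kN.
    case e : (edge k) => //=; congr (_ && _).
    rewrite tS mem_rcons inE mem_filter mem_rev mem_iota kN andbT e /=.
    by case: (eqVneq (src k) c) => [->|_]; rewrite ?cnt ?orbF //=.
  - split=> //; first exact: ch.
  - by split=> //; apply: filter_uniq; rewrite rev_uniq iota_uniq.
  - by move: lem; set z := size _; clear; lia.
move=> s2 m2 [q' [l [t2 tk [ch2 f2] [ul sl] [lem1 lem2]]]]; split; [by run_pure|exact: leq_ltn_trans (leq0n _) lem1| |].
- rewrite /=; case: l => [|k l] /= in t2 ch2 ul sl lem1 lem2 *; first by rewrite ch2.
  move=> _; have [ek ch3] := ch2; have /andP[kl ul'] := ul.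
  have [kN e sk] := outN _ _ (sl k (mem_head _ _)).
  have [fN fH fQ fR] := f2.
  apply: (wp_relax t2 ek kN e kl).
  + by rewrite tk tS sk mem_rcons mem_head.
  + rewrite fN; apply: chW ch3 _ => x xl.
    by have [] := outN _ _ (sl x (mem_behead (s := k :: l) xl)).
  + by move: lem1; clear; lia.
  move=> s3 m3 q3 lem3 tk3 e3 t3 f3.
  exists q3, l; split=> //; first by rewrite tk3.
  + by rewrite e3 fN; split=> //; split; rewrite !f3.
  + by split=> // x xl; apply: sl; rewrite inE xl orbT.
  + move: lem1 lem2 lem3; move: (size l) (size (out_edges N c)); clear; lia.
- rewrite /= -eqn0Ngt => /eqP z; case: l => [|k l] /= in t2 ch2 ul sl lem1 lem2 *; last by case: ch2; rewrite z.
  have [fN fH fQ fR] := f2.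
  apply: (H _ _ q') => //.
  + by move: lem1 lem2; clear; lia.
  + case: t2 => a1 a2 a3 a4 a5 a6 a7 a8; split=> //.
    by move=> c'; rewrite a6; apply: eq_count => k; rewrite orbF.
  + by move=> c'; rewrite fN fH.
  + by rewrite fR; case: eqP => // c00; rewrite -c00 in c0.
  + move=> i ij; rewrite -(nth_take 0 ij) tk nth_take // fR.
    move: ij; rewrite ltnS leq_eqVlt => /orP[/eqP ->|ij]; first by rewrite eqxx.
    by rewrite (negbTE (rank_nth _ ij)) rk.
Qed.

Lemma edges_leftS s q j undone : topo s q j undone -> j < size q ->
  edges_left j q = edges_left j.+1 q + size (out_edges N (nth 0 q j)).
Proof.
move=> t jq; rewrite /edges_left /out_edges size_filter count_rev.
have tS : take j.+1 q = rcons (take j q) (nth 0 q j) by rewrite (take_nth 0).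
have cnt : nth 0 q j \notin take j q.
  by have := take_uniq j.+1 (topo_uniq t); rewrite tS rcons_uniq => /andP[].
rewrite tS; elim: (iota 0 N) => //= k r ->; rewrite addnACA; congr (_ + _).
rewrite mem_rcons inE; case: (edge k) => //=; case: eqP => [->|_] /=; first by rewrite cnt.
by rewrite addn0.
Qed.

Lemma wp_toposort s m q (Q : state R -> nat -> Prop) :
  topo s q 0 xpredT -> imem s aQh 0 = 0 ->
  (forall c, chain (imem s aNext) (imem s aHead c) (out_edges N c)) ->
  imem s aRank 0 = 0 -> 9 * N + 9 * n + 1 <= m ->
  (forall s' m' rk, m <= m' + (9 * N + 9 * n + 1) -> imem s' aRank = rk ->
    [/\ rk 0 = 0, forall c, c <= n -> rk c <= n, forall c, 0 < c <= n -> 0 < rk c &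
      forall k, k < N -> edge k -> rk (src k) < rk (dst k)] -> Q s' m') ->
  wp cv inp B W toposort s m Q.
Proof.
move=> t qh ch r0 lem H.
have B0 : 0 < B by lia.
pose I (s1 : state R) m1 := exists q' j,
  [/\ topo s1 q' j (fun k' => src k' \notin take j q') /\ imem s1 aQh 0 = j,
    forall c, chain (imem s1 aNext) (imem s1 aHead c) (out_edges N c),
    imem s1 aRank 0 = 0, forall i, i < j -> imem s1 aRank (nth 0 q' i) = i.+1 &
    9 * edges_left j q' + 9 * (n - j) < m1 /\
    m + 9 * edges_left j q' + 9 * (n - j) <= m1 + 9 * N + 9 * n].
rewrite /toposort /var.
apply: (@wp_while _ _ _ _ _ _ _ _ I); last first.
  have el : edges_left 0 q <= N by apply: leq_trans (count_size _ _) _; rewrite size_iota.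
  exists q, 0; split=> //; last by lia.
  by split=> //; case: t => *; split=> //; rewrite take0.
move=> s1 m1 [q' [j [[t1 qh1] ch1 r1 rk1 [lem1 lem2]]]]; split; [by run_pure|exact: leq_ltn_trans (leq0n _) lem1| |].
- rewrite /= qh1 (topo_size t1) => jq.
  have jn : j < n by apply: leq_trans jq (topo_size_le t1).
  have eS := edges_leftS t1 jq.
  rewrite eS in lem1 lem2.
  have [d Ed] : exists d, n - j = d.+1 by exists (n - j).-1; lia.
  have jd : n - j.+1 = d by lia.
  rewrite Ed in lem1 lem2.
  apply: (wp_process_curve t1 jq qh1 ch1 r1 rk1); first by lia.
  move=> s2 m2 q2 lem3 t2 tk2 qh2 ch2 r2 rk2; exists q2, j.+1; split=> //.
  have -> : edges_left j.+1 q2 = edges_left j.+1 q' by rewrite /edges_left tk2.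
  by rewrite jd; lia.
- rewrite /= qh1 (topo_size t1) -leqNgt => qj.
  have jE : j = size q' by apply/eqP; rewrite eqn_leq (topo_le t1).
  apply: (H _ _ (imem s1 aRank)) => //; first by lia.
  (* By induction on [height]: once the queue is exhausted, a curve whose predecessors are all in it
     has degree 0 and is therefore in it as well. *)
  have full c : 0 < c <= n -> c \in q'.
    have [k] := ubnP (height c); elim: k c => // k IH c lt cn.
    rewrite (topo_zero t1) // (topo_deg t1) -leqn0 leqNgt -has_count; apply/hasPn => x.
    rewrite mem_iota => xN; apply/negP => /and3P[e /eqP d]; rewrite jE take_size => /negP[].
    by apply: IH; [have := acyclic xN e; rewrite d; lia|exact: src_in].
  have rkE c : 0 < c <= n -> imem s1 aRank c = (index c q').+1.
    by move=> /full cq; have := rk1 (index c q'); rewrite jE index_mem nth_index //; apply.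
  split=> // [c cn|c cn|k kN e].
  + case: c cn => [|c] cn; first by rewrite r1.
    by rewrite rkE //; apply: leq_trans (topo_size_le t1); rewrite index_mem full.
  + by rewrite rkE.
  + rewrite !rkE ?dst_in ?src_in // ltnS.
    by have [] := topo_order t1 kN e (full _ (dst_in kN e)).
Qed.

End Topo.

(** * The whole program *)

Local Open Scope prog_scope.

Definition find_size :=
  assign aL #1;;
  CWhile (var aL < #2 * in_N + in_n + #2) (assign aL (#2 * var aL)).

Definition max_ply_program :=
  find_size;; build_graph;; find_sources;; toposort;; load_traps;; sweep.

Local Close Scope prog_scope.

Section Program.
Variables (R : realType) (n : nat) (cv : 'I_n -> curve R).
Variables (inp : seq nat) (B W N root : nat).
Hypotheses (size_inp : size inp = 3 + 9 * N).
Hypotheses (inp_n : nth 0 inp 0 = n) (inp_N : nth 0 inp 1 = N)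
  (inp_root : nth 0 inp 2 = root).
Let valid := is_record inp root.
Let field := node_field inp.
Hypothesis walls_ok : forall k, k < N -> valid k ->
  field 7 k <= n.*2 /\ field 8 k <= n.*2.
Hypothesis curves_ok : forall k, k < N -> valid k ->
  field 5 k <= n /\ field 6 k <= n.
Hypothesis walls_lt : forall k, k < N -> valid k -> field 7 k != 0 ->
  field 8 k != 0 -> (event_x cv inp (2 * k) < event_x cv inp (2 * k + 1))%R.
Variable height : nat -> nat.
Hypothesis acyclic : forall k, k < N -> edge inp root k ->
  height (src inp k) < height (dst inp k).

Let h := up_log 2 (2 * N + n + 2).
Hypothesis B_big : 2 * 2 ^ h <= B.
Hypothesis W_big : 4 * (2 * N + 1) * 2 ^ h <= W.

Lemma wp_find_size s m (Q : state R -> nat -> Prop) :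
  2 * h + 2 <= m ->
  (forall s' m', m <= m' + (2 * h + 2) -> imem s' aL 0 = 2 ^ h -> Q s' m') ->
  wp cv inp B W find_size s m Q.
Proof.
move=> lem H.
have p0 : 0 < 2 ^ h by rewrite expn_gt0.
have hT : 2 * N + n + 2 <= 2 ^ h by exact: up_logP.
have hT' : 2 ^ h.-1 < 2 * N + n + 2 by rewrite up_log_gtn // addn2.
have B0 : 0 < B by lia.
have W1 : 1 <= W by nia.
have hW : 2 ^ h <= W by nia.
have [m1 E] : exists m1, m = m1.+1 by exists (m - 1); lia.
subst m.
have s0' : 0 < size inp by rewrite size_inp.
have s1' : 1 < size inp by rewrite size_inp.
rewrite /find_size /assign /var.
apply: wp_seq; eapply wp_store; [run_pure|run_val|run_pure|run_val|conj..|] => //.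
cbn [imem rmem predn].
pose I (s1 : state R) m2 := exists j, [/\ j <= h, imem s1 aL 0 = 2 ^ j,
  2 * (h - j) < m2 & m1 + 2 * (h - j) <= m2 + 2 * h].
apply: (@wp_while _ _ _ _ _ _ _ _ I); last first.
  by exists 0; split=> //; rewrite subn0; move: lem; move: (h) => x; clear; lia.
move=> s1 m2 [j [jh sj lem1 lem2]]; split; [by run_pure|exact: leq_ltn_trans (leq0n _) lem1| |].
- rewrite /= sj inp_n inp_N => lt.
  have jlt : j < h by rewrite -(ltn_exp2l _ _ (isT : 1 < 2)); apply: leq_trans lt hT.
  eapply wp_store; [run_pure|run_val|run_pure|rewrite /= sj -expnS; reflexivity|lia| | |].
  + by apply: leq_trans hW; rewrite leq_exp2l.
  + move: lem1 jlt; move: (h) => x; clear; lia.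
  + exists j.+1; split=> //; move: lem1 lem2 jlt; move: (h) => x; clear; lia.
- rewrite /= sj inp_n inp_N -leqNgt => ge.
  have hj : j = h by apply/eqP; rewrite eqn_leq jh up_log_min.
  rewrite hj in sj; apply: H => //; move: lem1 lem2; rewrite hj; move: (h) => x; clear; lia.
Qed.

Definition program_cost :=
  2 * h + 2 + (N * 8 + 2) + (n * 5 + 2) + (9 * N + 9 * n + 1) +
  (N * (30 * h + 20) + 2) + (2 * N * (30 * h + 31) + 3).

Lemma max_ply_program_correct : exists t s' rk,
  [/\ exec cv inp B W max_ply_program (init_state R) t s', t <= program_cost,
   [/\ rk 0 = 0, forall c, c <= n -> rk c <= n, forall c, 0 < c <= n -> 0 < rk c &
      forall k, k < N -> edge inp root k -> rk (src inp k) < rk (dst inp k)],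
   forall v r, r < 2 ^ h -> depth cv inp N root rk v r <= imem s' 0 0 &
   exists v, exists2 r, r < 2 ^ h & depth cv inp N root rk v r = imem s' 0 0].
Proof.
have hT : 2 * N + n + 2 <= 2 ^ h by exact: up_logP.
have Bn : N + n + 2 <= B by lia.
have Wn : N + n + 2 <= W by nia.
suff [t [s' [ex le [rk [a b c]]]]] : wp cv inp B W max_ply_program (init_state R) program_cost
  (fun s' _ => exists rk, [/\ [/\ rk 0 = 0, forall c, c <= n -> rk c <= n, forall c, 0 < c <= n -> 0 < rk c &
      forall k, k < N -> edge inp root k -> rk (src inp k) < rk (dst inp k)],
   forall v r, r < 2 ^ h -> depth cv inp N root rk v r <= imem s' 0 0 &
   exists v, exists2 r, r < 2 ^ h & depth cv inp N root rk v r = imem s' 0 0]).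
  by exists t, s', rk.
set Q := fun _ => _.
rewrite /max_ply_program.
apply: wp_seq.
have := @wp_find_size (init_state R) program_cost
  (fun s m => program_cost <= m + (2 * h + 2) /\ imem s aL 0 = 2 ^ h).
move=> /(_ ltac:(rewrite /program_cost; lia)) /(_ ltac:(by [])) /wp_frame w1.
apply: wp_conseq w1 _ => s1 m1 [[lem1 sL1] fr1].
apply: wp_seq.
have := @wp_build_graph _ _ cv inp B W N root size_inp inp_n inp_N inp_root curves_ok Bn Wn
  s1 m1 (fun s m => [/\ m1 <= m + (N * 8 + 2),
   (forall c, chain (imem s aNext) (imem s aHead c) (out_edges inp root N c)) &
    (forall c, imem s aDeg c = in_degree inp root N c)]).
move=> /(_ ltac:(by move=> c; rewrite fr1)) /(_ ltac:(by move=> c; rewrite fr1)).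
move=> /(_ ltac:(move: lem1; rewrite /program_cost; lia)) /(_ ltac:(by [])) /wp_frame w2.
apply: wp_conseq w2 _ => s2 m2 [[lem2 ch2 dg2] fr2].
apply: wp_seq.
have := @wp_find_sources _ _ cv inp B W N root size_inp inp_n inp_N inp_root Bn Wn
  s2 m2 (fun s m => m2 <= m + (n * 5 + 2) /\ exists q, topo n inp N root s q 0 xpredT).
move=> /(_ ltac:(by rewrite fr2 // fr1)) /(_ dg2).
move=> /(_ ltac:(move: lem1 lem2; rewrite /program_cost; lia)) /(_ ltac:(by move=> s' m' q; split=> //; exists q)) /wp_frame w3.
apply: wp_conseq w3 _ => s3 m3 [[lem3 [q t3]] fr3].
apply: wp_seq.
have := @wp_toposort _ _ cv inp B W N root size_inp inp_n inp_N inp_root curves_ok Bn Wn height acyclic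
  s3 m3 q (fun s m => m3 <= m + (9 * N + 9 * n + 1) /\
    let rk := imem s aRank in [/\ rk 0 = 0, forall c, c <= n -> rk c <= n, forall c, 0 < c <= n -> 0 < rk c &
      forall k, k < N -> edge inp root k -> rk (src inp k) < rk (dst inp k)]).
move=> /(_ t3) /(_ ltac:(by rewrite fr3 // fr2 // fr1)) /(_ ltac:(by move=> c; rewrite !fr3)).
move=> /(_ ltac:(by rewrite fr3 // fr2 // fr1)).
move=> /(_ ltac:(move: lem1 lem2 lem3; rewrite /program_cost; lia)).
move=> /(_ ltac:(by move=> s' m' rk lem E H; split=> //=; rewrite E)) /wp_frame w4.
apply: wp_conseq w4 _ => s4 m4 [[lem4 H4] fr4].
set rk := imem s4 aRank in H4; have [rk0 rk_le rk_gt0 rk_lt] := H4.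
have rk_edge k : k < N -> valid k -> field 5 k != 0 -> field 6 k != 0 -> rk (field 6 k) < rk (field 5 k).
  by move=> kN va f5 f6; apply: rk_lt => //; apply/and3P.
(* Memory starts at 0 and the earlier phases do not touch the tree; an all-zero tree satisfies every
   equation, so no pass is spent on building it. *)
have z a : a \in [:: aPos; aNeg; aMax; aMin] -> imem s4 a = fun=> 0.
  rewrite !inE => ain.
  by rewrite fr4 ?fr3 ?fr2 ?fr1 //; case/or4P: ain => /eqP ->.
have pr : prepared cv inp N root h rk s4 (fun=> false) (fun=> false) (fun=> false).
  have [zP zN zM zI] : [/\ imem s4 aPos = (fun=> 0), imem s4 aNeg = (fun=> 0),
     imem s4 aMax = (fun=> 0) & imem s4 aMin = (fun=> 0)] by split; apply: z.
  have t0 f r : slot_count N (fun=> false) f r = 0 by rewrite /slot_count big1.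
  split=> //; split; rewrite ?zP ?zN ?zM ?zI //.
  - by rewrite fr4 // fr3 // fr2.
  - by move=> j jL; rewrite zP zN zM zI; split=> //; left.
  - by move=> j jL; rewrite /consistent_at zP zN zM zI.
  - by move=> r _; rewrite /pos_of !t0.
  - by move=> r _; rewrite /neg_of !t0.
  - by move=> r _; rewrite /pos_of /neg_of !t0.
apply: wp_seq.
have := @wp_load_traps _ _ cv inp B W N root h size_inp inp_n inp_N inp_root walls_ok curves_ok hT B_big W_big
  rk rk0 rk_le rk_gt0 rk_edge s4 m4 _ pr; apply.
  by move: lem1 lem2 lem3 lem4; rewrite /program_cost; lia.
move=> s5 m5 lem5 pr5.
have := @wp_sweep _ _ cv inp B W N root h size_inp inp_n inp_N inp_root walls_ok curves_ok hT B_big W_big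
  rk rk0 rk_le rk_gt0 rk_edge walls_lt s5 m5 _ pr5; apply.
  by move: lem1 lem2 lem3 lem4 lem5; rewrite /program_cost; lia.
by move=> s6 m6 lem6 up dep; exists rk.
Qed.

End Program.

Import Order.TTheory GRing.Theory Num.Theory.
Import numFieldNormedType.Exports.
Local Open Scope classical_set_scope.
Local Open Scope ring_scope.


(** * The vertical order of the curves *)

Section Curves.
Variables (R : realType) (n : nat) (cv : 'I_n -> curve R).

Definition spans (c : 'I_n) (x : R) := cl (cv c) < x < cr (cv c).
Definition height_at (c : 'I_n) (x : R) := cf (cv c) x.
Definition below (b t : 'I_n) :=
  exists x, [/\ spans b x, spans t x & height_at b x < height_at t x].
Definition generic (x : R) := forall e : endpoint n, ptx cv e != x.

(** A concrete abscissa takes the place of a limit from the right: no endpoint lies over the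
    interval from [v], excluded, to [x], included. *)
Lemma right_gap (v : R) : exists2 x, v < x & forall e : endpoint n, v < ptx cv e -> x < ptx cv e.
Proof.
suff [x vx H] : exists2 x, v < x & forall e, e \in enum {: endpoint n} -> v < ptx cv e -> x < ptx cv e.
  by exists x => // e; apply: H; rewrite mem_enum.
elim: (enum _) => [|e s [x vx IH]]; first by exists (v + 1); rewrite ?ltrDl.
have [ve|ev] := ltP v (ptx cv e); last first.
  exists x => // e'; rewrite inE => /orP[/eqP ->|/IH //]; by rewrite ltNge ev.
exists (Order.min x ((v + ptx cv e) / 2)).
  by rewrite lt_min vx; lra.
move=> e'; rewrite inE gt_min => /orP[/eqP -> _|/IH H /H ->//].
by apply/orP; right; lra.
Qed.

Lemma gap_generic v x : v < x -> (forall e : endpoint n, v < ptx cv e -> x < ptx cv e) ->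
  generic x.
Proof.
move=> vx H e; apply/eqP => E; have [/H|] := ltP v (ptx cv e); first by rewrite E ltxx.
by rewrite E leNgt vx.
Qed.

Lemma gap_spans v x c : v < x -> (forall e : endpoint n, v < ptx cv e -> x < ptx cv e) ->
  cl (cv c) <= v -> v < cr (cv c) -> spans c x.
Proof.
by move=> vx H lv vr; rewrite /spans (le_lt_trans lv vx) /=; apply: (H (c, true)).
Qed.

Lemma generic_spans c x : generic x -> cl (cv c) <= x <= cr (cv c) -> spans c x.
Proof.
move=> g /andP[lx xr]; rewrite /spans !lt_neqAle lx xr.
by have := g (c, false); have := g (c, true); rewrite /ptx /= eq_sym => -> ->.
Qed.

Hypothesis dis : interior_disjoint cv.

Lemma height_neq c1 c2 x : c1 != c2 -> spans c1 x -> spans c2 x ->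
  height_at c1 x != height_at c2 x.
Proof.
move=> ne s1 s2; apply/eqP => E; have := dis ne.
rewrite -subset0 => /(_ (x, height_at c1 x)); apply.
by split; split.
Qed.

Lemma height_cont c x1 x2 : spans c x1 -> spans c x2 ->
  {within `[x1, x2], continuous (height_at c)}.
Proof.
move=> /andP[s1 _] /andP[_ s2]; apply: continuous_subspaceW (@cf_cont _ (cv c)).
move=> x /=; rewrite !in_itv /= => /andP[a b]; apply/andP; split.
  exact: ltW (lt_le_trans s1 a).
exact: ltW (le_lt_trans b s2).
Qed.

(** The difference of the two heights is continuous and, by disjointness of the interiors, has no
    zero; the intermediate value theorem fixes its sign. *)
Lemma no_crossing b t x1 x2 : x1 <= x2 -> spans b x1 -> spans t x1 -> spans b x2 -> spans t x2 ->
  b != t -> (height_at b x1 < height_at t x1) = (height_at b x2 < height_at t x2).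
Proof.
move=> le b1 t1 b2 t2 ne.
have cont : {within `[x1, x2], continuous (fun x => height_at b x - height_at t x)}.
  by move=> x; apply: cvgB; [exact: height_cont b1 b2 x|exact: height_cont t1 t2 x].
have root v : v = 0 -> Num.min (height_at b x1 - height_at t x1) (height_at b x2 - height_at t x2) <= v <= 
   Num.max (height_at b x1 - height_at t x1) (height_at b x2 - height_at t x2) -> False.
  move=> -> /(IVT le cont)[x]; rewrite in_itv /= => /andP[xa xb] /eqP.
  rewrite subr_eq0; apply/negP; apply: height_neq => //.
    by move: b1 b2 => /andP[? _] /andP[_ ?]; rewrite /spans; apply/andP; split; lra.
  by move: t1 t2 => /andP[? _] /andP[_ ?]; rewrite /spans; apply/andP; split; lra.
apply/idP/idP => lt; rewrite ltNge; apply/negP => ge; apply: (root 0) => //.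
  by rewrite ge_min le_max; apply/andP; split; apply/orP; [left|right]; lra.
by rewrite ge_min le_max; apply/andP; split; apply/orP; [right|left]; lra.
Qed.

Lemma below_irr b : ~ below b b.
Proof. by move=> [x [_ _]]; rewrite ltxx. Qed.

Lemma below_at b t x : below b t -> spans b x -> spans t x -> height_at b x < height_at t x.
Proof.
move=> bt bx tx; have ne : b != t by apply/eqP => E; move: bt; rewrite E; apply: below_irr.
have [y [by_ ty lt]] := bt; have [xy|/ltW yx] := leP x y.
  by rewrite (no_crossing xy bx tx by_ ty ne).
by rewrite -(no_crossing yx by_ ty bx tx ne).
Qed.

(* Insert the curve starting furthest to the right last: every curve that it
   overlaps is alive just right of its left endpoint, where all of them are
   linearly ordered. *)
Lemma below_acyclic : exists rho : 'I_n -> nat, forall b t, below b t -> (rho b < rho t)%N.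
Proof.
suff [rho H] : exists rho : 'I_n -> nat, forall b t, b \in [set: 'I_n]%SET -> t \in [set: 'I_n]%SET ->
    (0 < rho b)%N /\ (below b t -> (rho b < rho t)%N).
  by exists rho => b t bt; have [//|//|_] := H b t; apply.
have [k] := ubnP #|[set: 'I_n]%SET|; move: [set: 'I_n]%SET => U.
elim: k U => // k IH U; rewrite ltnS => Uk.
have [->|[c0 c0U]] := set_0Vmem U; first by exists (fun=> 0%N) => b t; rewrite inE.
pose c := [arg max_(c > c0 in U) cl (cv c)]%O.
have [cU cmax] : c \in U /\ forall d, d \in U -> cl (cv d) <= cl (cv c).
  by rewrite /c; case: arg_maxP => // i iU H; split.
have [|rho H] := IH (U :\ c)%SET; first by move: Uk; rewrite (cardsD1 c) cU.
have [x cx gap] := right_gap (cl (cv c)).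
have alive d : d \in U -> below d c \/ below c d -> spans d x.
  move=> dU bd; apply: (gap_spans cx gap); first exact: cmax.
  by case: bd => -[y [/andP[dl dr] /andP[cl_ cr_] _]]; lra.
have cspan : spans c x by apply: (gap_spans cx gap) => //; apply: cl_lt_cr.
pose M := \max_(d in U :\ c | `[< below d c >]) rho d.
(* Doubling the old values leaves room to place [c] just above the highest curve below it. All
   values are kept positive so that [M < rho t] also holds when no curve lies below [c] and [M] is
   0. *)
exists (fun d => if d == c then (2 * M + 1)%N else (2 * rho d)%N) => b t bU tU.
have inU d : d \in U -> d != c -> d \in (U :\ c)%SET by move=> dU dc; rewrite !inE dc.
split.
  case: eqVneq => [_|bc]; first by rewrite addn1.
  by have [//|//|] := H b b; rewrite ?inU // muln_gt0.
case: (eqVneq b c) => [->|bc]; case: (eqVneq t c) => [->|tc] bt.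
- by have := below_irr bt.
- have [//|//|r0 _] := H t t; rewrite ?inU //.
  suff : (M < rho t)%N by lia.
  rewrite -(prednK r0) ltnS; apply/bigmax_leqP => d /andP[dU /asboolP dc].
  rewrite -ltnS (prednK r0); have [//|//|_] := H d t; rewrite ?inU //; apply.
  have dU' : d \in U by move: dU; rewrite inE => /andP[].
  exists x; split; [by apply: alive => //; left|by apply: alive => //; right|].
  apply: lt_trans (below_at dc _ cspan) (below_at bt cspan _).
    by apply: alive => //; left.
  by apply: alive => //; right.
- suff : (rho b <= M)%N by lia.
  by apply: (@leq_bigmax_cond _ _ rho); rewrite inU //; apply/asboolP.
- by have [//|//|_] := H b t; rewrite ?inU // => /(_ bt); lia.
Qed.

End Curves.

(** * The recorded trapezoids *)

Section History.
Variables (R : realType) (n : nat) (cv : 'I_n -> curve R).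

Lemma trapezoid_sub (X : {set 'I_n}) D z : trapezoid cv X D -> D z -> ~ skeleton cv X z.
Proof. by move=> [z0 _ ->] /connected_component_sub. Qed.

Lemma trapezoid_off_curves (X : {set 'I_n}) D z c : trapezoid cv X D -> D z -> c \in X ->
  ~ on_curve (cv c) z.
Proof. by move=> tD Dz cX on; apply: (trapezoid_sub tD Dz); right; exists c. Qed.

Lemma trapezoid_nonempty (X : {set 'I_n}) D : trapezoid cv X D -> exists z, D z.
Proof. by move=> [z nz ->]; exists z; apply: connected_component_refl. Qed.

Variable N : nat.

Lemma replaced_top (c : 'I_n) (H H' : dag n N) k d kq kc :
  replaced cv c H' k d kq kc ->
  exists nd, [/\ H' k = Some nd, nd_trap nd = Some d & nd_kind nd <> Leaf].
Proof.
move=> [hp np hq nq [a [b [hc _ _]]]].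
have [Dp|/np kqk] := pselect (region cv d (pt cv (c, false))).
  by have [l E _] := hp Dp; eexists; split; [exact: E|..].
have [Dq|/nq kck] := pselect (region cv d (pt cv (c, true))).
  have [r E _] := hq Dq; exists (Node (Some d) (PointNode (c, true) kc r)).
  by rewrite -kqk E kqk eqxx.
exists (Node (Some d) (CurveNode c a b)).
by rewrite -{1}kqk -kck hc kck kqk eqxx.
Qed.

Lemma replaced_new (c : 'I_n) (H' : dag n N) k d kq kc j nd :
  replaced cv c H' k d kq kc -> j \in [:: kq; kc] -> j != k -> H' j = Some nd ->
  nd_trap nd = None.
Proof.
move=> [hp np hq nq [a [b [hc _ _]]]].
rewrite !inE => /orP[]/eqP -> ne; last by rewrite hc => -[<-] /=; rewrite (negbTE ne).
have [Dp|/np kqk] := pselect (region cv d (pt cv (c, false))); last by rewrite kqk eqxx in ne.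
have [Dq|/nq kck] := pselect (region cv d (pt cv (c, true))).
  by have [r -> _] := hq Dq => -[<-] /=; rewrite (negbTE ne).
by rewrite -kck hc => -[<-] /=; rewrite kck (negbTE ne).
Qed.

(** Thereby every record of the new DAG is one of the old DAG or that of a new leaf, since the other
    new nodes carry none. *)
Lemma step_cases X c (H H' : dag n N) j nd' : dag_step cv X c H H' -> H' j = Some nd' ->
  [\/ H j = Some nd',
      exists d, [/\ hit cv c H j d, nd_trap nd' = Some d & nd_kind nd' <> Leaf],
      H j = None /\ nd_kind nd' = Leaf |
      nd_trap nd' = None /\ nd_kind nd' <> Leaf].
Proof.
move=> st E'; have [keep [kq [kc [rep fresh _ new]]] _ _ _] := st.
case E : (H j) => [nd|].
  have [[d hd]|nh] := pselect (exists d, hit cv c H j d).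
    have [nd2 [E2 t2 k2]] := replaced_top H (rep _ _ hd).
    apply: Or42; exists d; split=> //; move: E2; rewrite E' => -[->] //.
  by apply: Or41; rewrite -E' -E; symmetry; rewrite (keep _ _ E nh) E.
case: (new _ _ E E') => [leaf|[k [d [hd jin]]]]; first exact: Or43.
have jk : j != k by apply/eqP => jk; case: hd; rewrite /leaf_at -jk E.
case K : (nd_kind nd') => [|e l r|c' a b].
- exact: Or43.
- by apply: Or44; split; [apply: replaced_new (rep _ _ hd) jin jk E'|].
- by apply: Or44; split; [apply: replaced_new (rep _ _ hd) jin jk E'|].
Qed.

Lemma step_mono X c (H H' : dag n N) j nd : dag_step cv X c H H' -> H j = Some nd ->
  H' j = Some nd \/ exists d nd', [/\ hit cv c H j d, H' j = Some nd',
     nd_trap nd' = Some d & nd_kind nd' <> Leaf].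
Proof.
move=> st E; have [keep [kq [kc [rep _ _ _]]] _ _ _] := st.
have [[d hd]|nh] := pselect (exists d, hit cv c H j d); last by left; apply: keep.
have [nd2 [E2 t2 k2]] := replaced_top H (rep _ _ hd).
by right; exists d, nd2.
Qed.

Variables (ins : 'S_n) (root : 'I_N).

Let prefix := prefix_set ins.

(** The clause [rec_dead] is what keeps [rec_inj] true: the region of an inner node meets an
    inserted curve, whereas that of a leaf is a trapezoid of the current map and avoids them all. *)
Record recorded (i : nat) (H : dag n N) : Prop := {
  rec_dead : forall j nd d, H j = Some nd -> nd_trap nd = Some d ->
    nd_kind nd <> Leaf -> exists z c, [/\ region cv d z, c \in prefix i & on_curve (cv c) z];
  rec_leaf : forall j t, (0 < i)%N -> H j = Some (Node t Leaf) ->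
    exists d, [/\ t = Some d, wf_trap cv d & trapezoid cv (prefix i) (region cv d)];
  rec_wf : forall j nd d, H j = Some nd -> nd_trap nd = Some d -> wf_trap cv d;
  rec_trapezoid : forall j nd d, H j = Some nd -> nd_trap nd = Some d -> j != root ->
    exists2 i', (1 <= i' <= i)%N & trapezoid cv (prefix i') (region cv d);
  rec_inj : forall j1 j2 nd1 nd2 d1 d2, H j1 = Some nd1 -> H j2 = Some nd2 ->
    nd_trap nd1 = Some d1 -> nd_trap nd2 = Some d2 ->
    region cv d1 = region cv d2 -> j1 = j2;
  rec_onto : forall i' D, (1 <= i' <= i)%N -> trapezoid cv (prefix i') D ->
    exists j nd d, [/\ H j = Some nd, nd_trap nd = Some d, region cv d = D & j != root];
  rec_root : exists nd, [/\ H root = Some nd, nd_trap nd = Some (Trap None None None None) &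
    (0 < i)%N -> nd_kind nd <> Leaf] }.

Lemma prefixS (i : 'I_n) : ins i \in prefix i.+1.
Proof. by apply/imsetP; exists i; rewrite ?inE. Qed.

Lemma prefix_mono i j : (i <= j)%N -> prefix i \subset prefix j.
Proof.
move=> ij; apply/fintype.subsetP => c /imsetP[k]; rewrite inE => ki ->.
by apply/imsetP; exists k; rewrite // inE (leq_trans ki).
Qed.

Lemma recorded0 (H : dag n N) :
  (forall k, H k = if k == root then Some (Node (Some (Trap None None None None)) Leaf) else None) ->
  recorded 0 H.
Proof.
move=> E; split.
- by move=> j nd d; rewrite E; case: eqP => // _ [<-].
- by [].
- by move=> j nd d; rewrite E; case: eqP => // _ [<-] [<-].
- by move=> j nd d; rewrite E; case: eqP.
- by move=> j1 j2 nd1 nd2 d1 d2; rewrite !E; case: eqP => // ->; case: eqP.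
- by move=> i' D; case: i'.
- by eexists; rewrite E eqxx; split.
Qed.

Lemma recordedS (i : 'I_n) (H H' : dag n N) :
  recorded i H -> dag_step cv (prefix i.+1) (ins i) H H' -> recorded i.+1 H'.
Proof.
move=> rc st; have [_ _ leaves onto inj] := st.
have subp : prefix i \subset prefix i.+1 by apply: prefix_mono.
have dead : forall j nd d, H' j = Some nd -> nd_trap nd = Some d ->
    nd_kind nd <> Leaf -> exists z c, [/\ region cv d z, c \in prefix i.+1 & on_curve (cv c) z].
  move=> j nd d E t k; case: (step_cases st E) => [E1|[d' [h t' _]]|[_ //]|[t0 _]].
  - have [z [c [rz cX on]]] := rec_dead rc E1 t k.
    by exists z, c; split=> //; apply: (fintype.subsetP subp).
  - move: t; rewrite t' => -[<-]; have [_ [z rz on]] := h.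
    by exists z, (ins i); split=> //; apply: prefixS.
  - by rewrite t0 in t.
have leaf j t : H' j = Some (Node t Leaf) ->
    exists d, [/\ t = Some d, wf_trap cv d & trapezoid cv (prefix i.+1) (region cv d)].
  exact: leaves.
have leafE nd : nd_kind nd = Leaf -> nd = Node (nd_trap nd) Leaf :> node n N.
  by case: nd => t k /= ->.
have old j nd d : H' j = Some nd -> nd_trap nd = Some d -> nd_kind nd <> Leaf ->
    exists2 nd0, H j = Some nd0 & nd_trap nd0 = Some d.
  move=> E t k; case: (step_cases st E) => [E1|[d' [h t' _]]|[_ //]|[t0 _]].
  - by exists nd.
  - by move: t; rewrite t' => -[<-]; have [lf _] := h; eexists; [exact: lf|].
  - by rewrite t0 in t.
have root_dead : exists nd, [/\ H' root = Some nd, nd_trap nd = Some (Trap None None None None) &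
     nd_kind nd <> Leaf].
  have [nd [E t k]] := rec_root rc.
  case: (step_mono st E) => [E'|[d [nd' [[lf _] E' t' k']]]].
    exists nd; split=> // kl.
    (* Were the root still a leaf, the whole plane would be a trapezoid of the new map, but it
       contains the left endpoint of the inserted curve. *)
    have [d [td _ tz]] := leaf root (nd_trap nd) ltac:(by rewrite E' {1}(leafE _ kl)).
    have dE : d = Trap None None None None by move: td; rewrite t => -[].
    pose p := pt cv (ins i, false).
    apply: (trapezoid_off_curves (z := p) tz _ (prefixS i)).
      by rewrite dE.
    by split=> //=; rewrite lexx ltW //; apply: cl_lt_cr.
  exists nd'; split=> //; rewrite t'; move: E t; rewrite lf => -[<-] /=.
  by [].
have kindP (nd : node n N) : nd_kind nd = Leaf \/ nd_kind nd <> Leaf.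
  by case: (nd_kind nd); [left|right|right].
split=> //.
- by move=> j t _; apply: leaf.
- move=> j nd d E t; have [kl|kn] := kindP nd.
    have [d' [td wf _]] := leaf j (nd_trap nd) ltac:(by rewrite E {1}(leafE _ kl)).
    by move: td; rewrite t => -[->].
  by have [nd0 E0 t0] := old _ _ _ E t kn; apply: rec_wf rc _ _ _ E0 t0.
- move=> j nd d E t jr; have [kl|kn] := kindP nd.
    have [d' [td _ tz]] := leaf j (nd_trap nd) ltac:(by rewrite E {1}(leafE _ kl)).
    by exists i.+1; rewrite ?leqnn //; move: td; rewrite t => -[->].
  have [nd0 E0 t0] := old _ _ _ E t kn.
  have [i' /andP[i1 i2] tz] := rec_trapezoid rc E0 t0 jr.
  by exists i' => //; rewrite i1 (leq_trans i2).
- have clash j1 j2 nd1 nd2 d1 d2 : H' j1 = Some nd1 -> H' j2 = Some nd2 ->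
      nd_trap nd1 = Some d1 -> nd_trap nd2 = Some d2 -> region cv d1 = region cv d2 ->
      nd_kind nd1 = Leaf -> nd_kind nd2 <> Leaf -> False.
    move=> E1 E2 t1 t2 rE k1 k2.
    have [d' [td _ tz]] := leaf j1 (nd_trap nd1) ltac:(by rewrite E1 {1}(leafE _ k1)).
    have [z [c [rz cX on]]] := dead _ _ _ E2 t2 k2.
    apply: (trapezoid_off_curves tz _ cX on).
    by move: td; rewrite t1 => -[<-]; rewrite rE.
  move=> j1 j2 nd1 nd2 d1 d2 E1 E2 t1 t2 rE.
  have [k1|k1] := kindP nd1; have [k2|k2] := kindP nd2.
  + apply: (inj _ _ d1 d2) => //; rewrite /leaf_at.
      by rewrite E1 (leafE _ k1) t1.
    by rewrite E2 (leafE _ k2) t2.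
  + by case: (clash _ _ _ _ _ _ E1 E2 t1 t2 rE k1 k2).
  + by case: (clash _ _ _ _ _ _ E2 E1 t2 t1 (esym rE) k2 k1).
  + have [n1 F1 u1] := old _ _ _ E1 t1 k1; have [n2 F2 u2] := old _ _ _ E2 t2 k2.
    exact: (rec_inj rc F1 F2 u1 u2 rE).
- move=> i' D /andP[i1]; rewrite leq_eqVlt => /orP[/eqP ->|]; last first.
    rewrite ltnS => i2 tD.
    have [j [nd [d [E t rE jr]]]] := rec_onto rc (introT andP (conj i1 i2)) tD.
    case: (step_mono st E) => [E'|[d' [nd' [[lf _] E' t' k']]]]; first by exists j, nd, d.
    exists j, nd', d; split=> //; rewrite t'.
    by move: E; rewrite lf => -[ndE]; move: t; rewrite -ndE.
  move=> /onto[j [d [lf rE]]]; exists j, (Node (Some d) Leaf), d; split=> //.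
  apply/eqP => jr; have [nd [E _ k]] := root_dead.
  by move: E; rewrite -jr lf => -[ndE]; apply: k; rewrite -ndE.
- by have [nd [E t k]] := root_dead; exists nd; split.
Qed.

Lemma history_recorded (G : 'I_N -> node n N) : history_dag cv ins root G ->
  recorded n (fun k => Some (G k)).
Proof.
move=> [H [H0 HS Hn]].
have -> : (fun k => Some (G k)) = H n by apply/funext => k; rewrite Hn.
have : forall i, (i <= n)%N -> recorded i (H i).
  elim=> [|i IH] lt; first exact: recorded0.
  exact: (@recordedS (Ordinal lt) _ _ (IH (ltnW lt)) (HS (Ordinal lt))).
exact.
Qed.

End History.

(** * Reading the input *)

Section Encoded.
Local Open Scope nat_scope.
Variables (n N : nat) (root : 'I_N) (G : 'I_N -> node n N).

Let inp := encode root G.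
Let block (k : 'I_N) := enc_kind (nd_kind (G k)) ++ enc_trap (nd_trap (G k)).

Lemma size_block k : size (block k) = 9.
Proof. by rewrite size_cat; case: (nd_kind (G k)) => *; case: (nd_trap (G k)). Qed.

Lemma size_blocks (s : seq 'I_N) : size (flatten [seq block k | k <- s]) = 9 * size s.
Proof. by elim: s => //= k s IH; rewrite size_cat size_block IH mulnS. Qed.

Lemma nth_blocks (s : seq 'I_N) k0 i j : j < 9 -> i < size s ->
  nth 0 (flatten [seq block k | k <- s]) (j + 9 * i) = nth 0 (block (nth k0 s i)) j.
Proof.
move=> j9; elim: s i => //= k s IH [|i] lt; rewrite nth_cat size_block.
  by rewrite muln0 addn0 j9.
by rewrite mulnS addnCA ltnNge leq_addr /= addKn IH.
Qed.

Lemma size_encode : size inp = 3 + 9 * N.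
Proof. by rewrite /inp /encode size_cat size_blocks size_enum_ord. Qed.

Lemma encode_n : nth 0 inp 0 = n. Proof. by []. Qed.
Lemma encode_N : nth 0 inp 1 = N. Proof. by []. Qed.
Lemma encode_root : nth 0 inp 2 = root. Proof. by []. Qed.

Lemma field_encode (k : 'I_N) j : j < 9 -> node_field inp j k = nth 0 (block k) j.
Proof.
move=> j9; rewrite /node_field /inp /encode -addnA nth_cat [size _]/= ltnNge leq_addr [~~ true]/= addKn.
by rewrite (nth_blocks k) ?size_enum_ord // nth_ord_enum.
Qed.

Lemma nth_block (k : 'I_N) j : nth 0 (block k) (4 + j) = nth 0 (enc_trap (nd_trap (G k))) j.
Proof.
rewrite nth_cat (_ : size (enc_kind _) = 4); last by case: (nd_kind (G k)).
by rewrite ltnNge leq_addr /= addKn.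
Qed.

(** The record of the root is the whole plane, the face of the empty map, which [Tstar] leaves
    out. *)
Definition record_at (k : 'I_N) := if k == root then None else nd_trap (G k).

Lemma is_record_encode (k : 'I_N) : is_record inp root k = isSome (record_at k).
Proof.
rewrite /is_record field_encode // (nth_block k 0) /record_at -val_eqE /=.
by case: ifP => _; rewrite ?andbF // andbT; case: (nd_trap (G k)).
Qed.

Lemma record_at_nd k d : record_at k = Some d -> nd_trap (G k) = Some d /\ k != root.
Proof. by rewrite /record_at; case: eqVneq. Qed.

Lemma fields_encode k d : record_at k = Some d ->
  [/\ node_field inp 5 k = enc_option (@enc_curve n) (tr_top d),
      node_field inp 6 k = enc_option (@enc_curve n) (tr_bot d),
      node_field inp 7 k = enc_option (@enc_endpoint n) (tr_left d) &
      node_field inp 8 k = enc_option (@enc_endpoint n) (tr_right d)].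
Proof.
move=> /record_at_nd[E _].
by rewrite !field_encode // (nth_block k 1) (nth_block k 2) (nth_block k 3) (nth_block k 4) E.
Qed.

Lemma is_record_at k : k < N -> is_record inp root k ->
  exists (kN : k < N) d, record_at (Ordinal kN) = Some d.
Proof.
move=> kN; have := is_record_encode (Ordinal kN) => /= ->.
by case E : (record_at _) => [d|//] _; exists kN, d.
Qed.

Lemma enc_curve_le (c : option 'I_n) : enc_option (@enc_curve n) c <= n.
Proof. by case: c => //= c; apply: ltn_ord. Qed.

Lemma enc_endpoint_lt (e : endpoint n) : enc_endpoint e < n.*2.
Proof. by case: e => c [] /=; rewrite /enc_endpoint /=; have := ltn_ord c; lia. Qed.

Lemma enc_endpoint_le (e : option (endpoint n)) : enc_option (@enc_endpoint n) e <= n.*2.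
Proof. by case: e => //= e; apply: enc_endpoint_lt. Qed.

Lemma fields_le k : k < N -> is_record inp root k ->
  (node_field inp 7 k <= n.*2 /\ node_field inp 8 k <= n.*2) /\ (node_field inp 5 k <= n /\ node_field inp 6 k <= n).
Proof.
move=> kN /(is_record_at kN)[kN' [d /fields_encode[/= -> -> -> ->]]].
by rewrite !enc_curve_le !enc_endpoint_le.
Qed.

Lemma handle_x_endpoint (R : realType) (cv : 'I_n -> curve R) (e : endpoint n) :
  handle_x cv (enc_endpoint e) = ptx cv e.
Proof.
rewrite /handle_x /endpoint_at /enc_endpoint /curve_at.
have -> : ((e.1 : nat).*2 + e.2)./2 = e.1 :> nat by case: e => c [] /=; lia.
rewrite valK /=; congr ptx; case: e => c b /=; congr pair.
by rewrite oddD odd_double; case: b.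
Qed.

Lemma event_x_left (R : realType) (cv : 'I_n -> curve R) k :
  event_x cv inp (2 * k) = handle_x cv (node_field inp 7 k - 1).
Proof. by rewrite /event_x (event_handleE encode_N encode_root size_encode) mulKn // (_ : 2 * k %% 2 = 0) ?modnMr. Qed.

Lemma event_x_right (R : realType) (cv : 'I_n -> curve R) k :
  event_x cv inp (2 * k + 1) = handle_x cv (node_field inp 8 k - 1).
Proof.
rewrite /event_x (event_handleE encode_N encode_root size_encode) (_ : (2 * k + 1) %/ 2 = k); last by lia.
by rewrite (_ : (2 * k + 1) %% 2 = 1) //; lia.
Qed.

End Encoded.

(** * Records as trapezoids, and ranks as an extension of the vertical order *)

Section Reduction.
Variables (R : realType) (n : nat) (cv : 'I_n -> curve R) (ins : 'S_n).
Variables (N : nat) (root : 'I_N) (G : 'I_N -> node n N).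
Hypotheses (dis : interior_disjoint cv) (n0 : (0 < n)%N).
Hypothesis rc : recorded cv ins root n (fun k => Some (G k)).

Let inp := encode root G.
Let trap_at := record_at root G.

Lemma trap_at_wf k d : trap_at k = Some d -> wf_trap cv d.
Proof. by move=> /record_at_nd[E _]; apply: rec_wf rc _ _ _ (erefl _) E. Qed.

Lemma trap_at_Tstar k d : trap_at k = Some d -> Tstar cv ins (region cv d).
Proof. move=> /record_at_nd[E kr]; by have [i' i'n tz] := rec_trapezoid rc (erefl (Some (G k))) E kr; exists i'. Qed.

Lemma trap_at_inj k1 k2 d1 d2 : trap_at k1 = Some d1 -> trap_at k2 = Some d2 ->
  region cv d1 = region cv d2 -> k1 = k2.
Proof.
by move=> /record_at_nd[E1 _] /record_at_nd[E2 _]; apply: (rec_inj rc (erefl _) (erefl _) E1 E2).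
Qed.

Lemma trap_at_onto D : Tstar cv ins D -> exists k d, trap_at k = Some d /\ region cv d = D.
Proof.
move=> [i in_ tD]; have [j [nd [d [[ndE] t rE jr]]]] := rec_onto rc in_ tD.
by exists j, d; rewrite /trap_at /record_at (negbTE jr) ndE.
Qed.

Lemma trap_at_nonempty k d : trap_at k = Some d -> exists z, region cv d z.
Proof. by move=> /trap_at_Tstar[i _ /trapezoid_nonempty]. Qed.

(** [wf_trap] gives closed bounds only, but lying between the walls is an open condition: applying
    it slightly to the left and to the right of [z] makes the bounds strict. *)
Lemma wall_spans d z c : wf_trap cv d -> region cv d z ->
  tr_bot d = Some c \/ tr_top d = Some c -> spans cv c z.1.
Proof.
move=> wf [[zl zr] _ _] bt.
have W x : between_walls cv d x -> cl (cv c) <= x <= cr (cv c).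
  by move=> /wf[]; case: bt => ->.
have [x1 x1z W1] : exists2 x1, x1 < z.1 & between_walls cv d x1.
  case El : (tr_left d) zl => [e|] zl.
    exists ((ptx cv e + z.1) / 2); first by lra.
    split; first by rewrite El; lra.
    by case: (tr_right d) zr => // e' zr; apply: lt_trans zr; lra.
  exists (z.1 - 1); first by lra.
  split; first by rewrite El.
  by case: (tr_right d) zr => // e' zr; apply: lt_trans zr; lra.
have [x2 x2z W2] : exists2 x2, z.1 < x2 & between_walls cv d x2.
  case Er : (tr_right d) zr => [e|] zr.
    exists ((ptx cv e + z.1) / 2); first by lra.
    split; last by rewrite Er; lra.
    by case: (tr_left d) zl => // e' zl; apply: lt_trans zl _; lra.
  exists (z.1 + 1); first by lra.
  split; last by rewrite Er.
  by case: (tr_left d) zl => // e' zl; apply: lt_trans zl _; lra.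
by have := W _ W1; have := W _ W2; rewrite /spans; lra.
Qed.

Lemma edge_below k d b t : trap_at k = Some d -> tr_bot d = Some b -> tr_top d = Some t ->
  below cv b t.
Proof.
move=> E Eb Et; have [z rz] := trap_at_nonempty E; have wf := trap_at_wf E.
exists z.1; split; [by apply: wall_spans rz _ => //; left|by apply: wall_spans rz _ => //; right|].
by case: rz => _; rewrite Eb Et; apply: lt_trans.
Qed.

Lemma walls_ordered k : (k < N)%N -> is_record inp root k -> node_field inp 7 k != 0%N ->
  node_field inp 8 k != 0%N -> event_x cv inp (2 * k) < event_x cv inp (2 * k + 1).
Proof.
move=> kN /(is_record_at kN)[kN' [d E]].
have [/= _ _ f7 f8] := fields_encode E; rewrite event_x_left event_x_right f7 f8.
have [z [[zl zr] _ _]] := trap_at_nonempty E.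
case: (tr_left d) zl => // e1 zl _; case: (tr_right d) zr => // e2 zr _.
by rewrite /= !subn1 /= !handle_x_endpoint; apply: lt_trans zl zr.
Qed.

Lemma edges_acyclic : exists height : nat -> nat,
  forall k, (k < N)%N -> edge inp root k -> (height (src inp k) < height (dst inp k))%N.
Proof.
have [rho H] := below_acyclic dis.
exists (fun c => if insub c.-1 is Some c' then rho c' else 0%N) => k kN.
move=> /and3P[va f5 f6]; have [kN' [d E]] := is_record_at kN va; move: f5 f6.
have [/= e5 e6 _ _] := fields_encode E; rewrite /src /dst e5 e6.
case Et : (tr_top d) => [t|] //= _; case Eb : (tr_bot d) => [b|] //= _.
by rewrite !valK; apply: H; apply: edge_below E Eb Et.
Qed.

Variable rk : nat -> nat.
Hypotheses (rk0 : rk 0%N = 0%N) (rk_le : forall c, (c <= n)%N -> (rk c <= n)%N)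
  (rk_gt0 : forall c, (0 < c <= n)%N -> (0 < rk c)%N)
  (rk_lt : forall k, (k < N)%N -> edge inp root k -> (rk (src inp k) < rk (dst inp k))%N).

Lemma rk_edge k d b t : trap_at k = Some d -> tr_bot d = Some b -> tr_top d = Some t ->
  (rk b.+1 < rk t.+1)%N.
Proof.
move=> E Eb Et; have := rk_lt (ltn_ord k).
have [e5 e6 _ _] := fields_encode E; rewrite /src /dst e5 e6 Eb Et /=; apply.
by rewrite /edge e5 e6 Eb Et /= andbT is_record_encode -/(trap_at k) E.
Qed.

Lemma prefix_full c : c \in prefix_set ins n.
Proof.
by apply/imsetP; exists ((ins^-1)%g c); rewrite ?inE ?ltn_ord // permKV.
Qed.

(* Between two vertically consecutive curves lies a trapezoid of the final map
   that has them as bottom and top. *)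
Lemma rk_height x a b : generic cv x -> spans cv a x -> spans cv b x ->
  height_at cv a x < height_at cv b x -> (rk a.+1 < rk b.+1)%N.
Proof.
move=> gx; pose between a b := [set c | `[< spans cv c x /\ height_at cv a x < height_at cv c x < height_at cv b x >]]%SET.
(* Induction on the number of curves strictly between [a] and [b] at [x]: a curve in between splits
   the pair into two pairs with fewer. *)
have [m] := ubnP #|between a b|; elim: m a b => // m IH a b; rewrite ltnS => le sa sb ab.
have [E|[c]] := set_0Vmem (between a b); last first.
  rewrite inE => /asboolP[sc /andP[ac cb]].
  have cbt : c \in between a b by rewrite inE; apply/asboolP; split=> //; rewrite ac.
  have sub a' b' : a' \in [:: a; c] -> b' \in [:: c; b] -> c \notin between a' b' ->
      (#|between a' b'| < m)%N.
    move=> a'P b'P cn; apply: leq_trans le; apply: proper_card; apply/properP; split.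
      apply/fintype.subsetP => e; rewrite !inE => -[se /andP[h1 h2]]; split=> //; apply/andP; split.
        by move: a'P h1; rewrite !inE => /orP[]/eqP -> // h1; apply: lt_trans h1.
      by move: b'P h2; rewrite !inE => /orP[]/eqP -> // h2; apply: lt_trans cb.
    by exists c.
  have notin a' b' : ~~ (height_at cv a' x < height_at cv c x < height_at cv b' x) ->
      c \notin between a' b'.
    by move=> h; rewrite inE; apply/asboolP => -[_]; apply/negP.
  apply: (@ltn_trans (rk c.+1)); apply: IH => //;
    by apply: sub; [rewrite !inE eqxx ?orbT|rewrite !inE eqxx ?orbT|
      apply: notin; rewrite ltxx ?andbF].
have none c : spans cv c x -> height_at cv a x < height_at cv c x -> height_at cv c x < height_at cv b x -> False.
  move=> sc h1 h2; have : c \in between a b by rewrite inE; apply/asboolP; rewrite h1 h2.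
  by rewrite E inE.
(* The point halfway avoids the walls because [x] is generic, and the curves because none lies in
   between; so it lies in a trapezoid of the final map. *)
pose y := (height_at cv a x + height_at cv b x) / 2.
have ay : height_at cv a x < y by rewrite /y; lra.
have yb : y < height_at cv b x by rewrite /y; lra.
have nsk : ~ skeleton cv (prefix_set ins n) (x, y).
  case=> [[e [_ /= xe _]]|[c _ [/= cx cy]]]; first by have := gx e; rewrite xe eqxx.
  by apply: (none c); rewrite ?(generic_spans gx) // /height_at -cy.
pose D := connected_component (~` skeleton cv (prefix_set ins n)) (x, y).
have tD : trapezoid cv (prefix_set ins n) D by exists (x, y).
have Dz : D (x, y) by apply: connected_component_refl.
have [k [d [Ed rE]]] : exists k d, trap_at k = Some d /\ region cv d = D.
  by apply: trap_at_onto; exists n; rewrite ?leqnn ?n0.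
have rz : region cv d (x, y) by rewrite rE.
have wf := trap_at_wf Ed.
have off c z : on_curve (cv c) z -> ~ region cv d z.
  by move=> on; rewrite rE => Dz'; apply: (trapezoid_off_curves tD Dz' (prefix_full c) on).
have on c : spans cv c x -> on_curve (cv c) (x, height_at cv c x).
  by move=> /andP[h1 h2]; split=> //=; rewrite !ltW.
have [[wl wr] zb zt] := rz.
(* A missing or lower bottom would put a point of [a] into the trapezoid, a higher one would lie
   between [a] and [b]; disjointness leaves only [a]. The top is symmetric. *)
have Eb : tr_bot d = Some a.
  case Eb : (tr_bot d) zb => [c|] zb; last first.
    case: (off a _ (on a sa)); split=> //=; first by rewrite Eb.
    by case: (tr_top d) zt => // t; apply: lt_trans.
  have sc : spans cv c x by apply: (wall_spans wf rz); left.
  have [ca|ac|ca] := ltgtP (height_at cv c x) (height_at cv a x).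
  - case: (off a _ (on a sa)); split=> //=; first by rewrite Eb.
    by case: (tr_top d) zt => // t; apply: lt_trans.
  - by case: (none c sc ac); apply: lt_trans zb yb.
  - congr Some; apply/eqP/negPn/negP => ne.
    by have := height_neq dis ne sc sa; rewrite ca eqxx.
have Et : tr_top d = Some b.
  case Et : (tr_top d) zt => [c|] zt; last first.
    case: (off b _ (on b sb)); split=> //=; last by rewrite Et.
    by case: (tr_bot d) zb => // t zb; apply: lt_trans zb yb.
  have sc : spans cv c x by apply: (wall_spans wf rz); right.
  have [cb|bc|cb] := ltgtP (height_at cv c x) (height_at cv b x).
  - by case: (none c sc _ cb); apply: lt_trans ay zt.
  - case: (off b _ (on b sb)); split=> //=; last by rewrite Et.
    by case: (tr_bot d) zb => // t zb; apply: lt_trans zb yb.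
  - congr Some; apply/eqP/negPn/negP => ne.
    by have := height_neq dis ne sc sb; rewrite cb eqxx.
exact: rk_edge Ed Eb Et.
Qed.

(** Moving slightly to the right reaches a generic abscissa where the two curves are in the same
    order. *)
Lemma rk_below b t : below cv b t -> (rk b.+1 < rk t.+1)%N.
Proof.
move=> bt; have [x0 [bx tx lt]] := bt; have [x x0x gap] := right_gap cv x0.
have bx' : spans cv b x by case/andP: bx => h1 h2; apply: (gap_spans x0x gap) => //; apply: ltW.
have tx' : spans cv t x by case/andP: tx => h1 h2; apply: (gap_spans x0x gap) => //; apply: ltW.
exact: (rk_height (gap_generic x0x gap) bx' tx' (below_at dis bt bx' tx')).
Qed.

Definition in_region (z : R * R) (k : 'I_N) :=
  if trap_at k is Some d then `[< region cv d z >] else false.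

Definition ply (z : R * R) := #|[set k | in_region z k]%SET|.

(** On the records other than that of the root, [region] is injective and its image is [Tstar], so
    listing the records around [z] gives the bijection. Ply 0 is separate because [nth] needs a
    default. *)
Lemma has_ply_ply z : has_ply cv ins z (ply z).
Proof.
pose A := [set k | in_region z k]%SET.
have [/card0_eq A0|A_gt0] := posnP (ply z).
  rewrite /has_ply (_ : [set D | _] = set0); last first.
    apply/seteqP; split=> // D [/trap_at_onto[k [d [E rE]]] Dz].
    have := A0 k; rewrite !inE /in_region E => /asboolP; apply.
    by rewrite rE.
  by rewrite (_ : ply z = 0%N) ?II0 ?card_eq00 //; apply/eq_card0.
have [k0 k0A] : exists k0, k0 \in A by apply/card_gt0P.
pose g (i : nat) := if trap_at (nth k0 (enum A) i) is Some d then region cv d else set0.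
have A_in i : (i < ply z)%N -> nth k0 (enum A) i \in A.
  by move=> iA; rewrite -mem_enum mem_nth // -cardE.
rewrite /has_ply (_ : [set D | _] = g @` `I_(ply z)); last first.
  apply/seteqP; split=> D.
    move=> [/trap_at_onto[k [d [E rE]]] Dz].
    have kA : k \in A by rewrite inE /in_region E; apply/asboolP; rewrite rE.
    exists (index k (enum A)); first by rewrite /= /ply cardE index_mem mem_enum.
    by rewrite /g nth_index ?mem_enum // E.
  move=> [i /= iA <-]; have := A_in i iA; rewrite inE /in_region /g.
  case E : (trap_at _) => [d|//] /asboolP rz; split=> //.
  exact: trap_at_Tstar E.
apply: inj_card_eq => i j; rewrite !inE /= => iA jA.
have := A_in i iA; have := A_in j jA; rewrite !inE /in_region /g.
case E1 : (trap_at _) => [d1|//] _; case E2 : (trap_at _) => [d2|//] _ rE.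
by have := trap_at_inj E2 E1 rE => /eqP; rewrite nth_uniq ?enum_uniq -?cardE // => /eqP ->.
Qed.

End Reduction.

(** * Depth of the rectangles against ply of the points *)

Lemma separate (R : realType) (s1 s2 : seq R) :
  (forall a b, a \in s1 -> b \in s2 -> a < b) ->
  exists y, (forall a, a \in s1 -> a < y) /\ (forall b, b \in s2 -> y < b).
Proof.
move=> lt.
(* A bound that is weak towards [s1] and strict towards [s2] leaves room for [y] above it, and it
   exists for empty lists too. *)
have [M HM H1] : exists2 M, (forall b, b \in s2 -> M < b) & forall a, a \in s1 -> a <= M.
  elim: s1 lt => [|a s1 IH] lt.
    clear lt; have : exists M, forall b, b \in s2 -> M < b.
      elim: s2 => [|b s [M HM]]; first by exists 0.
      exists (Num.min M (b - 1)) => x; rewrite inE gt_min => /orP[/eqP ->|/HM -> //].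
      by apply/orP; right; lra.
    by move=> [M HM]; exists M.
  have [|M HM H1] := IH; first by move=> x b xs; apply: lt; rewrite inE xs orbT.
  exists (Num.max M a) => [b bs|x]; first by rewrite gt_max HM // lt // mem_head.
  by rewrite inE le_max => /orP[/eqP ->|/H1 ->]; rewrite ?lexx ?orbT.
clear lt; have [y My H2] : exists2 y, M < y & forall b, b \in s2 -> y < b.
  elim: s2 HM => [|b s IH] HM; first by exists (M + 1); rewrite ?ltrDl.
  have [|y My Hy] := IH; first by move=> x xs; apply: HM; rewrite inE xs orbT.
  have Mb : M < b by apply: HM; rewrite mem_head.
  exists (Num.min y ((M + b) / 2)); first by rewrite lt_min My; lra.
  move=> x; rewrite inE gt_min => /orP[/eqP ->|/Hy -> //].
  by apply/orP; right; lra.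
by exists y; split=> // a /H1 aM; apply: le_lt_trans aM My.
Qed.

Section Depth.
Variables (R : realType) (n : nat) (cv : 'I_n -> curve R) (ins : 'S_n).
Variables (N : nat) (root : 'I_N) (G : 'I_N -> node n N).
Hypotheses (dis : interior_disjoint cv) (n0 : (0 < n)%N).
Hypothesis rc : recorded cv ins root n (fun k => Some (G k)).

Let inp := encode root G.
Let trap_at := record_at root G.

Variable rk : nat -> nat.
Hypotheses (rk0 : rk 0%N = 0%N) (rk_le : forall c, (c <= n)%N -> (rk c <= n)%N)
  (rk_gt0 : forall c, (0 < c <= n)%N -> (0 < rk c)%N)
  (rk_lt : forall k, (k < N)%N -> edge inp root k -> (rk (src inp k) < rk (dst inp k))%N).

Definition bot_rank (d : trap n) := if tr_bot d is Some b then rk b.+1 else 0%N.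
Definition top_rank (d : trap n) := if tr_top d is Some t then rk t.+1 else n.+1.

Lemma alive_trap k d v r : trap_at k = Some d ->
  alive cv inp root rk k v r =
  [&& if tr_left d is Some e then ptx cv e <= v else true,
      if tr_right d is Some e then v < ptx cv e else true,
      (bot_rank d <= r)%N & (r < top_rank d)%N].
Proof.
move=> E; rewrite /alive is_record_encode -/(trap_at k) E /=.
have [/= f5 f6 f7 f8] := fields_encode E.
congr [&& _, _, _ & _].
- rewrite /started event_x_left f7; case: (tr_left d) => //= e.
  by rewrite subn1 handle_x_endpoint.
- rewrite /ended event_x_right f8; case: (tr_right d) => //= e.
  by rewrite subn1 handle_x_endpoint -ltNge.
- by rewrite /bpos f6 /bot_rank; case: (tr_bot d) => //=; rewrite rk0.
- by rewrite /tpos f5 /top_rank; case: (tr_top d) => [t|] //=; rewrite rk0 addn0 mul1n addn1.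
Qed.

Lemma in_region_trap z k : in_region cv root G z k -> exists2 d, trap_at k = Some d & region cv d z.
Proof. by rewrite /in_region -/(trap_at k); case E : (trap_at k) => [d|//] /asboolP; exists d. Qed.

(** At the common point [z] the bottom of one trapezoid lies under the top of the other, and ranks
    extend [below]; so the two rank intervals intersect. *)
Lemma bot_rank_lt_top_rank z k1 d1 k2 d2 : trap_at k1 = Some d1 -> trap_at k2 = Some d2 ->
  region cv d1 z -> region cv d2 z -> (bot_rank d1 < top_rank d2)%N.
Proof.
move=> E1 E2 r1 r2; rewrite /bot_rank /top_rank.
have w1 := trap_at_wf rc E1; have w2 := trap_at_wf rc E2.
case Eb : (tr_bot d1) => [b|]; case Et : (tr_top d2) => [t|] //.
- apply: (rk_below dis n0 rc rk_lt); exists z.1; split.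
  + by apply: (wall_spans w1 r1); left.
  + by apply: (wall_spans w2 r2); right.
  + by case: r1 r2 => _ h _ [_ _]; rewrite Eb in h; rewrite Et; apply: lt_trans.
- by rewrite ltnS rk_le.
- by rewrite rk_gt0 /=.
Qed.

Lemma ply_sum z : ply cv root G z = (\sum_(k < N) in_region cv root G z k)%N.
Proof.
rewrite /ply -sum1_card big_mkcond; apply: eq_bigr => k _.
by rewrite inE; case: (in_region _ _ _ _ _).
Qed.

(** One-dimensional Helly: the rank intervals of the trapezoids around [z] intersect pairwise, so
    the largest of their bottom ranks lies in all of them. *)
Lemma ply_le_depth z : exists2 r, (r <= n)%N & (ply cv root G z <= depth cv inp N root rk z.1 r)%N.
Proof.
pose r := (\max_(k | in_region cv root G z k) (if trap_at k is Some d then bot_rank d else 0))%N.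
have bn d : (bot_rank d <= n)%N by rewrite /bot_rank; case: (tr_bot d) => // b; rewrite rk_le.
exists r.
  by apply/bigmax_leqP => k _; case: (trap_at k).
rewrite ply_sum; apply: leq_sum => k _.
case E : (in_region _ _ _ _ _) => //.
have [d Ed rz] := in_region_trap E.
rewrite (alive_trap _ _ Ed); have [[wl wr] _ _] := rz.
have -> : (if tr_left d is Some e then ptx cv e <= z.1 else true) = true.
  by case: (tr_left d) wl => // e; apply: ltW.
have -> : (if tr_right d is Some e then z.1 < ptx cv e else true) = true.
  by case: (tr_right d) wr.
have -> : (bot_rank d <= r)%N.
  by have := @leq_bigmax_cond _ _ (fun k => if trap_at k is Some d then bot_rank d else 0)%N k E; rewrite Ed.
have -> // : (r < top_rank d)%N.
have t0 : (0 < top_rank d)%N by apply: leq_ltn_trans (bot_rank_lt_top_rank Ed Ed rz rz).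
rewrite -(prednK t0) ltnS; apply/bigmax_leqP => k' /in_region_trap[d' Ed' rz'].
by rewrite Ed' -ltnS (prednK t0); apply: bot_rank_lt_top_rank Ed' Ed rz' rz.
Qed.

(** Trapezoids are open while [alive] admits a left wall at [v] itself, so the point is taken at a
    generic [x] just to the right. There heights and ranks agree, and some [y] separates the curves
    of rank at most [r] from the others. *)
Lemma depth_le_ply v r : exists z, (depth cv inp N root rk v r <= ply cv root G z)%N.
Proof.
have [x vx gap] := right_gap cv v; have gx := gap_generic vx gap.
pose lower := [seq height_at cv c x | c <- enum 'I_n & spans cv c x && (rk c.+1 <= r)%N].
pose upper := [seq height_at cv c x | c <- enum 'I_n & spans cv c x && (r < rk c.+1)%N].
have [|y [yl yu]] := @separate R lower upper.
  move=> a b /mapP[c1 + ->] /mapP[c2 + ->].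
  rewrite !mem_filter => /andP[/andP[s1 r1] _] /andP[/andP[s2 r2] _].
  have ne : c1 != c2 by apply/eqP => E; move: r1; rewrite E leqNgt r2.
  case: ltgtP => [//|gt|E]; last by have := height_neq dis ne s1 s2; rewrite E eqxx.
  have := rk_height dis n0 rc rk_lt gx s2 s1 gt.
  by rewrite ltnNge (leq_trans r1 (ltnW r2)).
exists (x, y); rewrite ply_sum; apply: leq_sum => k _.
case Ea : (alive _ _ _ _ _ _ _) => //.
have [d Ed] : exists d, trap_at k = Some d.
  move: Ea; rewrite /alive is_record_encode -/(trap_at k); case: (trap_at k) => // d _.
  by exists d.
rewrite /in_region -/(trap_at k) Ed.
move: Ea; rewrite (alive_trap _ _ Ed) => /and4P[wl wr br tr].
have W : between_walls cv d x.
  split.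
    by case: (tr_left d) wl => // e ev; apply: le_lt_trans ev vx.
  by case: (tr_right d) wr => // e; apply: gap.
have [wb wt] := trap_at_wf rc Ed W.
rewrite (_ : `[< _ >]) //; apply/asboolP; split=> //=.
- case Eb : (tr_bot d) wb => [c|] // /(generic_spans gx) sc; apply: yl.
  apply/mapP; exists c => //; rewrite mem_filter sc mem_enum andbT /=.
  by move: br; rewrite /bot_rank Eb.
- case Et : (tr_top d) wt => [c|] // /(generic_spans gx) sc; apply: yu.
  apply/mapP; exists c => //; rewrite mem_filter sc mem_enum andbT /=.
  by move: tr; rewrite /top_rank Et.
Qed.

End Depth.

(** * Time, space and word size in terms of [n] *)

Section Bounds.
Local Open Scope nat_scope.
Variables (c n N : nat).
Hypotheses (n0 : 0 < n) (Nn : N <= c * n).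
Let h := up_log 2 (2 * N + n + 2).

(** The summands up to [99 * c + 26] come from the time bound, with [2 * c + 5] for replacing [h] by
    the logarithm of [n]. The square and the final 2 form the exponent of the word bound, and
    [4 * (2 * c + 3)] is the space bound. *)
Definition constant :=
  (90 * c + 2) * (2 * c + 5) + (99 * c + 26) + 8 * (2 * c + 3) ^ 2 + 4 * (2 * c + 3) + 2.

Lemma leaves_bound : 2 ^ h <= 2 * (2 * c + 3) * n.
Proof.
have lt : 2 ^ h.-1 < 2 * N + n + 2 by rewrite up_log_gtn // addn2.
have h0 : 0 < h by rewrite up_log_gt0 // addn2.
rewrite -(prednK h0) expnS -mulnA leq_mul2l /=.
move: lt n0 Nn; move: (2 ^ _) => x; clear; nia.
Qed.

(** The crude [2 * c + 3 < 2 ^ (2 * c + 3)] turns the factor by which [N] may exceed [n] into an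
    additive constant. *)
Lemma log_bound : h <= trunc_log 2 n + (2 * c + 4).
Proof.
have lt : 2 ^ h.-1 < 2 * N + n + 2 by rewrite up_log_gtn // addn2.
have nt : n < 2 ^ (trunc_log 2 n).+1 by apply: trunc_log_ltn.
have ct : 2 * c + 3 < 2 ^ (2 * c + 3) by apply: ltn_expl.
suff : 2 ^ h.-1 < 2 ^ ((2 * c + 3) + (trunc_log 2 n).+1).
  by rewrite ltn_exp2l //; move: (h) (trunc_log 2 n) => x t; clear; lia.
rewrite expnD; apply: leq_trans lt _.
apply: leq_trans (_ : (2 * c + 4) * n.+1 <= _); last by apply: leq_mul nt; rewrite [_ + 4]addnS.
move: n0 Nn; clear; nia.
Qed.

(** The logarithm vanishes for [n = 1]; this is the case that the [+ 1] of the time bound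
    absorbs. *)
Lemma linear_bound : n <= n * trunc_log 2 n + 1.
Proof.
have [n1|n1] := leqP n 1; first by rewrite (leq_trans n1) // addn1.
by rewrite addn1 leqW // leq_pmulr // trunc_log_gt0 // n1.
Qed.

Lemma cost_bound : program_cost n N <= constant * (n * trunc_log 2 n + 1).
Proof.
have hb := log_bound; have lb := linear_bound.
rewrite /program_cost -/h; set t := trunc_log 2 n in hb lb *.
have c1 : 2 * h + 2 + (N * 8 + 2) + (n * 5 + 2) + (9 * N + 9 * n + 1) +
  (N * (30 * h + 20) + 2) + (2 * N * (30 * h + 31) + 3) <= (90 * c + 2) * (n * h) + (99 * c + 26) * n.
  move: n0 Nn; move: (h) => x; clear; nia.
apply: leq_trans c1 _.
have c2 : n * h <= (2 * c + 5) * (n * t + 1).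
  apply: leq_trans (_ : n * (t + (2 * c + 4)) <= _); first by rewrite leq_mul2l hb orbT.
  rewrite mulnDr; move: lb; move: (n * t) => x; clear; nia.
apply: leq_trans (_ : ((90 * c + 2) * (2 * c + 5) + (99 * c + 26)) * (n * t + 1) <= _).
  rewrite [X in _ <= X]mulnDl -[X in _ <= X + _]mulnA; apply: leq_add; first by rewrite leq_mul2l c2 orbT.
  by rewrite leq_mul2l lb orbT.
by rewrite leq_mul2r; apply/orP; right; rewrite /constant -!addnA !leq_add2l leq_addr.
Qed.

Lemma space_bound : 2 * 2 ^ h <= constant * n.
Proof.
apply: leq_trans (_ : 2 * (2 * (2 * c + 3) * n) <= _); first by rewrite leq_mul2l leaves_bound.
rewrite mulnA leq_mul2r; apply/orP; right; rewrite /constant.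
move: ((90 * c + 2) * _) (_ ^ 2) => x y; clear; lia.
Qed.

(** The left side is at most [K * n ^ 2], and since [n] is positive the factor moves into the
    exponent by [K < 2 ^ K <= n.+1 ^ K]. *)
Lemma word_bound : 4 * (2 * N + 1) * 2 ^ h <= n.+1 ^ constant.
Proof.
pose K := 8 * (2 * c + 3) ^ 2.
have K0 : 0 < K by rewrite /K muln_gt0 expn_gt0 addnS.
apply: (@leq_trans (n ^ 2 * K)).
  apply: leq_trans (_ : (4 * ((2 * c + 3) * n)) * (2 * (2 * c + 3) * n) <= _).
    apply: leq_mul leaves_bound; rewrite leq_mul2l /=.
    move: n0 Nn; clear; nia.
  rewrite /K; clear; nia.
have CK : 2 + K <= constant by rewrite /constant -/K; clear K0; move: K => k; clear; lia.
apply: leq_trans (_ : n.+1 ^ (2 + K) <= _); last by rewrite leq_exp2l.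
rewrite expnD leq_mul ?leq_exp2r //.
by apply: leq_trans (ltnW (ltn_expl K (isT : 1 < 2))) _; rewrite leq_exp2r.
Qed.

End Bounds.

Theorem mainTheorem4 (R : realType) :
  exists P : cmd, forall c : nat, exists C : nat,
  forall (n : nat) (cv : 'I_n -> curve R) (ins : 'S_n)
         (N : nat) (root : 'I_N) (G : 'I_N -> node n N),
    interior_disjoint cv ->
    general_position cv ->
    history_dag cv ins root G ->
    (N <= c * n)%N ->
    exists (t : nat) (s : state R),
      [/\ exec cv (encode root G) (C * n) (n.+1 ^ C)%N P (init_state R) t s,
          (t <= C * (n * trunc_log 2 n + 1))%N &
          is_max_ply cv ins (imem s 0 0)].
Proof.
exists max_ply_program => c; exists (constant c) => n cv ins N root G dis _ hist Nn.
(* The root is a name in ['I_N], so [N] is positive, and [N <= c * n] excludes [n = 0]. *)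
have n0 : (0 < n)%N.
  rewrite lt0n; apply/negP => /eqP n00; move: Nn; rewrite n00 muln0 leqn0 => /eqP N0.
  by have := ltn_ord root; rewrite [X in (_ < X)%N]N0.
have rc := history_recorded hist.
have [height acyc] := edges_acyclic dis rc.
have [t [s [rk [ex le [rk0 rk_le rk_gt0 rk_lt] up [v [r rh dep]]]]]] :=
  max_ply_program_correct (size_encode root G) (encode_n root G) (encode_N root G) (encode_root root G)
   (fun k kN va => (fields_le kN va).1) (fun k kN va => (fields_le kN va).2)
   (walls_ordered rc) acyc (space_bound n0 Nn) (word_bound n0 Nn).
exists t, s; split=> //; first exact: leq_trans le (cost_bound n0 Nn).
have upper z : (ply cv root G z <= imem s 0 0)%N.
  have [r' r'n le'] := ply_le_depth dis n0 rc rk0 rk_le rk_gt0 rk_lt z.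
  apply: leq_trans le' (up _ _ _).
  by apply: leq_trans (up_logP _ (isT : (1 < 2)%N)); lia.
split=> [z|]; first by exists (ply cv root G z); [exact: has_ply_ply|].
(* The pair [(v, r)] attains the maximal depth, so some point has at least this ply, and [upper]
   forbids more. *)
have [z zle] := depth_le_ply dis n0 rc rk0 rk_lt v r.
exists z; rewrite (_ : imem s 0 0 = ply cv root G z); first exact: has_ply_ply.
by apply/eqP; rewrite eqn_leq upper -dep zle.
Qed.
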